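(* Let $T>0$, $\nu>0$, $\alpha^2>0$, $\beta>0$, and let $(w,\lambda)$ be a solution on $[0,T]$ of the hybrid penalty/artificial-compression model $$w_t+w\cdot\nabla w+\tfrac12(\nabla\cdot w)w-\nu\Delta w+\nabla\lambda=f,\qquad \lambda_t+2\beta\,\nabla\cdot w_t+\alpha^2\,\nabla\cdot w=0\quad\text{in }\Omega\times(0,T],$$ with $w=0$ on $\partial\Omega\times(0,T]$, $w(\cdot,0)=w_0$ and $\lambda(\cdot,0)=\lambda_0$ in $\Omega$. Then the model is unconditionally stable, in the sense that $$\|w(T)\|^2+\alpha^{-2}\|(\lambda+2\beta\,\nabla\cdot w)(T)\|^2+\int_0^T\big(\nu\|\nabla w\|^2+4\beta\|\nabla\cdot w\|^2\big)\,dt\le\int_0^T\frac1\nu\|f\|_{-1}^2\,dt+\|w_0\|^2+\alpha^{-2}\|\lambda_0+2\beta\,\nabla\cdot w_0\|^2 .$$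
   Context: $\Omega\subset\mathbb{R}^d$ ($d=2,3$) is a regular bounded domain; $(\cdot,\cdot)$ and $\|\cdot\|$ are the $L^2(\Omega)$ inner product and norm. $X=(H_0^1(\Omega))^d$, $Q=L_0^2(\Omega)=\{q\in L^2(\Omega):\int_\Omega q\,dx=0\}$, and $\|f\|_{-1}=\sup_{0\ne v\in X}\frac{(f,v)}{\|\nabla v\|}$. The trilinear form is $b^*(u,v,w)=(u\cdot\nabla v,w)+\frac12((\nabla\cdot u)v,w)$ for $u,v,w\in X$. A solution of the model is understood through its weak formulation: $(w(t),\lambda(t))\in X\times Q$ and, for (almost every) $t\in(0,T]$, $$(w_t,v)+b^*(w,w,v)+\nu(\nabla w,\nabla v)-(\lambda,\nabla\cdot v)=(f,v)\quad\forall v\in X,$$ $$(\lambda_t+2\beta\,\nabla\cdot w_t+\alpha^2\,\nabla\cdot w,q)=0\quad\forall q\in Q,$$ with time regularity such that the terms above make sense: $w\in L^2(0,T;X)$, $w_t\in L^2(0,T;(L^2(\Omega))^d)$, $\nabla\cdot w_t\in L^2(0,T;L^2(\Omega))$, $\lambda\in H^1(0,T;Q)$, and $f\in L^2(0,T;(H^{-1}(\Omega))^d)$. *)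

(* Defs.v *)
From HB Require Import structures.
From mathcomp Require Import all_boot all_order all_algebra.
From mathcomp Require Import all_classical all_reals all_analysis.

Set Implicit Arguments.
Unset Strict Implicit.
Unset Printing Implicit Defensive.

Import Order.TTheory GRing.Theory Num.Theory.
Import numFieldNormedType.Exports.

Local Open Scope classical_set_scope.
Local Open Scope ring_scope.

Definition measure_rV_display : measure_display -> measure_display.
Proof. exact. Qed.

Section measurable_rV.
Context (R : realType) (n : nat).

Let coord : 'I_n -> 'rV[R]_n -> R := fun i x => x ord0 i.

Let rV_set0 : g_sigma_preimage coord set0.
Proof. exact: sigma_algebra0. Qed.

Let rV_setC A : g_sigma_preimage coord A -> g_sigma_preimage coord (~` A).
Proof. exact: sigma_algebraC. Qed.

Let rV_bigcup (F : (set 'rV[R]_n)^nat) :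
  (forall i, g_sigma_preimage coord (F i)) ->
  g_sigma_preimage coord (\bigcup_i (F i)).
Proof. exact: sigma_algebra_bigcup. Qed.

(* The product sigma-algebra, i.e. the Borel sets of R^n. *)
HB.instance Definition _ := @isMeasurable.Build
  (measure_rV_display default_measure_display)
  'rV[R]_n (g_sigma_preimage coord) rV_set0 rV_setC rV_bigcup.

Lemma measurable_coord (i : 'I_n) :
  measurable_fun [set: 'rV[R]_n] (fun x : 'rV[R]_n => x ord0 i).
Proof.
move=> _ Y mY; rewrite setTI; apply: sub_sigma_algebra => /=.
rewrite -bigcup_seq/=; exists i => /=; first by rewrite mem_index_enum.
by exists Y => //; rewrite setTI.
Qed.

Lemma measurable_fun_rVP d (T : measurableType d) (f : T -> 'rV[R]_n) :
  (forall i, measurable_fun [set: T] (fun x => f x ord0 i)) ->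
  measurable_fun [set: T] f.
Proof.
move=> mf _ A mA; rewrite setTI.
pose G := [set B : set 'rV[R]_n | measurable (f @^-1` B)].
suff : measurable `<=` G by exact.
apply: smallest_sub.
  split; rewrite /G /=.
  - by rewrite preimage_set0.
  - by move=> B mB; rewrite setTD -preimage_setC; exact: measurableC.
  - by move=> F mF; rewrite preimage_bigcup; exact: bigcup_measurable.
rewrite -bigcup_seq; apply: bigcup_sub => i _ B [C mC <-].
rewrite /G /= setTI -[X in measurable X]setTI.
exact: (mf i).
Qed.

End measurable_rV.

Section rV_cons.
Context (R : realType) (n : nat).

Definition rV_cons (p : measurableTypeR R * 'rV[R]_n) : 'rV[R]_n.+1 :=
  \row_i if unlift ord0 i is Some j then p.2 ord0 j else p.1.

Definition rV_uncons (x : 'rV[R]_n.+1) : measurableTypeR R * 'rV[R]_n :=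
  (x ord0 ord0, \row_j x ord0 (lift ord0 j)).

Lemma rV_consK : cancel rV_cons rV_uncons.
Proof.
move=> [a x]; rewrite /rV_uncons /rV_cons mxE unlift_none; congr pair.
by apply/rowP => j; rewrite !mxE liftK.
Qed.

Lemma measurable_rV_cons : measurable_fun setT rV_cons.
Proof.
apply: measurable_fun_rVP => i.
under eq_fun do rewrite mxE.
case: unliftP => [j _|_] /=; last exact: measurable_fst.
apply: (@measurableT_comp _ _ _ _ _ _ (fun x : 'rV[R]_n => x ord0 j)) => //.
exact: measurable_coord.
Qed.

Lemma measurable_rV_uncons : measurable_fun setT rV_uncons.
Proof.
apply: measurable_fun_pair; first exact: measurable_coord.
apply: measurable_fun_rVP => i; under eq_fun do rewrite mxE.
exact: measurable_coord.
Qed.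

Context (m : {sigma_finite_measure set 'rV[R]_n -> \bar R}).

Definition leb_succ : set 'rV[R]_n.+1 -> \bar R :=
  pushforward (lebesgue_measure \x m)%E rV_cons.

HB.instance Definition _ := Measure.copy leb_succ
  (measure_function_pushforward__canonical__measure_function_Measure
     (lebesgue_measure \x m)%E measurable_rV_cons).

Let leb_succ_sigma_finite : sigma_finite setT leb_succ.
Proof.
have /sigma_finiteP[F [TF ndF Foo]] := sigma_finiteT (@lebesgue_measure R).
have /sigma_finiteP[G [TG ndG Goo]] := sigma_finiteT m.
exists (fun k => rV_uncons @^-1` (F k `*` G k)).
  rewrite -preimage_bigcup -[LHS](preimage_setT rV_uncons); congr (_ @^-1` _).
  rewrite -setXTT TF TG predeqE => -[x y]; split.
    move=> [/= [i _ Fx] [k _ Gy]]; exists (maxn i k) => //; split.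
    - by move: x Fx; exact/subsetPset/ndF/leq_maxl.
    - by move: y Gy; exact/subsetPset/ndG/leq_maxr.
  by move=> [k _ []/= ? ?]; split; exists k.
move=> k; have [mF Fk] := Foo k; have [mG Gk] := Goo k; split.
  rewrite -[X in measurable X]setTI; apply: measurable_rV_uncons => //.
  exact: measurableX.
rewrite /leb_succ /pushforward /=.
have -> : rV_cons @^-1` (rV_uncons @^-1` (F k `*` G k)) = F k `*` G k.
  rewrite -comp_preimage (_ : rV_uncons \o rV_cons = id) ?preimage_id//.
  by apply/funext => p; exact: rV_consK.
by rewrite product_measure1E// lte_mul_pinfty// ge0_fin_numE.
Qed.

HB.instance Definition _ := Measure_isSigmaFinite.Build _ _ _ leb_succ
  leb_succ_sigma_finite.

End rV_cons.

Fixpoint leb (R : realType) (n : nat) :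
    {sigma_finite_measure set 'rV[R]_n -> \bar R} :=
  match n with
  | 0 => \d_(0 : 'rV[R]_0)
  | k.+1 => leb_succ (leb R k)
  end.

Lemma leb_box (R : realType) (n : nat) (A : 'I_n -> set R) :
  (forall i, measurable (A i)) ->
  leb R n [set x | forall i, A i (x ord0 i)] =
  (\prod_(i < n) lebesgue_measure (A i))%E.
Proof.
elim: n A => [|n IH] A mA.
  rewrite big_ord0 /=; set S := (X in dirac _ X).
  have -> : S = setT by apply/seteqP; split => // x _ [].
  exact: diracT.
pose B := [set x : 'rV[R]_n | forall i, A (lift ord0 i) (x ord0 i)].
have mB : measurable B.
  have -> : B = \bigcap_(i in [set: 'I_n])
      ((fun x : 'rV[R]_n => x ord0 i) @^-1` A (lift ord0 i)).
    by apply/seteqP; split => [x Ax i _|x Ax i]; [exact: Ax|exact: (Ax i I)].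
  apply: fin_bigcap_measurable => // i _.
  by rewrite -[X in measurable X]setTI; apply: measurable_coord.
rewrite big_ord_recl -(IH (fun i => A (lift ord0 i)))// -/B.
rewrite -product_measure1E//=; last exact: (mA ord0).
rewrite /leb_succ /pushforward.
congr product_measure1; apply/seteqP; split => -[a x] /=.
  move=> H; split; first by have := H ord0; rewrite mxE unlift_none.
  by move=> i; have := H (lift ord0 i); rewrite mxE liftK.
move=> [Aa Bx] i; rewrite mxE.
by case: unliftP => [j|] ->.
Qed.

Section spaces.
Context (R : realType) (d : nat).

Local Notation E := 'rV[R]_d.
Local Notation vfield := ('I_d -> E -> R).

Definition unitv (i : 'I_d) : E := delta_mx ord0 i.

Definition dotv (x y : E) : R := \sum_i x ord0 i * y ord0 i.

(* Near each boundary point, [Om] is the set of points lying strictly above a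
   Lipschitz graph in some unit direction [e].  The graph is given by a
   function [g] on the whole space that is constant in the direction [e]. *)
Definition lipschitz_boundary (Om : set E) : Prop :=
  forall x, (closure Om `\` interior Om) x ->
  exists (e : E) (r L : R) (g : E -> R),
    [/\ dotv e e = 1, 0 < r,
        forall y z, `|g y - g z| <= L * `|y - z|,
        forall y s, g (y + s *: e) = g y &
        forall y, ball x r y -> (Om y <-> g y < dotv y e)].

Definition regular_bounded_domain (Om : set E) : Prop :=
  [/\ open Om, connected Om, Om !=set0, bounded_set Om & lipschitz_boundary Om].

Definition pderiv (s : seq 'I_d) (phi : E -> R) : E -> R :=
  foldr (fun i h x => 'D_(unitv i) h x) phi s.

Definition smooth (phi : E -> R) : Prop :=
  forall s : seq 'I_d, continuous (pderiv s phi) /\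
    forall i x, derivable (pderiv s phi) x (unitv i).

Definition Ccinfty (Om : set E) : set (E -> R) :=
  [set phi | smooth phi /\ exists K : set E,
     [/\ compact K, K `<=` Om & forall x, ~ K x -> phi x = 0]].

Definition time_test (T : R) : set (R -> R) :=
  [set psi : R -> R | (forall n x, derivable (derive1n n psi) x 1) /\
     exists a b, [/\ 0 < a, b < T & forall t, ~ (a <= t <= b) -> psi t = 0]].

(* Elements of the function spaces on [Om] are represented by functions on the
   whole space, of which only the restriction to [Om] up to equality almost
   everywhere matters. *)

Context (Om : set E).

Definition L2 : set (E -> R) :=
  [set u : E -> R | measurable_fun Om u /\
           (leb R d).-integrable Om (fun x => (u x ^+ 2)%:E)].

Definition ip (u v : E -> R) : R := \int[leb R d]_(x in Om) (u x * v x).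

Definition nrm (u : E -> R) : R := Num.sqrt (ip u u).

Definition ae_eq_on (u v : E -> R) : Prop :=
  {ae leb R d, forall x, Om x -> u x = v x}.

Definition is_wpd (i : 'I_d) (u g : E -> R) : Prop :=
  forall phi, Ccinfty Om phi -> ip u (pderiv [:: i] phi) = - ip g phi.

(* The i-th weak partial derivative in L^2; it is determined by [u] up to
   equality almost everywhere. *)
Definition wpd (i : 'I_d) (u : E -> R) : E -> R :=
  xget (fun=> 0) [set g : E -> R | L2 g /\ is_wpd i u g].

Definition H1 : set (E -> R) :=
  [set u : E -> R | L2 u /\ forall i, exists g, L2 g /\ is_wpd i u g].

Definition H1nrm (u : E -> R) : R :=
  Num.sqrt (nrm u ^+ 2 + \sum_i nrm (wpd i u) ^+ 2).

Definition H10 : set (E -> R) :=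
  [set u : E -> R | H1 u /\ exists phi : nat -> E -> R,
     (forall n, Ccinfty Om (phi n)) /\ H1nrm (u - phi n) @[n --> \oo] --> 0].

Definition Q : set (E -> R) :=
  [set q : E -> R | L2 q /\ \int[leb R d]_(x in Om) q x = 0].

Definition X : set vfield := [set v | forall i, H10 (v i)].

Definition vL2 : set vfield := [set v | forall i, L2 (v i)].

Definition vip (u v : vfield) : R := \sum_i ip (u i) (v i).

Definition vnrm (u : vfield) : R := Num.sqrt (vip u u).

Definition gradip (u v : vfield) : R :=
  \sum_i \sum_j ip (wpd j (u i)) (wpd j (v i)).

Definition gradnrm (u : vfield) : R := Num.sqrt (gradip u u).

Definition vH1nrm (u : vfield) : R := Num.sqrt (vnrm u ^+ 2 + gradnrm u ^+ 2).

Definition is_wdiv (u : vfield) (g : E -> R) : Prop :=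
  forall phi, Ccinfty Om phi ->
    \sum_i ip (u i) (pderiv [:: i] phi) = - ip g phi.

Definition Hdiv : set vfield :=
  [set u : vfield | vL2 u /\ exists g, L2 g /\ is_wdiv u g].

Definition wdiv (u : vfield) : E -> R :=
  xget (fun=> 0) [set g : E -> R | L2 g /\ is_wdiv u g].

Definition convect (u v : vfield) : vfield :=
  fun j x => \sum_i u i x * wpd i (v j) x.

Definition bstar (u v w : vfield) : R :=
  vip (convect u v) w + 2^-1 * vip (fun j x => wdiv u x * v j x) w.

Definition dualnrm (F : vfield -> R) : \bar R :=
  ereal_sup [set (F v / gradnrm v)%:E | v in
    [set v | X v /\ ~ (forall i, ae_eq_on (v i) (fun=> 0))]].

(* The second condition makes [F] a functional on a.e. classes. *)
Definition Hm1 : set (vfield -> R) :=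
  [set F | [/\ forall a u v, X u -> X v -> F (a *: u + v) = a * F u + F v,
               forall u v, X u -> X v ->
                 (forall i, ae_eq_on (u i) (v i)) -> F u = F v &
               (dualnrm F < +oo)%E]].

(* Bochner spaces of functions on [0, T] with values in the normed space whose
   elements form [D] and whose norm is [N]. *)

Section bochner.
Context (V : lmodType R) (D : set V) (N : V -> \bar R).

Definition bochner_simple (s : R -> V) : Prop :=
  exists (n : nat) (A : 'I_n -> set R) (c : 'I_n -> V),
    [/\ forall i, measurable (A i), forall i, D (c i) &
        forall t, s t = \sum_i (\1_(A i) t : R) *: c i].

Definition strongly_measurable (T : R) (u : R -> V) : Prop :=
  exists s : nat -> R -> V, (forall n, bochner_simple (s n)) /\
    {ae lebesgue_measure, forall t : R, 0 <= t <= T ->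
       N (u t - s n t) @[n --> \oo] --> 0%E}.

Definition bochner_L2 (T : R) (u : R -> V) : Prop :=
  [/\ {ae lebesgue_measure, forall t : R, 0 <= t <= T -> D (u t)},
      strongly_measurable T u &
      (\int[lebesgue_measure]_(t in `[0%R, T]) (N (u t)) ^+ 2 < +oo)%E].

End bochner.

(* [ut] is the distributional time derivative of [u] on (0, T) as an
   L^2-valued function: the identity between the Bochner integrals of
   [u psi'] and [- ut psi] is tested against all [q] in L^2. *)
Definition is_time_derivative (T : R) (u ut : R -> E -> R) : Prop :=
  forall q psi, L2 q -> time_test T psi ->
    \int[lebesgue_measure]_(t in `[0, T]) (ip (u t) q * derive1 psi t) =
    - \int[lebesgue_measure]_(t in `[0, T]) (ip (ut t) q * psi t).

Definition L2_continuous (T : R) (u : R -> E -> R) : Prop :=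
  forall t, 0 <= t <= T ->
    L2 (u t) /\ nrm (u s - u t) @[s --> within `[0, T] (nbhs t)] --> 0.

Record weak_solution (T nu alpha beta : R) (f : R -> vfield -> R)
    (w0 : vfield) (l0 : E -> R)
    (w wt : R -> vfield) (l lt : R -> E -> R) : Prop := {
  ws_w : bochner_L2 X (fun v => (vH1nrm v)%:E) T w;
  ws_wt : bochner_L2 vL2 (fun v => (vnrm v)%:E) T wt;
  ws_wt_deriv : forall i, is_time_derivative T (w ^~ i) (wt ^~ i);
  ws_wt_Hdiv : {ae lebesgue_measure, forall t : R, 0 <= t <= T -> Hdiv (wt t)};
  ws_div_wt : bochner_L2 L2 (fun q => (nrm q)%:E) T (fun t => wdiv (wt t));
  ws_l : bochner_L2 Q (fun q => (nrm q)%:E) T l;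
  ws_lt : bochner_L2 Q (fun q => (nrm q)%:E) T lt;
  ws_lt_deriv : is_time_derivative T l lt;
  (* [w] and [l] are the representatives that are continuous in time, which
     gives a meaning to their values at 0 and T. *)
  ws_w_cont : forall i, L2_continuous T (w ^~ i);
  ws_l_cont : L2_continuous T l;
  ws_w_init : vL2 w0 /\ forall i, ae_eq_on (w 0 i) (w0 i);
  ws_l_init : L2 l0 /\ ae_eq_on (l 0) l0;
  ws_momentum : {ae lebesgue_measure, forall t : R, 0 < t <= T ->
    forall v, X v ->
      vip (wt t) v + bstar (w t) (w t) v + nu * gradip (w t) v
        - ip (l t) (wdiv v) = f t v};
  ws_continuity : {ae lebesgue_measure, forall t : R, 0 < t <= T ->
    forall q, Q q ->
      ip (lt t + (2 * beta) *: wdiv (wt t) + alpha ^+ 2 *: wdiv (w t)) q = 0}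
}.

Definition solution (T nu alpha beta : R) (f : R -> vfield -> R)
    (w0 : vfield) (l0 : E -> R) (w : R -> vfield) (l : R -> E -> R) : Prop :=
  exists (wt : R -> vfield) (lt : R -> E -> R),
    weak_solution T nu alpha beta f w0 l0 w wt l lt.

End spaces.

(* Main.v *)
Require Import Defs.
From HB Require Import structures.
From mathcomp Require Import all_boot all_order all_algebra.
From mathcomp Require Import all_classical all_reals all_analysis.
From mathcomp Require Import measurable_realfun ring lra zify.
Import Order.TTheory GRing.Theory Num.Theory.
Import numFieldNormedType.Exports.
Import HBSimple HBNNSimple.
Local Open Scope classical_set_scope.
Local Open Scope ring_scope.
Set Implicit Arguments.
Unset Strict Implicit.
Unset Printing Implicit Defensive.

(* Put p = lambda + 2 beta div w, so that the continuity equation reads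
   p_t = - alpha^2 div w.  Testing the momentum equation with w and the
   continuity equation with alpha^-2 p, the form b* vanishes, the pressure terms
   cancel, and
     d/dt (|w|^2 + alpha^-2 |p|^2) = 2 f(w) - 2 nu |grad w|^2 - 4 beta |div w|^2,
   where 2 f(w) <= nu^-1 |f|_{-1}^2 + nu |grad w|^2 by Young's inequality.

   Three points need care.  The cancellation b*(w,w,w) = 0 uses H^1_0 in L^4,
   which comes from Ladyzhenskaya's inequality (d <= 3).  The energy identity
   needs no mollification: a primitive u of u' is continuous with modulus
   m(t) = int_0^t |u'|, and F(t) = |u(t)|^2 - 2 int_0^t (u', u) satisfies
   |F(b) - F(a)| <= 2 (m(b) - m(a))^2, so that F is constant.  The weak divergence
   of w is only known to exist at almost every time; it has the modulus of
   continuity int |div w_t|, hence exists at every time by completeness of L^2.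
   Neither integrand of the final inequality is assumed measurable, so the
   integrated inequality is obtained through simple functions below the left
   integrand. *)

(** * The space L^2 *)

(** Elements of the spaces are plain functions, and [wpd] and [wdiv] pick one weak derivative out of
    a class, so they are linear only up to null sets; identities between them read
    [nrm Om (g - h) = 0] and are consumed through inner products. Uniqueness rests on the density of
    [Ccinfty Om] in $L^2$, obtained from explicit bumps converging to indicators of boxes, then a
    Dynkin class, then simple functions.

    The $L^4$ bound is what lets phi_n^2 and w_i phi_n converge in $L^2$ when the test functions
    phi_n approximate a component of w.

    The continuity equation is tested against mean-zero functions only; p is admissible because the
    divergence of a field in $H^1_0$ has mean zero. The number 4 beta arises from 2 alpha^-2 (p_t,
    p) = -2 (div w, p) and the summand 2 beta div w of p, while the summand lambda cancels the
    pressure term.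

    In time, pairing with a fixed q reduces distributional derivatives to scalar functions; test
    functions whose derivatives concentrate at two points turn them into integral identities. *)

Section L2_theory.
Context (R : realType) (d : nat) (Om : set 'rV[R]_d).
Hypothesis mOm : measurable Om.
Local Notation E := 'rV[R]_d.
Local Notation mu := (leb R d).
Implicit Types u v w : E -> R.

Lemma L2_integrable_mul u v : L2 Om u -> L2 Om v ->
  mu.-integrable Om (EFin \o (fun x => u x * v x)).
Proof.
move=> [mu_ iu] [mv iv].
apply: (@le_integrable _ _ _ _ _ mOm _ (EFin \o (fun x => u x ^+ 2 + v x ^+ 2))).
- by apply/measurable_EFinP; exact: measurable_funM.
- move=> x _ /=; rewrite lee_fin.
  rewrite (ger0_norm (addr_ge0 (sqr_ge0 _) (sqr_ge0 _))) normrM.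
  rewrite -[u x ^+ 2]real_normK ?num_real// -[v x ^+ 2]real_normK ?num_real//.
  have := sqr_ge0 (`|u x| - `|v x|); have := normr_ge0 (u x); have := normr_ge0 (v x).
  by nra.
- have -> : EFin \o (fun x => u x ^+ 2 + v x ^+ 2) =
     ((EFin \o (fun x => u x ^+ 2)%R) \+ (EFin \o (fun x => v x ^+ 2)%R))%E.
    by apply/funext => x /=; rewrite EFinD.
  exact: integrableD.
Qed.

Lemma L2D u v : L2 Om u -> L2 Om v -> L2 Om (u + v).
Proof.
move=> Lu Lv; split; first by apply: measurable_funD; [case: Lu|case: Lv].
have -> : (fun x => ((u + v) x ^+ 2)%:E) = ((EFin \o (fun x => u x * u x)%R) \+
   ((fun x => (2 * (u x * v x))%:E) \+ (EFin \o (fun x => v x * v x)%R)))%E.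
  apply/funext => x /=; rewrite -!EFinD; congr EFin.
  by rewrite fctE; ring.
apply: integrableD => //; first exact: L2_integrable_mul.
apply: integrableD => //; last exact: L2_integrable_mul.
have -> : (fun x => (2 * (u x * v x))%:E) = (fun x => (2%:E * (EFin \o (fun x => u x * v x)%R) x)%E).
  by apply/funext => x; rewrite /= EFinM.
by apply: integrableZl => //; exact: L2_integrable_mul.
Qed.

Lemma L2Z (a : R) u : L2 Om u -> L2 Om (a *: u).
Proof.
move=> [mu_ iu]; split; first exact: measurable_funM.
have -> : (fun x => ((a *: u) x ^+ 2)%:E) = (fun x => ((a ^+ 2)%:E * (u x ^+ 2)%:E)%E).
  by apply/funext => x; rewrite -EFinM -exprMn.
exact: integrableZl.
Qed.

Lemma L2N u : L2 Om u -> L2 Om (- u).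
Proof. by move=> /(L2Z (-1)); rewrite scaleN1r. Qed.

Lemma L2B u v : L2 Om u -> L2 Om v -> L2 Om (u - v).
Proof. by move=> Lu Lv; apply: L2D => //; exact: L2N. Qed.

Lemma L2_0 : L2 Om (0 : E -> R).
Proof.
split; first exact: measurable_cst.
have -> : (fun x : E => ((0 : E -> R) x ^+ 2)%:E) = (fun=> 0%E).
  by apply/funext => x; rewrite expr0n.
exact: integrable0.
Qed.

Lemma L2_sum (I : Type) (s : seq I) (P : pred I) (F : I -> E -> R) :
  (forall i, P i -> L2 Om (F i)) -> L2 Om (\sum_(i <- s | P i) F i).
Proof.
move=> H; elim/big_ind : _ => //; [exact: L2_0|exact: L2D].
Qed.

Lemma ipC u v : ip Om u v = ip Om v u.
Proof. by rewrite /ip; congr (fine _); apply: eq_integral => x _; rewrite mulrC. Qed.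

Lemma ipDl u v w : L2 Om u -> L2 Om v -> L2 Om w ->
  ip Om (u + v) w = ip Om u w + ip Om v w.
Proof.
move=> Lu Lv Lw; rewrite /ip -RintegralD//; try exact: L2_integrable_mul.
by congr (fine _); apply: eq_integral => x _; rewrite fctE mulrDl.
Qed.

Lemma ipZl a u w : L2 Om u -> L2 Om w -> ip Om (a *: u) w = a * ip Om u w.
Proof.
move=> Lu Lw; rewrite /ip -RintegralZl//; try exact: L2_integrable_mul.
by congr (fine _); apply: eq_integral => x _; rewrite mulrA.
Qed.

Lemma ip0l w : ip Om 0 w = 0.
Proof.
rewrite /ip (_ : (fun x => _) = cst 0).
  by rewrite /Rintegral integral0.
by apply/funext => x; rewrite fctE mul0r.
Qed.

Lemma ipDr u v w : L2 Om u -> L2 Om v -> L2 Om w ->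
  ip Om w (u + v) = ip Om w u + ip Om w v.
Proof. by move=> Lu Lv Lw; rewrite ipC ipDl// !(ipC w). Qed.

Lemma ipZr a u w : L2 Om u -> L2 Om w -> ip Om w (a *: u) = a * ip Om w u.
Proof. by move=> Lu Lw; rewrite ipC ipZl// (ipC w). Qed.

Lemma ipNl u w : L2 Om u -> L2 Om w -> ip Om (- u) w = - ip Om u w.
Proof. by move=> Lu Lw; rewrite -scaleN1r ipZl// mulN1r. Qed.

Lemma ipBl u v w : L2 Om u -> L2 Om v -> L2 Om w ->
  ip Om (u - v) w = ip Om u w - ip Om v w.
Proof. by move=> Lu Lv Lw; rewrite ipDl ?ipNl//; exact: L2N. Qed.

Lemma ipBr u v w : L2 Om u -> L2 Om v -> L2 Om w ->
  ip Om w (u - v) = ip Om w u - ip Om w v.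
Proof. by move=> Lu Lv Lw; rewrite ipC ipBl// !(ipC w). Qed.

Lemma ip_suml (I : Type) (s : seq I) (F : I -> E -> R) w :
  (forall i, L2 Om (F i)) -> L2 Om w ->
  ip Om (\sum_(i <- s) F i) w = \sum_(i <- s) ip Om (F i) w.
Proof.
move=> LF Lw; elim: s => [|a s IH]; first by rewrite !big_nil ip0l.
by rewrite !big_cons ipDl ?IH//; exact: L2_sum.
Qed.

Lemma ip_ge0 u : 0 <= ip Om u u.
Proof. by apply: Rintegral_ge0 => x _; rewrite -expr2 sqr_ge0. Qed.

Lemma nrm_ge0 u : 0 <= nrm Om u. Proof. exact: sqrtr_ge0. Qed.

Lemma nrm_sqr u : nrm Om u ^+ 2 = ip Om u u.
Proof. by rewrite sqr_sqrtr// ip_ge0. Qed.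

Lemma nrm0 : nrm Om 0 = 0.
Proof. by rewrite /nrm ip0l sqrtr0. Qed.

Lemma ip_CS_sqr u v : L2 Om u -> L2 Om v ->
  ip Om u v ^+ 2 <= ip Om u u * ip Om v v.
Proof.
move=> Lu Lv.
have key a : 0 <= a ^+ 2 * ip Om u u + 2 * a * ip Om u v + ip Om v v.
  have := ip_ge0 (a *: u + v).
  rewrite ipDl ?ipDr ?ipZl ?ipZr//; try (by apply: L2Z); try (by apply: L2D => //; exact: L2Z).
  by rewrite (ipC v u); nra.
have := ip_ge0 u; rewrite le_eqVlt => /orP[/eqP u0|u0].
  rewrite -u0 mul0r.
  have /eqP -> : ip Om u v == 0.
    apply/negP => /negP c0.
    (* When (u, u) = 0 the quadratic is affine in [a]; this value of [a] makes it equal to -1. *)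
    have := key (- (ip Om v v + 1) / (2 * ip Om u v)).
    rewrite -u0 mulr0 add0r.
    have -> : 2 * (- (ip Om v v + 1) / (2 * ip Om u v)) * ip Om u v = - (ip Om v v + 1).
      by field.
    by lra.
  by rewrite expr0n.
(* The minimiser of the quadratic in [a]. *)
have := key (- ip Om u v / ip Om u u).
have -> : (- ip Om u v / ip Om u u) ^+ 2 * ip Om u u +
   2 * (- ip Om u v / ip Om u u) * ip Om u v + ip Om v v =
  (ip Om u u * ip Om v v - ip Om u v ^+ 2) / ip Om u u.
  by field; rewrite gt_eqF.
by rewrite pmulr_lge0 ?invr_gt0// subr_ge0.
Qed.

Lemma ip_CS u v : L2 Om u -> L2 Om v -> `|ip Om u v| <= nrm Om u * nrm Om v.
Proof.
move=> Lu Lv; rewrite -(@ler_pXn2r _ 2)//; last by rewrite nnegrE mulr_ge0// nrm_ge0.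
by rewrite real_normK ?num_real// exprMn !nrm_sqr; exact: ip_CS_sqr.
Qed.

Lemma nrm_triangle u v : L2 Om u -> L2 Om v ->
  nrm Om (u + v) <= nrm Om u + nrm Om v.
Proof.
move=> Lu Lv; rewrite -(@ler_pXn2r _ 2) ?nnegrE ?addr_ge0 ?nrm_ge0//.
rewrite sqrrD !nrm_sqr ipDl ?ipDr//; try exact: L2D.
have := ip_CS Lu Lv; rewrite (ipC v u) ler_norml => /andP[_].
by lra.
Qed.

Lemma nrmZ a u : L2 Om u -> nrm Om (a *: u) = `|a| * nrm Om u.
Proof.
move=> Lu; rewrite /nrm ipZl ?ipZr//; last exact: L2Z.
by rewrite mulrA -expr2 sqrtrM ?sqr_ge0// sqrtr_sqr.
Qed.

Lemma nrmN u : L2 Om u -> nrm Om (- u) = nrm Om u.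
Proof. by move=> Lu; rewrite -scaleN1r nrmZ// normrN normr1 mul1r. Qed.

Lemma nrm_distC u v : L2 Om u -> L2 Om v -> nrm Om (u - v) = nrm Om (v - u).
Proof. by move=> Lu Lv; rewrite -nrmN ?opprB//; exact: L2B. Qed.

Lemma nrm_ler_dist u v : L2 Om u -> L2 Om v ->
  `|nrm Om u - nrm Om v| <= nrm Om (u - v).
Proof.
move=> Lu Lv; rewrite ler_norml; apply/andP; split.
  have := @nrm_triangle (v - u) u; rewrite subrK => /(_ _ _)/=.
  rewrite nrm_distC// => /(_ (L2B Lv Lu) Lu); lra.
have := @nrm_triangle (u - v) v; rewrite subrK => /(_ (L2B Lu Lv) Lv); lra.
Qed.

Lemma nrm_sum (I : Type) (s : seq I) (F : I -> E -> R) :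
  (forall i, L2 Om (F i)) ->
  nrm Om (\sum_(i <- s) F i) <= \sum_(i <- s) nrm Om (F i).
Proof.
move=> LF; elim: s => [|a s IH]; first by rewrite !big_nil nrm0.
rewrite !big_cons; apply: le_trans (nrm_triangle _ _) _ => //; first exact: L2_sum.
by rewrite lerD2l.
Qed.

Lemma L2_eq u v : (forall x, Om x -> u x = v x) -> L2 Om u -> L2 Om v.
Proof.
move=> uv [mu_ iu]; split.
  by apply: eq_measurable_fun mu_ => x /[!inE]; exact: uv.
apply: eq_integrable iu => // x /[!inE] Ox; by rewrite uv.
Qed.

Lemma ae_eq_ip u u' v v' : measurable_fun Om u -> measurable_fun Om u' ->
  measurable_fun Om v -> measurable_fun Om v' ->
  ae_eq_on Om u u' -> ae_eq_on Om v v' -> ip Om u v = ip Om u' v'.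
Proof.
move=> m1 m2 m3 m4 uu vv; rewrite /ip /Rintegral; congr fine.
apply: ae_eq_integral => //; try by apply/measurable_EFinP; exact: measurable_funM.
by apply: filterS2 uu vv => x ux vx Ox; rewrite /= ux ?vx.
Qed.

Lemma ae_eq_nrm u v : L2 Om u -> L2 Om v -> ae_eq_on Om u v -> nrm Om u = nrm Om v.
Proof. by move=> [mu_ _] [mv _] uv; rewrite /nrm (ae_eq_ip _ _ _ _ uv uv). Qed.

Lemma L2_sqr_integral u : L2 Om u ->
  (\int[mu]_(x in Om) (u x ^+ 2)%:E)%E = (nrm Om u ^+ 2)%:E.
Proof.
move=> Lu; rewrite nrm_sqr /ip /Rintegral fineK//.
exact/(integrable_fin_num mOm)/(L2_integrable_mul Lu Lu).
Qed.

Lemma nrm_eq0 u : L2 Om u -> nrm Om u = 0 -> ae_eq_on Om u (fun=> 0).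
Proof.
move=> Lu u0; have := L2_sqr_integral Lu.
rewrite u0 expr0n /= => i0.
pose f2 : E -> \bar R := fun x => (u x ^+ 2)%:E.
have mf : measurable_fun Om f2.
  by apply/measurable_EFinP; apply: measurable_funX; case: Lu.
have := @ae_eq_integral_abs _ _ _ mu Om mOm _ mf; rewrite -/(_ <-> _) => -[+ _].
move=> /(_ _)/filterS; apply; last first.
  by rewrite -[RHS]i0; apply: eq_integral => x _ /=; rewrite ger0_norm// sqr_ge0.
move=> x + Ox => /(_ Ox)/eqP; rewrite eqe sqrf_eq0 => /eqP; exact.
Qed.

Lemma nrmB0_ae_eq u v : L2 Om u -> L2 Om v -> nrm Om (u - v) = 0 -> ae_eq_on Om u v.
Proof.
move=> Lu Lv /(nrm_eq0 (L2B Lu Lv)).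
by apply: filterS => x + Ox => /(_ Ox); rewrite !fctE => /eqP; rewrite subr_eq0 => /eqP.
Qed.

Lemma L2_norm u : L2 Om u -> L2 Om (fun x => `|u x|).
Proof.
move=> [mu_ iu]; split; first exact: measurableT_comp.
apply: eq_integrable iu => // x _.
by rewrite real_normK// num_real.
Qed.

Lemma nrm_norm u : nrm Om (fun x => `|u x|) = nrm Om u.
Proof.
congr (Num.sqrt (fine _)); apply: eq_integral => x _.
by rewrite -!expr2 real_normK// num_real.
Qed.

Lemma L2_le u v : measurable_fun Om u -> L2 Om v ->
  (forall x, Om x -> `|u x| <= `|v x|) -> L2 Om u.
Proof.
move=> mu_ [mv iv] uv; split => //.
apply: (le_integrable mOm _ _ iv).
  by apply/measurable_EFinP; exact: measurable_funX.
move=> x Ox /=; rewrite lee_fin !normrX.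
by rewrite lerXn2r ?nnegrE// uv.
Qed.

Lemma nrm_le u v : measurable_fun Om u -> L2 Om v ->
  (forall x, Om x -> `|u x| <= `|v x|) -> nrm Om u <= nrm Om v.
Proof.
move=> mu_ Lv uv; have Lu := L2_le mu_ Lv uv.
rewrite ler_wsqrtr//; apply: le_Rintegral => //; try exact: L2_integrable_mul.
move=> x Ox; rewrite -!expr2 -[u x ^+ 2]real_normK ?num_real//.
rewrite -[v x ^+ 2]real_normK ?num_real//.
by rewrite lerXn2r ?nnegrE// uv.
Qed.

Lemma sum_half_le (N : nat) : \sum_(k < N) (2^-1 : R) ^+ k <= 2.
Proof.
have -> : \sum_(k < N) (2^-1 : R) ^+ k = 2 - 2 * 2^-1 ^+ N.
  elim: N => [|N IH]; first by rewrite big_ord0 expr0; lra.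
  by rewrite big_ord_recr /= IH exprS; field.
have : 0 <= (2^-1 : R) ^+ N by rewrite exprn_ge0// invr_ge0.
lra.
Qed.

Lemma L2_complete (u : nat -> E -> R) : (forall n, L2 Om (u n)) ->
  (forall n, nrm Om (u n.+1 - u n) <= 2^-1 ^+ n) ->
  exists2 v, L2 Om v & nrm Om (v - u n) @[n --> \oo] --> 0.
Proof.
move=> Lu cu.
pose e k : E -> R := fun x => `|(u k.+1 - u k) x|.
have Le k : L2 Om (e k) by apply: L2_norm; exact: L2B.
pose H N : E -> R := \sum_(k < N) e k.
have HE N x : H N x = \sum_(k < N) e k x by rewrite /H fct_sumE.
have LH N : L2 Om (H N) by exact: L2_sum.
have nH N : nrm Om (H N) <= 2.
  apply: le_trans (nrm_sum _ _) _ => //.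
  apply: le_trans (sum_half_le N); apply: ler_sum => k _.
  by rewrite /e nrm_norm.
have H0 N x : 0 <= H N x by rewrite HE; apply: sumr_ge0 => i _; exact: normr_ge0.
have HS N x : H N x <= H N.+1 x.
  by rewrite !HE big_ord_recr /= lerDl normr_ge0.
have Hnd x : {homo H ^~ x : n m / (n <= m)%N >-> n <= m}.
  exact: (homo_leq lexx le_trans (HS^~ x)).
pose g' N (x : E) : \bar R := (H N x ^+ 2)%:E.
have mg' N : measurable_fun Om (g' N).
  by apply/measurable_EFinP; apply: measurable_funX; case: (LH N).
have g'nd x : {homo g' ^~ x : n m / (n <= m)%N >-> (n <= m)%E}.
  by move=> n m nm; rewrite lee_fin lerXn2r ?nnegrE// Hnd.
pose G x : \bar R := limn (g' ^~ x).
have cG x : g' n x @[n --> \oo] --> G x by exact: ereal_nondecreasing_is_cvgn.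
have g'G n x : (g' n x <= G x)%E.
  apply: lime_ge; first exact: ereal_nondecreasing_is_cvgn.
  by exists n => // m /= nm; exact: g'nd.
have G0 x : (0 <= G x)%E by apply: le_trans (g'G 0%N x); rewrite lee_fin sqr_ge0.
have mG : measurable_fun Om G by apply: (emeasurable_fun_cvg g') => // x _; exact: cG.
have iG : mu.-integrable Om G.
  apply/integrableP; split => //.
  under eq_integral do rewrite gee0_abs//.
  have cI := @cvg_monotone_convergence _ _ _ mu Om mOm g' mg'.
  apply: (@le_lt_trans _ _ 4%:E); last exact: ltry.
  have -> : (\int[mu]_(x in Om) G x)%E = limn (fun n => (\int[mu]_(x in Om) g' n x)%E).
    apply/esym/cvg_lim => //; apply: cI => //.
    by move=> n x _; rewrite lee_fin sqr_ge0.
  apply: lime_le.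
    apply: ereal_nondecreasing_is_cvgn => n m nm; apply: ge0_le_integral => //.
      by move=> x _; rewrite lee_fin sqr_ge0.
    by move=> x _; exact: g'nd.
  apply: nearW => n; rewrite L2_sqr_integral// lee_fin.
  have := nH n; have := nrm_ge0 (H n); nra.
(* [A] is conull in [Om] because [G] is integrable. Cutting the sequence off outside [A] makes it
   converge at every point, so that the limit is measurable. *)
pose A := Om `&` [set x | G x \is a fin_num].
have mA : measurable A by exact: emeasurable_fin_num.
pose v' n : E -> R := fun x => u n x * \1_A x.
have cvA x : A x -> cvgn (u ^~ x).
  move=> [Ox Gx].
  have cs : cvgn (series (telescope (u ^~ x))).
    apply: normed_cvg; apply: nondecreasing_is_cvgn.
      by apply: nondecreasing_series => k _ _; exact: normr_ge0.
    exists (Num.sqrt (fine (G x))) => _ [N _ <-].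
    rewrite -[X in X <= _](_ : H N x = _); last first.
      by rewrite HE -(big_mkord xpredT (e ^~ x)).
    rewrite -(ger0_norm (H0 N x)) -sqrtr_sqr ler_wsqrtr// -lee_fin fineK//.
    exact: g'G.
  have -> : u ^~ x = (fun n => u 0%N x + series (telescope (u ^~ x)) n).
    by apply/funext => n; rewrite -eq_sum_telescope.
  by apply: is_cvgD => //; exact: is_cvg_cst.
pose v : E -> R := fun x => limn (v' ^~ x).
have cv x : v' n x @[n --> \oo] --> v x.
  have [Ax|Ax] := pselect (A x).
    suff : cvgn (v' ^~ x) by [].
    by apply: is_cvgMl; exact: cvA.
  suff : cvgn (v' ^~ x) by [].
  rewrite (_ : v' ^~ x = cst 0); first exact: is_cvg_cst.
  by apply/funext => n; rewrite /v' indicE memNset ?mulr0.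
have mv' n : measurable_fun Om (v' n).
  by apply: measurable_funM; [case: (Lu n)|exact: measurable_indic].
have mv : measurable_fun Om v.
  by apply: (measurable_fun_cvg mv') => x _; exact: cv.
have Hsub n m x : (n <= m)%N -> `|u m x - u n x| <= H m x.
  move=> nm; rewrite HE -(big_mkord xpredT (e ^~ x)) (big_cat_nat (leq0n n) nm)//=.
  have -> : u m x - u n x = \sum_(n <= i < m) (u i.+1 x - u i x).
    by rewrite (telescope_sumr (u ^~ x) nm).
  apply: le_trans (ler_norm_sum _ _ _) _.
  by rewrite lerDr; apply: sumr_ge0 => i _; exact: normr_ge0.
(* For m >= n the difference of [u m] and [u n] is at most [H m], whose square lies below [G]; then
   m tends to infinity. *)
have bnd n x : Om x -> (((v x - v' n x) ^+ 2)%:E <= G x)%E.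
  move=> Ox; have [Ax|Ax] := pselect (A x); last first.
    have v'0 k : v' k x = 0 by rewrite /v' indicE memNset ?mulr0.
    suff -> : v x = 0 by rewrite v'0 subr0 expr0n.
    rewrite /v (_ : v' ^~ x = cst 0); first exact: lim_cst.
    exact/funext.
  have cd : ((v' m x - v' n x) ^+ 2)%:E @[m --> \oo] --> ((v x - v' n x) ^+ 2)%:E.
    apply: cvg_EFin; first exact: nearW.
    apply: (@cvg_comp _ _ _ (fun m => v' m x - v' n x) (fun y => y ^+ 2)).
      by apply: cvgB; [exact: cv|exact: cvg_cst].
    exact: exprn_continuous.
  rewrite -(cvg_lim _ cd)//; apply: lime_le; first by apply/cvg_ex; eexists; exact: cd.
  exists n => // m /= nm; apply: le_trans (g'G m x).
  rewrite lee_fin /v' indicE mem_set// !mulr1 -[_ ^+ 2]real_normK ?num_real//.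
  by rewrite lerXn2r ?nnegrE// Hsub.
have Lvv n : L2 Om (v - v' n).
  split; first exact: measurable_funB.
  apply: (le_integrable mOm _ _ iG).
    apply/measurable_EFinP; apply: measurable_funX; exact: measurable_funB.
  move=> x Ox; rewrite gee0_abs ?lee_fin ?sqr_ge0// gee0_abs//; exact: bnd.
have Lv' n : L2 Om (v' n).
  apply: (L2_le (mv' n) (Lu n)) => x _; rewrite /v' normrM ler_piMr//.
  by rewrite indicE; case: (_ \in _); rewrite ?normr1 ?normr0.
have Lv : L2 Om v by rewrite -(subrK (v' 0%N) v); exact: L2D.
exists v => //.
have uv' n : ae_eq_on Om (u n) (v' n).
  have := integrable_ae mOm iG; apply: filterS => x fx Ox.
  by rewrite /v' indicE mem_set ?mulr1//; split => //=; exact: fx.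
have -> : (fun n => nrm Om (v - u n)) = (fun n => nrm Om (v - v' n)).
  apply/funext => n; apply: ae_eq_nrm => //; first exact: L2B.
  by apply: filterS (uv' n) => x ux Ox; rewrite !fctE ux.
have := @dominated_convergence _ _ _ mu Om mOm (fun n x => ((v x - v' n x) ^+ 2)%:E) (cst 0%E) G.
case.
- by move=> n; apply/measurable_EFinP; apply: measurable_funX; exact: measurable_funB.
- exact: measurable_cst.
- apply: aeW => x Ox; rewrite [X in _ --> X](_ : _ = (0 ^+ 2)%:E); last by rewrite expr0n.
  apply: cvg_EFin; first exact: nearW.
  apply: (@cvg_comp _ _ _ (fun m => v x - v' m x) (fun y => y ^+ 2) _ (nbhs (0 : R))).
    by rewrite -(subrr (v x)); apply: cvgB; [exact: cvg_cst|exact: cv].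
  exact: exprn_continuous.
- exact: iG.
- by apply: aeW => x n Ox; rewrite gee0_abs ?lee_fin ?sqr_ge0//; exact: bnd.
move=> _ _ /=; rewrite integral0 => c0.
have {}c0 : (nrm Om (v - v' n) ^+ 2)%:E @[n --> \oo] --> 0%:E.
  apply: cvg_trans c0; apply: near_eq_cvg; apply: nearW => n /=.
  by rewrite -L2_sqr_integral.
have {}c0 : nrm Om (v - v' n) ^+ 2 @[n --> \oo] --> (0 : R) by exact: fine_cvg c0.
have -> : (fun n => nrm Om (v - v' n)) = (fun n => Num.sqrt (nrm Om (v - v' n) ^+ 2)).
  by apply/funext => n; rewrite sqrtr_sqr ger0_norm// nrm_ge0.
rewrite -[X in _ --> X]sqrtr0.
by apply: (@cvg_comp _ _ _ _ (@Num.sqrt R)) c0 _; exact: sqrt_continuous.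
Qed.

End L2_theory.

(** * Lebesgue measure on R^n *)

Section rV_geometry.
Context (R : realType) (d : nat).
Local Notation E := 'rV[R]_d.

Lemma norm_coord_le (x : E) i : `|x ord0 i| <= `|x|.
Proof.
have -> : `|x| = mx_norm x by [].
rewrite mx_normrE.
exact: (le_bigmax _ (fun ij => `|x ij.1 ij.2|) (ord0, i)).
Qed.

Lemma norm_rV_le (x : E) M : 0 <= M -> (forall i, `|x ord0 i| <= M) -> `|x| <= M.
Proof.
move=> M0 xM; have -> : `|x| = mx_norm x by [].
rewrite mx_normrE; apply: bigmax_le => // -[i j] _ /=.
by rewrite (ord1 i).
Qed.

Definition box (A : 'I_d -> set R) : set E := [set x | forall i, A i (x ord0 i)].

Lemma measurable_box A : (forall i, measurable (A i)) -> measurable (box A).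
Proof.
move=> mA.
have -> : box A = \bigcap_(i in [set: 'I_d])
    ((fun x : E => x ord0 i) @^-1` A i).
  by apply/seteqP; split => [x Ax i _|x Ax i]; [exact: Ax|exact: (Ax i I)].
apply: fin_bigcap_measurable => // i _.
by rewrite -[X in measurable X]setTI; apply: measurable_coord.
Qed.

Definition boxes : set (set E) :=
  [set B | exists2 A, (forall i, measurable (A i)) & B = box A].

Lemma measurable_boxes : measurable = <<s boxes >> :> set (set E).
Proof.
apply/seteqP; split; last first.
  apply: smallest_sub; first exact: sigma_algebra_measurable.
  by move=> _ [A mA ->]; exact: measurable_box.
apply: smallest_sub; first exact: smallest_sigma_algebra.
rewrite -bigcup_seq; apply: bigcup_sub => i _ B [C mC <-].
rewrite setTI; apply: sub_sigma_algebra.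
exists (fun j => if j == i then C else setT).
  by move=> j; case: ifP.
apply/seteqP; split => x /= => [Cx j|/(_ i)]; last by rewrite eqxx.
by case: ifPn => // /eqP ->.
Qed.

Lemma setI_closed_boxes : setI_closed boxes.
Proof.
move=> _ _ [A mA ->] [B mB ->]; exists (fun i => A i `&` B i).
  by move=> i; exact: measurableI.
apply/seteqP; split => x /=; first by move=> [Ax Bx] i; split; [exact: Ax|exact: Bx].
by move=> ABx; split=> i; case: (ABx i).
Qed.

Definition cube (M : R) : set E := box (fun=> `[- M, M]%classic).

Lemma cube_boxes M : boxes (cube M).
Proof. by exists (fun=> `[- M, M]%classic) => // i; exact: measurable_itv. Qed.

Lemma measurable_cube M : measurable (cube M).
Proof. by apply: measurable_box => i; exact: measurable_itv. Qed.

Lemma cubeP M (x : E) : 0 <= M -> `|x| <= M <-> cube M x.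
Proof.
move=> M0; split => [xM i|xM].
  rewrite /= in_itv/= -ler_norml; exact: le_trans (norm_coord_le _ _) xM.
by apply: norm_rV_le => // i; have := xM i; rewrite /= in_itv/= -ler_norml.
Qed.

Lemma bigcup_cube : \bigcup_k cube k%:R = setT.
Proof.
apply/seteqP; split => // x _.
exists `|Num.ceil `|x| |%N => //.
apply/cubeP => //.
by rewrite natr_absz ger0_norm ?ceil_ge ?ceil_ge0//; apply: lt_le_trans (normr_ge0 _); rewrite ltrN10.
Qed.

Lemma leb_box_lty (A : 'I_d -> set R) M : (forall i, measurable (A i)) ->
  (forall i, A i `<=` `[- M, M]%classic) -> (leb R d (box A) < +oo)%E.
Proof.
move=> mA AM; rewrite leb_box//.
have H i : lebesgue_measure (A i) \is a fin_num.
  rewrite ge0_fin_numE//; apply: (@le_lt_trans _ _ (lebesgue_measure `[- M, M]%classic)).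
    by apply: le_measure; rewrite ?inE; [exact: mA|exact: measurable_itv|exact: AM].
  by rewrite lebesgue_measure_itv; case: ifP => // _; rewrite -EFinD ltry.
under eq_bigr do rewrite -[lebesgue_measure _]fineK//.
by rewrite prodEFin ltry.
Qed.

Lemma leb_cube_lty M : (leb R d (cube M) < +oo)%E.
Proof. by apply: (@leb_box_lty (fun=> `[- M, M]%classic) M) => i; [exact: measurable_itv|exact: subset_refl]. Qed.

(** Boxes form a generating pi-system and the cubes exhaust the space with finite measure. This is
    how [leb], built by prepending one coordinate, is compared with measures built otherwise. *)
Lemma measure_eq_boxes (m : {measure set E -> \bar R}) :
  (forall A, (forall i, measurable (A i)) -> leb R d (box A) = m (box A)) ->
  forall A, measurable A -> leb R d A = m A.
Proof.
move=> H; apply: (@measure_unique _ _ _ boxes (fun k => cube k%:R)).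
- exact: measurable_boxes.
- exact: setI_closed_boxes.
- by move=> k; exact: cube_boxes.
- exact: bigcup_cube.
- by move=> _ [A mA ->]; exact: H.
- by move=> k; exact: leb_cube_lty.
Qed.

Lemma ballrVE (x : E) e : 0 < e -> ball x e = box (fun i => `]x ord0 i - e, x ord0 i + e[%classic).
Proof.
move=> e0; rewrite mx_norm_ball; apply/seteqP; split => y /=.
  move=> xy i; rewrite /= in_itv/= -ltr_distlC.
  apply: le_lt_trans xy; have := norm_coord_le (x - y) i.
  by rewrite !mxE.
move=> H; have -> : `|x - y| = mx_norm (x - y) by [].
rewrite mx_normrE; apply: bigmax_lt => // -[i j] _ /=; rewrite (ord1 i).
by have := H j; rewrite /= in_itv /= -ltr_distlC !mxE.
Qed.

(** Rational boxes are countable, and balls of the sup norm are boxes. Inclusion is asked of the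
    closed boxes because they later serve as compact supports of bumps inside [Om]. *)
Lemma open_bigcup_box (Om : set E) : open Om ->
  exists (D : set nat) (a b : nat -> E),
    (forall n, D n -> box (fun i => `[a n ord0 i, b n ord0 i]%classic) `<=` Om) /\
    Om = \bigcup_(n in D) box (fun i => `]a n ord0 i, b n ord0 i[%classic).
Proof.
move=> oOm.
pose T := ({ffun 'I_d -> rat} * {ffun 'I_d -> rat})%type.
pose a (p : T) : E := \row_i ratr (p.1 i).
pose b (p : T) : E := \row_i ratr (p.2 i).
pose p0 : T := ([ffun=> 0], [ffun=> 0]).
(* Integers that code no pair are sent to [p0]; this is harmless, since an index is kept only if its
   closed box lies in [Om]. *)
pose p n : T := odflt p0 (unpickle n).
pose cb n := box (fun i => `[a (p n) ord0 i, b (p n) ord0 i]%classic).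
exists [set n | cb n `<=` Om], (a \o p), (b \o p); split => //.
apply/seteqP; split => [x Ox|x [n nO Bx]]; last first.
  apply: nO => i; have := Bx i; rewrite /= !in_itv/= => /andP[? ?].
  by rewrite !ltW.
have /nbhs_ballP[e /= e0 xe] := open_nbhs_nbhs (conj oOm Ox).
have /choice[q1 q1P] i : exists q : rat, ratr q \in `]x ord0 i - e, x ord0 i[.
  by apply: rat_in_itvoo; rewrite ltrBlDr ltrDl.
have /choice[q2 q2P] i : exists q : rat, ratr q \in `]x ord0 i, x ord0 i + e[.
  by apply: rat_in_itvoo; rewrite ltrDl.
pose t : T := ([ffun i => q1 i], [ffun i => q2 i]).
have tE : p (pickle t) = t by rewrite /p pickleK.
exists (pickle t) => /=.
  rewrite /cb tE => y yab; apply: xe; rewrite ballrVE// => i.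
  have := yab i; rewrite /= !mxE !ffunE !in_itv/= => /andP[h1 h2].
  have := q1P i; have := q2P i; rewrite !in_itv/= => /andP[_ h3] /andP[h4 _].
  by rewrite (lt_le_trans h4)// (le_lt_trans h2).
move=> i; rewrite tE /= !mxE !ffunE in_itv/=.
by have := q1P i; have := q2P i; rewrite !in_itv/= => /andP[-> _] /andP[_ ->].
Qed.

Lemma open_measurable_rV (Om : set E) : open Om -> measurable Om.
Proof.
move=> /open_bigcup_box[D [a [b [_ ->]]]].
apply: bigcup_measurable => n _; apply: measurable_box => i; exact: measurable_itv.
Qed.

Lemma continuous_measurable_rV (f : E -> R) : continuous f -> measurable_fun setT f.
Proof.
move=> cf; apply: (measurability _ (RGenOInfty.measurableE R)).
move=> _ [_ [a ->] <-]; rewrite setTI; apply: open_measurable_rV.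
move/continuousP : cf; apply.
exact: rray_open.
Qed.

End rV_geometry.

(** * Fubini's theorem along an arbitrary coordinate *)

Section insert_coordinate.
Context (R : realType) (n : nat) (i : 'I_n.+1).

(** The recursion defining [leb] splits off coordinate 0; [ins i] puts the new coordinate at
    position [i], so that a partial derivative in any direction can be integrated along its own
    line. *)
Definition ins (p : measurableTypeR R * 'rV[R]_n) : 'rV[R]_n.+1 :=
  \row_k if unlift i k is Some j then p.2 ord0 j else p.1.

Definition rem (x : 'rV[R]_n.+1) : 'rV[R]_n := \row_j x ord0 (lift i j).

Lemma ins_coord p : ins p ord0 i = p.1.
Proof. by rewrite mxE unlift_none. Qed.

Lemma ins_lift p j : ins p ord0 (lift i j) = p.2 ord0 j.
Proof. by rewrite mxE liftK. Qed.

Lemma ins_rem (x : 'rV[R]_n.+1) : ins (x ord0 i, rem x) = x.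
Proof.
apply/rowP => k; rewrite mxE /=; case: unliftP => [j|] -> //.
by rewrite mxE.
Qed.

Lemma rem_ins p : rem (ins p) = p.2.
Proof. by apply/rowP => j; rewrite mxE ins_lift. Qed.

Lemma measurable_ins : measurable_fun setT ins.
Proof.
apply: measurable_fun_rVP => k.
under eq_fun do rewrite mxE.
case: unliftP => [j _|_] /=; last exact: measurable_fst.
apply: (@measurableT_comp _ _ _ _ _ _ (fun x : 'rV[R]_n => x ord0 j)) => //.
exact: measurable_coord.
Qed.

Lemma measurable_rem : measurable_fun setT rem.
Proof.
apply: measurable_fun_rVP => k; under eq_fun do rewrite mxE.
exact: measurable_coord.
Qed.

Lemma insE t y : ins (t, y) = ins (0, y) + t *: unitv R i.
Proof.
apply/rowP => k; rewrite !mxE eqxx /=; case: unliftP => [j|] -> /=.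
  by rewrite eq_sym (negbTE (neq_lift _ _)) mulr0 addr0.
by rewrite eqxx mulr1 add0r.
Qed.

(** Both measures give a box the product of its side lengths, and boxes determine the measure. *)
Lemma leb_ins A : measurable A ->
  leb R n.+1 A = (lebesgue_measure \x leb R n)%E (ins @^-1` A).
Proof.
pose m := measure_function_pushforward__canonical__measure_function_Measure
     (lebesgue_measure \x leb R n)%E measurable_ins.
apply: (@measure_eq_boxes _ _ m) => {}A mA.
rewrite leb_box// /m /= /pushforward.
have -> : ins @^-1` box A = A i `*` box (fun j => A (lift i j)).
  apply/seteqP; split => -[t x] /=.
    move=> H; split; first by have := H i; rewrite ins_coord.
    by move=> j; have := H (lift i j); rewrite ins_lift.
  move=> [At Ax] k; rewrite mxE /=.
  by case: unliftP => [j|] -> //; exact: Ax.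
rewrite product_measure1E; [|exact: mA|exact: measurable_box].
by rewrite (bigD1_ord i)//= [in RHS]leb_box//.
Qed.

Lemma integral_ins_prod f : measurable_fun setT f -> (forall x, (0 <= f x)%E) ->
  (\int[leb R n.+1]_x f x =
   \int[(lebesgue_measure \x leb R n)%E]_p f (ins p))%E.
Proof.
move=> mf f0.
pose m := measure_function_pushforward__canonical__measure_function_Measure
     (lebesgue_measure \x leb R n)%E measurable_ins.
rewrite (@eq_measure_integral _ _ _ _ m); last by move=> A mA _; exact: leb_ins.
by rewrite (ge0_integral_pushforward measurable_ins).
Qed.

Lemma integral_ins f : measurable_fun setT f -> (forall x, (0 <= f x)%E) ->
  (\int[leb R n.+1]_x f x =
   \int[lebesgue_measure]_t \int[leb R n]_y f (ins (t, y)))%E.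
Proof.
move=> mf f0; rewrite integral_ins_prod// fubini_tonelli1//.
exact: (measurableT_comp mf measurable_ins).
Qed.

Lemma integral_ins' f : measurable_fun setT f -> (forall x, (0 <= f x)%E) ->
  (\int[leb R n.+1]_x f x =
   \int[leb R n]_y \int[lebesgue_measure]_t f (ins (t, y)))%E.
Proof.
move=> mf f0; rewrite integral_ins_prod// fubini_tonelli2//.
exact: (measurableT_comp mf measurable_ins).
Qed.

Lemma measurable_integral_ins f : measurable_fun setT f -> (forall x, (0 <= f x)%E) ->
  measurable_fun setT (fun y => \int[lebesgue_measure]_t f (ins (t, y)))%E.
Proof.
move=> mf f0.
have := @measurable_fun_fubini_tonelli_G _ _ _ _ R (@lebesgue_measure R) (fun p => f (ins p)).
by apply => //; exact: (measurableT_comp mf measurable_ins).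
Qed.

Lemma integrable_ins_Fubini (f : 'rV[R]_n.+1 -> \bar R) :
  (leb R n.+1).-integrable setT f ->
  (\int[leb R n.+1]_x f x =
   \int[leb R n]_y \int[lebesgue_measure]_t f (ins (t, y)))%E.
Proof.
move=> /integrableP[mf iF].
pose m := measure_function_pushforward__canonical__measure_function_Measure
     (lebesgue_measure \x leb R n)%E measurable_ins.
have mfi : measurable_fun setT (f \o ins) by exact: (measurableT_comp mf measurable_ins).
have ifi : (lebesgue_measure \x leb R n)%E.-integrable setT (f \o ins).
  apply/integrableP; split => //.
  by rewrite -(integral_ins_prod (f := fun x => `|f x|%E))//; exact: measurableT_comp.
rewrite (@eq_measure_integral _ _ _ _ m); last by move=> A mA _; exact: leb_ins.
rewrite (integral_pushforward measurable_ins)// -integral21_prod_meas1//.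
Qed.

End insert_coordinate.

(** * Compactly supported functions and their integrals along coordinate lines *)

Section compactly_supported.
Context (R : realType).

Definition csupp d (F : 'rV[R]_d -> R) :=
  exists2 K, compact K & forall x, ~ K x -> F x = 0.

Lemma csupp_bound d (F : 'rV[R]_d -> R) : csupp F ->
  exists2 M, 0 < M & forall x, M < `|x| -> F x = 0.
Proof.
move=> [K /compact_bounded[M [_ KM]] FK].
exists (`|M| + 1); first by rewrite ltr_wpDl.
move=> x Mx; apply: FK => Kx.
have : `|x| <= `|M| + 1.
  by apply: (KM (`|M| + 1)) => //; rewrite (le_lt_trans (ler_norm _))// ltrDl.
by rewrite leNgt Mx.
Qed.

Lemma csupp_bounded d (F : 'rV[R]_d -> R) : continuous F -> csupp F ->
  exists2 C, 0 <= C & forall x, `|F x| <= C.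
Proof.
move=> cF [K cK FK].
have : compact (F @` K).
  by apply: continuous_compact => //; exact: continuous_subspaceT.
move=> /compact_bounded[M [_ KM]].
exists (`|M| + 1); first by rewrite addr_ge0.
move=> x; have [Kx|nKx] := pselect (K x); last by rewrite FK// normr0 addr_ge0.
apply: (KM (`|M| + 1)); last by exists x.
by rewrite (le_lt_trans (ler_norm _))// ltrDl.
Qed.

Lemma csupp_integrable d (F : 'rV[R]_d -> R) : continuous F -> csupp F ->
  (leb R d).-integrable setT (EFin \o F).
Proof.
move=> cF sF; have [C C0 FC] := csupp_bounded cF sF.
have [M M0 FM] := csupp_bound sF.
apply: (@le_integrable _ _ _ _ _ measurableT _ (fun x => (C * \1_(cube M) x)%:E)).
- by apply/measurable_EFinP; exact: continuous_measurable_rV.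
- move=> x _; rewrite !abse_EFin lee_fin normrM (ger0_norm C0) indicE.
  have [Mx|Mx] := leP `|x| M.
    by rewrite mem_set ?normr1 ?mulr1//; apply/cubeP => //; exact: ltW.
  by rewrite FM// normr0 mulr_ge0.
- apply/integrableP; split.
    by apply/measurable_EFinP; apply: measurable_funM => //; exact: measurable_indic (measurable_cube _).
  under eq_integral do rewrite EFinM gee0_abs ?mule_ge0 ?lee_fin//.
  rewrite ge0_integralZl//; last first.
    by apply/measurable_EFinP; exact: measurable_indic (measurable_cube _).
  rewrite integral_indic ?setIT//; last exact: measurable_cube.
  by rewrite lte_mul_pinfty// leb_cube_lty.
Qed.

Lemma derive_csupp d (F : 'rV[R]_d -> R) K v : compact K ->
  (forall x, ~ K x -> F x = 0) -> forall x, ~ K x -> 'D_v F x = 0.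
Proof.
move=> cK FK x nKx.
have oK : open (~` K).
  by rewrite openC; apply: compact_closed => //; exact: norm_hausdorff.
transitivity ('D_v (cst (0 : R)) x); last exact: derive_cst.
apply: near_eq_derive.
have : nbhs x (~` K) by exact: open_nbhs_nbhs.
by apply: filterS => y /FK ->.
Qed.

Lemma csupp_derive d (F : 'rV[R]_d -> R) v : csupp F -> csupp ('D_v F).
Proof. by move=> [K cK FK]; exists K => //; exact: derive_csupp. Qed.

Lemma is_derive_line d (F : 'rV[R]_d -> R) b v t :
  derivable F (b + t *: v) v ->
  is_derive t 1 (fun s : R => F (b + s *: v)) ('D_v F (b + t *: v)).
Proof.
move=> dF.
have E : (fun h : R => h^-1 *: (((fun s : R => F (b + s *: v)) \o shift t) (h *: (1 : R)) - F (b + t *: v)))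
   = (fun h : R => h^-1 *: ((F \o shift (b + t *: v)) (h *: v) - F (b + t *: v))).
  apply/funext => h /=; congr (_ *: (F _ - _)).
  by rewrite [h *: 1]mulr1 scalerDl addrCA.
by split; rewrite /derivable /derive E.
Qed.

Lemma line_continuous d (b v : 'rV[R]_d) : continuous (fun s : R => b + s *: v).
Proof.
move=> s; apply: cvgD; first exact: cvg_cst.
by apply: cvgZr_tmp; exact: cvg_id.
Qed.

Context (n : nat) (i : 'I_n.+1) (F : 'rV[R]_n.+1 -> R).
Hypotheses (cF : continuous F) (sF : csupp F)
  (dF : forall x, derivable F x (unitv R i)) (cDF : continuous ('D_(unitv R i) F)).

Lemma continuous_ins (y : 'rV[R]_n) : continuous (fun t : R => ins i (t, y)).
Proof.
rewrite (_ : (fun t => _) = fun t => ins i (0, y) + t *: unitv R i); first exact: line_continuous.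
by apply/funext => t; rewrite insE.
Qed.

Lemma integral_line a b (y : 'rV[R]_n) : a < b ->
  (\int[lebesgue_measure]_(t in `[a, b]) ('D_(unitv R i) F (ins i (t, y)))%:E)%E
  = (F (ins i (b, y)) - F (ins i (a, y)))%:E.
Proof.
move=> ab; rewrite EFinB.
have dl (t : R) : is_derive t 1 (fun t : R => F (ins i (t, y))) ('D_(unitv R i) F (ins i (t, y))).
  rewrite insE (_ : (fun t => F _) = fun t => F (ins i (0, y) + t *: unitv R i)); last first.
    by apply/funext => s; rewrite insE.
  exact: is_derive_line.
have cl : continuous (fun t : R => F (ins i (t, y))).
  by move=> t; apply: continuous_comp; [exact: continuous_ins|exact: cF].
apply: (@continuous_FTC2 _ _ (fun t => F (ins i (t, y))) _ _ ab).
- apply: continuous_subspaceT => t.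
  by apply: (@continuous_comp _ _ _ (fun t => ins i (t, y)) ('D_(unitv R i) F)); [exact: continuous_ins|exact: cDF].
- split.
  + by move=> t _; case: (dl t).
  + by apply: cvg_at_right_filter; exact: cl.
  + by apply: cvg_at_left_filter; exact: cl.
- by move=> t _; rewrite derive1E; case: (dl t).
Qed.

Lemma norm_ins_ge t (y : 'rV[R]_n) : `|t| <= `|ins i (t, y)|.
Proof. by rewrite -[X in `|X|](ins_coord i (t, y)) norm_coord_le. Qed.

Lemma integral_lineT (y : 'rV[R]_n) :
  (\int[lebesgue_measure]_t ('D_(unitv R i) F (ins i (t, y)))%:E)%E = 0%E.
Proof.
have [M M0 FM] := csupp_bound sF.
have [M' M'0 DM] := csupp_bound (csupp_derive (unitv R i) sF).
pose N := M + M'.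
have MN : M < N by rewrite ltrDl.
have M'N : M' < N by rewrite ltrDr.
have N0 : 0 < N by exact: lt_trans MN.
transitivity (\int[lebesgue_measure]_(t in `[(- N)%R, N]) ('D_(unitv R i) F (ins i (t, y)))%:E)%E.
  rewrite [RHS]integral_mkcond; apply: eq_integral => t _; rewrite patchE.
  case: ifPn => //; rewrite notin_setE /= in_itv/= -ler_norml => /negP; rewrite -ltNge => Nt.
  by rewrite DM// (lt_le_trans _ (norm_ins_ge _ _))// (lt_trans _ Nt).
rewrite integral_line ?gt_opp//; last by rewrite gtrN.
rewrite !FM ?subrr//; apply: lt_le_trans (norm_ins_ge _ _).
  by rewrite normrN gtr0_norm.
by rewrite gtr0_norm.
Qed.

(** Fubini in direction [i], and on each line the fundamental theorem of calculus between two points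
    outside the support. Every later integration by parts in space rests on this. *)
Lemma integral_partial_eq0 :
  (\int[leb R n.+1]_x ('D_(unitv R i) F x)%:E)%E = 0%E.
Proof.
rewrite (integrable_ins_Fubini i (f := fun x => ('D_(unitv R i) F x)%:E)).
  by apply: integral0_eq => y _; exact: integral_lineT.
by apply: csupp_integrable => //; exact: csupp_derive.
Qed.

(** The fundamental theorem of calculus from a point outside the support up to [x], with the
    integral then enlarged to the whole line. The right side does not depend on coordinate [i] of
    [x], which is the source of Ladyzhenskaya's inequality. *)
Lemma norm_le_integral_line x :
  ((`|F x|)%:E <= \int[lebesgue_measure]_t (`|'D_(unitv R i) F (ins i (t, rem i x))|)%:E)%E.
Proof.
have [M M0 FM] := csupp_bound sF.
(* To the left of [x], and outside the support because this single coordinate already has modulus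
   above [M]. *)
pose a := - (M + `|x ord0 i| + 1).
have ax : a < x ord0 i.
  rewrite /a; have := ler_norm (- x ord0 i); rewrite normrN.
  by lra.
have Fa : F (ins i (a, rem i x)) = 0.
  apply: FM; apply: lt_le_trans (norm_ins_ge _ _).
  by rewrite /a normrN ger0_norm; have := normr_ge0 (x ord0 i); lra.
have md (D : set R) : measurable_fun D (fun t : R => 'D_(unitv R i) F (ins i (t, rem i x))).
  apply: measurable_funTS; apply: continuous_measurable_fun => t.
  by apply: (@continuous_comp _ _ _ (fun t => ins i (t, rem i x)) ('D_(unitv R i) F)); [exact: continuous_ins|exact: cDF].
have := integral_line (rem i x) ax.
rewrite ins_rem Fa subr0 => E; rewrite -abse_EFin -E.
apply: (le_trans (le_abse_integral lebesgue_measure (measurable_itv `[a, x ord0 i]) _)) => //=.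
  by apply/measurable_EFinP; exact: (md `[a, x ord0 i]%classic).
apply: ge0_subset_integral => //.
apply/measurable_EFinP; apply: measurableT_comp => //.
exact: (md setT).
Qed.

End compactly_supported.

(** * Test functions and their density *)

Section flat_functions.
Context (R : realType).
Implicit Types (p q : {poly R}) (x y : R).

Definition smooth1 (f : R -> R) := forall n x, derivable (derive1n n f) x 1.

(** Iterated derivatives never have to be computed: it is enough to exhibit a class of derivable
    functions that is stable under differentiation. *)
Lemma smooth1_coind (C : set (R -> R)) :
  (forall f, C f -> (forall x, derivable f x 1) /\ C (f^`()%classic)) ->
  forall f, C f -> smooth1 f.
Proof.
move=> H f Cf n; suff Cn : C (derive1n n f) by case: (H _ Cn).
by elim: n => // n /H[].
Qed.

(** The classical exp(-1/x) extended by 0, with a polynomial factor in 1/x that makes the family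
    stable under differentiation: [p] becomes X^2 (p - p'). *)
Definition flat p x := if 0 < x then p.[x^-1] * expR (- x^-1) else 0.

Lemma poly_norm_le p y : 1 <= y -> `|p.[y]| <= (\sum_(i < size p) `|p`_i|) * y ^+ size p.
Proof.
move=> y1; rewrite horner_coef mulr_suml; apply: le_trans (ler_norm_sum _ _ _) _.
apply: ler_sum => i _; rewrite normrM ler_wpM2l// normrX ger0_norm ?(le_trans ler01)//.
by apply: ler_weXn2l => //; exact: ltnW.
Qed.

Lemma flat_le p : exists2 C, 0 <= C & forall x, 0 < x <= 1 -> `|flat p x| <= C * x ^+ 2.
Proof.
pose A := \sum_(i < size p) `|p`_i|.
(* The exponential is bounded below by its term of degree [size p] + 2: [size p] powers absorb the
   polynomial and the other two leave x^2. *)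
pose m := (size p).+1.
exists (A * (m.+1)`!%:R); first by rewrite mulr_ge0// sumr_ge0.
move=> x /andP[x0 x1]; rewrite /flat x0.
have y1 : 1 <= x^-1 by rewrite invf_ge1.
have y0 : 0 < x^-1 by rewrite invr_gt0.
rewrite normrM [`|expR _|]ger0_norm ?expR_ge0// expRN.
have Ey : (x^-1) ^+ m.+1 / (m.+1)`!%:R <= expR x^-1.
  by have := @expR_ge1Dxn _ (x^-1) m (ltW y0); lra.
have E0 : 0 < x^-1 ^+ m.+1 / (m.+1)`!%:R.
  by rewrite divr_gt0 ?exprn_gt0// ltr0n fact_gt0.
apply: (@le_trans _ _ ((A * x^-1 ^+ size p) * (x^-1 ^+ m.+1 / (m.+1)`!%:R)^-1)).
  apply: ler_pM => //; first exact: poly_norm_le.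
  by rewrite lef_pV2// posrE expR_gt0.
rewrite le_eqVlt; apply/orP; left; apply/eqP.
rewrite invf_div.
have -> : x^-1 ^+ m.+1 = x^-1 ^+ size p * x^-1 ^+ 2 by rewrite -exprD addn2.
have X0 : x != 0 by rewrite gt_eqF.
have Y0 : x^-1 ^+ size p != 0 by rewrite expf_neq0 ?invr_eq0.
by field; rewrite ?Y0 ?X0.
Qed.

(** Only x = 0 is delicate: there [flat_le] bounds the difference quotient from the right by C h. *)
Lemma is_derive_flat p x : is_derive x 1 (flat p) (flat ('X^2 * (p - p^`())) x).
Proof.
have [x0|x0|<-] := ltgtP 0 x.
- apply: (@near_eq_is_derive _ _ _ (fun y => p.[y^-1] * expR (- y^-1))).
    near=> y; rewrite /flat ifT//.
    by near: y; exact: lt_nbhsr.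
  have dp (y : R) : is_derive y 1 (horner p) (p^`().[y]).
    by split; [exact: derivable_horner|rewrite -derive1E -derivE].
  have xV : x != 0 by rewrite gt_eqF.
  have dV : is_derive x 1 (fun y : R => y^-1) (- x ^- 2).
    by have := @is_deriveV R id x 1 1 xV (is_derive_id _ _); rewrite scaler1 /=.
  have dPV := @is_derive1_comp R (horner p) (fun y : R => y^-1) x _ _ (dp _) dV.
  have dEV := @is_derive1_comp R expR (fun y : R => - y^-1) x _ _ (is_derive_expR _) (is_deriveN dV).
  have := is_deriveM dPV dEV.
  set e := (X in is_derive _ _ _ X -> _) => H; apply: DeriveDef; first by case: H.
  case: H => _ ->; rewrite /e /flat x0 /=.
  rewrite !hornerE /GRing.scale /= exprVn; ring.
- rewrite {2}/flat ltNge (ltW x0) /=.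
  apply: (@near_eq_is_derive _ _ _ (cst 0)).
  near=> y; rewrite /flat ifF//; apply/negbTE; rewrite -leNgt ltW//.
  by near: y; exact: lt_nbhsl.
- rewrite {2}/flat ltxx /=.
  have [C C0 HC] := flat_le p.
  have Cp : 0 < C + 1 by rewrite ltr_wpDl.
  have c0 : h^-1 *: ((flat p \o shift (0 : R)) (h *: (1 : R)) - flat p 0) @[h --> 0^'] --> (0 : R).
    apply/cvgrPdist_le => e e0; near=> h.
    rewrite sub0r normrN [_ *: 1]mulr1 /= addr0 {2}/flat ltxx subr0.
    have h0 : h != 0 by near: h; exact: nbhs_dnbhs_neq.
    have [hp|hp] := ltP 0 h; last by rewrite /flat ltNge hp /= scaler0 normr0 ltW.
    have hC : C * h <= e.
      apply: (@le_trans _ _ ((C + 1) * h)); first by rewrite ler_wpM2r ?lerDl ?ltW.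
      rewrite mulrC -ler_pdivlMr//.
      by apply: ltW; near: h; apply: nbhs_dnbhs; apply: lt_nbhsl; exact: divr_gt0.
    have h1 : h <= 1 by apply: ltW; near: h; apply: nbhs_dnbhs; apply: lt_nbhsl; exact: ltr01.
    apply: le_trans hC; rewrite normrM normrV ?unitfE// gtr0_norm// mulrC ler_pdivrMr//.
    by apply: (le_trans (HC h _)); rewrite ?hp ?h1// expr2 mulrA.
  by apply: DeriveDef; [apply/cvg_ex; exists 0|apply/cvg_lim].
Unshelve. all: by end_near. Qed.

Lemma flat0 p x : x <= 0 -> flat p x = 0.
Proof. by rewrite /flat leNgt => /negbTE ->. Qed.

Lemma flatZ (c : R) p x : flat (c *: p) x = c * flat p x.
Proof. by rewrite /flat; case: ifP => _; rewrite ?mulr0// hornerZ mulrA. Qed.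

Lemma flat1_ge0 x : 0 <= flat 1 x.
Proof. by rewrite /flat; case: ifP => // _; rewrite hornerC mul1r expR_ge0. Qed.

Lemma flat1_le1 x : flat 1 x <= 1.
Proof.
rewrite /flat; case: ifP => // x0; rewrite hornerC mul1r -expR0 ler_expR.
by rewrite oppr_le0 invr_ge0 ltW.
Qed.

Lemma flat1_cvg x : 0 < x -> flat 1 (n.+1%:R * x) @[n --> \oo] --> (1 : R).
Proof.
move=> x0; rewrite (_ : (fun n => _) = fun n => expR (- (x^-1 * n.+1%:R^-1))); last first.
  by apply/funext => n; rewrite /flat mulr_gt0// hornerC mul1r invfM mulrC.
rewrite -[X in _ --> X]expR0.
apply: (@cvg_comp _ _ _ (fun n : nat => - (x^-1 * n.+1%:R^-1)) (@expR R) _ (nbhs (0 : R))).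
  rewrite -oppr0; apply: cvgN; rewrite -[X in _ --> X](mulr0 x^-1).
  apply: cvgMr; exact: cvg_harmonic.
exact: continuous_expR.
Qed.

Section bump.
Context (a b : R).

(** As [k] grows the support stays in [a, b] while the values inside tend to 1, since exp(-1/(k y))
    tends to 1 for y > 0. Indicators of intervals are thus approximated by smooth functions without
    any convolution. *)
Definition bump k x := flat 1 (k * (x - a)) * flat 1 (k * (b - x)).

Lemma is_derive_affine (k c x : R) : is_derive x 1 (fun y => k * (y - c)) k.
Proof.
have := @is_deriveZ _ _ _ (fun y : R => y - c) k x 1 _ (is_deriveB (is_derive_id x 1) (is_derive_cst c x 1)).
by rewrite subr0 [_ *: 1]mulr1.
Qed.

Lemma is_derive_flat_prod k p q x :
  is_derive x 1 (fun y => flat p (k * (y - a)) * flat q (k * (b - y)))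
   (flat (k *: ('X^2 * (p - p^`()))) (k * (x - a)) * flat q (k * (b - x)) +
    flat p (k * (x - a)) * flat (- k *: ('X^2 * (q - q^`()))) (k * (b - x))).
Proof.
have d1 := @is_derive1_comp R (flat p) (fun y => k * (y - a)) x _ _ (is_derive_flat p _) (is_derive_affine k a x).
have E y : k * (b - y) = (- k) * (y - b) by ring.
have d2 := @is_derive1_comp R (flat q) (fun y => - k * (y - b)) x _ _ (is_derive_flat q _) (is_derive_affine (- k) b x).
have := is_deriveM d1 d2.
set e := (X in is_derive _ _ _ X -> _) => H.
rewrite (_ : (fun y => _) = (flat p \o (fun y => k * (y - a))) * (flat q \o (fun y => - k * (y - b)))).
  apply: DeriveDef; first by case: H.
  by case: H => _ ->; rewrite /e !flatZ /GRing.scale /= E; ring.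
by apply/funext => y; rewrite !fctE /= E.
Qed.

Lemma bump_smooth k : smooth1 (bump k).
Proof.
(* Finite sums of products of two flat functions: the Leibniz rule stays inside this class. *)
pose C : set (R -> R) := [set f | exists s : seq ({poly R} * {poly R}),
  f = fun x => \sum_(pq <- s) flat pq.1 (k * (x - a)) * flat pq.2 (k * (b - x))].
apply: (@smooth1_coind C); last first.
  by exists [:: (1, 1)]; apply/funext => x; rewrite big_seq1.
move=> _ [s ->].
pose D1 (p : {poly R}) := k *: ('X^2 * (p - p^`())).
pose D2 (p : {poly R}) := - k *: ('X^2 * (p - p^`())).
pose g (s : seq ({poly R} * {poly R})) x := \sum_(pq <- s) flat pq.1 (k * (x - a)) * flat pq.2 (k * (b - x)).
pose s' := [seq (D1 pq.1, pq.2) | pq <- s] ++ [seq (pq.1, D2 pq.2) | pq <- s].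
have H x : is_derive x 1 (g s) (g s' x).
  rewrite /s' /g big_cat !big_map /= -big_split /=.
  elim: s {s'} => [|pq s IH].
    rewrite big_nil (_ : (fun x => _) = cst 0); first exact: is_derive_cst.
    by apply/funext => y; rewrite big_nil.
  rewrite big_cons (_ : (fun x => _) = (fun y => flat pq.1 (k * (y - a)) * flat pq.2 (k * (b - y))) +
     (fun x => \sum_(pq <- s) flat pq.1 (k * (x - a)) * flat pq.2 (k * (b - x)))).
    by apply: is_deriveD => //; exact: is_derive_flat_prod.
  by apply/funext => y; rewrite big_cons.
split; first by move=> x; case: (H x).
exists s'; apply/funext => x; rewrite derive1E; by case: (H x).
Qed.

Lemma bump_ge0 k x : 0 <= bump k x.
Proof. by rewrite mulr_ge0// flat1_ge0. Qed.

Lemma bump_le1 k x : bump k x <= 1.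
Proof. by rewrite -[1]mulr1 ler_pM ?flat1_ge0 ?flat1_le1. Qed.

Lemma bump_out k x : 0 <= k -> ~ (a < x < b) -> bump k x = 0.
Proof.
move=> k0 /negP; rewrite negb_and -!leNgt => /orP[h|h]; rewrite /bump.
  by rewrite flat0 ?mul0r// mulr_ge0_le0// subr_le0.
by rewrite [X in _ * X]flat0 ?mulr0// mulr_ge0_le0// subr_le0.
Qed.

Lemma bump_cvg x : bump n.+1%:R x @[n --> \oo] --> (\1_(`]a, b[%classic) x : R).
Proof.
rewrite indicE; have [xab|xab] := boolP (a < x < b).
  rewrite mem_set/= ?in_itv//=; move: xab => /andP[ax xb].
  rewrite -[X in _ --> X]mulr1; apply: cvgM; apply: flat1_cvg; by rewrite subr_gt0.
rewrite memNset/= ?in_itv/=; last exact/negP.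
rewrite (_ : (fun n => _) = cst 0); first exact: cvg_cst.
by apply/funext => n; rewrite bump_out//; exact/negP.
Qed.

End bump.
End flat_functions.

(** * Smooth functions of several variables and test functions *)

Section test_functions.
Context (R : realType) (d : nat).
Local Notation E := 'rV[R]_d.

Lemma continuous_addf (f g : E -> R) : continuous f -> continuous g -> continuous (f + g).
Proof. by move=> cf cg x; apply: continuousD; [exact: cf|exact: cg]. Qed.

Lemma continuous_mulf (f g : E -> R) : continuous f -> continuous g -> continuous (f * g).
Proof. by move=> cf cg x; apply: continuousM; [exact: cf|exact: cg]. Qed.

Lemma continuous_scalef a (f : E -> R) : continuous f -> continuous (a *: f).
Proof.
by move=> cf; apply: (@continuous_mulf (cst a) f) => //; exact: cst_continuous.
Qed.

Lemma is_derive_mulf (f g : E -> R) x v : derivable f x v -> derivable g x v ->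
  is_derive x v (f * g) (f x * 'D_v g x + 'D_v f x * g x).
Proof.
move=> df dg; have := @is_deriveM R _ f g x v _ _ (derivableP df) (derivableP dg).
by rewrite /GRing.scale /= [X in _ + X]mulrC.
Qed.

Lemma pderiv_cons i s (phi : E -> R) : pderiv (i :: s) phi = 'D_(unitv R i) (pderiv s phi).
Proof. by []. Qed.

Lemma pderiv_cat s1 s2 (phi : E -> R) : pderiv (s1 ++ s2) phi = pderiv s1 (pderiv s2 phi).
Proof. by rewrite /pderiv foldr_cat. Qed.

Lemma smooth_continuous (phi : E -> R) : smooth phi -> continuous phi.
Proof. by move=> /(_ [::])[]. Qed.

Lemma smooth_derivable (phi : E -> R) i x : smooth phi -> derivable phi x (unitv R i).
Proof. by move=> /(_ [::])[_]; exact. Qed.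

Lemma smooth_pderiv s (phi : E -> R) : smooth phi -> smooth (pderiv s phi).
Proof. by move=> sphi s'; rewrite -pderiv_cat; exact: sphi. Qed.

Lemma smooth_coind (C : set (E -> R)) :
  (forall f, C f -> continuous f /\
     forall i, (forall x, derivable f x (unitv R i)) /\ C ('D_(unitv R i) f)) ->
  forall f, C f -> smooth f.
Proof.
move=> H f Cf s; have Cs : C (pderiv s f).
  by elim: s => // i s /H[_ /(_ i)[]].
have [cf df] := H _ Cs; split => // i x; by case: (df i).
Qed.

Lemma pderiv_lin s a (f g : E -> R) : smooth f -> smooth g ->
  pderiv s (a *: f + g) = a *: pderiv s f + pderiv s g.
Proof.
move=> sf sg; elim: s => // i s IH; rewrite !pderiv_cons IH.
apply/funext => x; rewrite deriveD ?deriveZ//.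
- exact/smooth_derivable/smooth_pderiv.
- by apply: derivableZ; exact/smooth_derivable/smooth_pderiv.
- exact/smooth_derivable/smooth_pderiv.
Qed.

Lemma smooth_lin a (f g : E -> R) : smooth f -> smooth g -> smooth (a *: f + g).
Proof.
move=> sf sg s; rewrite pderiv_lin//.
have [cf df] := sf s; have [cg dg] := sg s; split.
  by apply: continuous_addf => //; exact: continuous_scalef.
move=> i x; apply: derivableD => //; exact: derivableZ.
Qed.

Lemma smooth0 : smooth (0 : E -> R).
Proof.
apply: (@smooth_coind [set 0]) => // _ ->; split; first exact: cst_continuous.
move=> i; split; first by move=> x; exact: derivable_cst.
by apply/funext => x; exact: derive_cst.
Qed.

Lemma smoothM (f g : E -> R) : smooth f -> smooth g -> smooth (f * g).
Proof.
move=> sf sg.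
(* A list of pairs of multi-indices codes a sum of products of derivatives; by the Leibniz rule,
   differentiation acts on the list as in [s'] below. *)
pose F (s : seq (seq 'I_d * seq 'I_d)) : E -> R :=
  \sum_(p <- s) pderiv p.1 f * pderiv p.2 g.
pose C : set (E -> R) := [set h | exists s, h = F s].
apply: (@smooth_coind C); last by exists [:: ([::], [::])]; rewrite /F big_seq1.
move=> _ [s ->].
have cf u : continuous (pderiv u f) by case: (sf u).
have cg u : continuous (pderiv u g) by case: (sg u).
split.
  rewrite /F; elim: s => [|p s IH].
    by rewrite big_nil; exact: cst_continuous.
  by rewrite big_cons; apply: continuous_addf => //; exact: continuous_mulf.
move=> i.
pose s' := [seq (p.1, i :: p.2) | p <- s] ++ [seq (i :: p.1, p.2) | p <- s].
have H x : is_derive x (unitv R i) (F s) (F s' x).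
  rewrite /s' /F big_cat !big_map /= -big_split /=.
  elim: s {s'} => [|p s IH]; first by rewrite !big_nil; exact: is_derive_cst.
  rewrite !big_cons; apply: is_deriveD.
  have df : derivable (pderiv p.1 f) x (unitv R i) by exact/smooth_derivable/smooth_pderiv.
  have dg : derivable (pderiv p.2 g) x (unitv R i) by exact/smooth_derivable/smooth_pderiv.
  exact: is_derive_mulf.
split; first by move=> x; case: (H x).
by exists s'; apply/funext => x; case: (H x).
Qed.

Lemma Ccinfty_smooth (Om : set E) phi : Ccinfty Om phi -> smooth phi.
Proof. by case. Qed.

Lemma Ccinfty_csupp (Om : set E) phi : Ccinfty Om phi -> csupp phi.
Proof. by move=> [_ [K [cK _ HK]]]; exists K. Qed.

Lemma Ccinfty_out (Om : set E) phi x : Ccinfty Om phi -> ~ Om x -> phi x = 0.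
Proof. by move=> [_ [K [_ KO HK]]] Ox; apply: HK => /KO. Qed.

Lemma Ccinfty0 (Om : set E) : Ccinfty Om 0.
Proof.
split; first exact: smooth0.
by exists set0; split => //; exact: compact0.
Qed.

Lemma Ccinfty_lin (Om : set E) a phi psi : Ccinfty Om phi -> Ccinfty Om psi ->
  Ccinfty Om (a *: phi + psi).
Proof.
move=> [s1 [K1 [c1 O1 H1]]] [s2 [K2 [c2 O2 H2]]]; split; first exact: smooth_lin.
exists (K1 `|` K2); split; first exact: compactU.
  by move=> x [/O1|/O2].
move=> x /not_orP[n1 n2]; rewrite !fctE H1// H2// addr0; exact: mulr0.
Qed.

Lemma CcinftyD (Om : set E) phi psi : Ccinfty Om phi -> Ccinfty Om psi ->
  Ccinfty Om (phi + psi).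
Proof. by move=> h1 h2; rewrite -[phi]scale1r; exact: Ccinfty_lin. Qed.

Lemma CcinftyZ (Om : set E) a phi : Ccinfty Om phi -> Ccinfty Om (a *: phi).
Proof. by move=> h1; rewrite -[_ *: _]addr0; apply: Ccinfty_lin => //; exact: Ccinfty0. Qed.

Lemma CcinftyB (Om : set E) phi psi : Ccinfty Om phi -> Ccinfty Om psi ->
  Ccinfty Om (phi - psi).
Proof. by move=> h1 h2; apply: CcinftyD => //; rewrite -scaleN1r; exact: CcinftyZ. Qed.

Lemma CcinftyM (Om : set E) phi psi : Ccinfty Om phi -> Ccinfty Om psi ->
  Ccinfty Om (phi * psi).
Proof.
move=> [s1 [K1 [c1 O1 H1]]] [s2 _]; split; first exact: smoothM.
by exists K1; split => // x n1; rewrite !fctE H1// mul0r.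
Qed.

Lemma Ccinfty_pderiv (Om : set E) s phi : Ccinfty Om phi -> Ccinfty Om (pderiv s phi).
Proof.
move=> [s1 [K [cK KO HK]]]; split; first exact: smooth_pderiv.
exists K; split => //; elim: s => // i s IH; rewrite pderiv_cons.
exact: derive_csupp.
Qed.

Lemma csupp_L2 (Om : set E) (F : E -> R) : measurable Om -> continuous F -> csupp F ->
  L2 Om F.
Proof.
move=> mOm cF [K cK FK]; split.
  by apply: measurable_funTS; exact: continuous_measurable_rV.
apply: (@integrableS _ _ _ _ setT) => //.
apply: (@csupp_integrable _ _ (fun x => F x ^+ 2)).
  exact: continuous_mulf.
by exists K => // x /FK ->; rewrite expr0n.
Qed.

Lemma Ccinfty_L2 (Om : set E) phi : measurable Om -> Ccinfty Om phi -> L2 Om phi.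
Proof.
move=> mOm C; apply: csupp_L2 => //; last exact: Ccinfty_csupp C.
exact/smooth_continuous/(Ccinfty_smooth C).
Qed.

Definition prodf (th : 'I_d -> R -> R) : E -> R := fun x => \prod_j th j (x ord0 j).

Lemma continuous_prodf th : (forall j, continuous (th j)) -> continuous (prodf th).
Proof.
move=> cth; rewrite /prodf; elim: (index_enum _) => [|j s IH].
  by rewrite (_ : (fun x => _) = cst 1); [exact: cst_continuous|apply/funext => x; rewrite big_nil].
rewrite (_ : (fun x => _) = (fun x : E => th j (x ord0 j)) * (fun x : E => \prod_(j <- s) th j (x ord0 j))).
  apply: continuous_mulf => // x.
  apply: (@continuous_comp _ _ _ (fun x : E => x ord0 j) (th j)); last exact: cth.
  exact: coord_continuous.
by apply/funext => x; rewrite big_cons.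
Qed.

Lemma is_derive_prodf (th : 'I_d -> R -> R) (i : 'I_d) (x : E) : derivable (th i) (x ord0 i) 1 ->
  is_derive x (unitv R i) (prodf th)
    (prodf (fun j => if j == i then (th i)^`()%classic else th j) x).
Proof.
move=> di.
pose C := \prod_(j | j != i) th j (x ord0 j).
have E1 : prodf (fun j => if j == i then (th i)^`()%classic else th j) x = C * 'D_1 (th i) (x ord0 i).
  rewrite /prodf (bigD1 i)//= eqxx mulrC derive1E; congr (_ * _).
  by apply: eq_bigr => j /negbTE ->.
have E2 : (fun h : R => h^-1 *: ((prodf th \o shift x) (h *: unitv R i) - prodf th x)) =
   (fun h : R => C * (h^-1 *: ((th i \o shift (x ord0 i)) (h *: (1 : R)) - th i (x ord0 i)))).
  apply/funext => h; rewrite /= /prodf (bigD1 i)//= [in X in _ - X](bigD1 i)//=.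
  rewrite (eq_bigr (fun j => th j (x ord0 j))); last first.
    by move=> j ji; rewrite !mxE eqxx /= (negbTE ji) mulr0 add0r.
  by rewrite -/C !mxE !eqxx /GRing.scale /= mulr1; ring.
have := di; rewrite /derivable => /cvg_ex[l Hl].
have DE : 'D_1 (th i) (x ord0 i) = l by exact/cvg_lim.
have : h^-1 *: ((prodf th \o shift x) (h *: unitv R i) - prodf th x) @[h --> 0^'] --> C * l.
  by rewrite E2; apply: cvgMr.
move=> c; apply: DeriveDef; first by apply/cvg_ex; exists (C * l).
by rewrite E1 DE; exact/cvg_lim.
Qed.

Lemma smooth_prodf th : (forall j, smooth1 (th j)) -> smooth (prodf th).
Proof.
move=> sth; pose C : set (E -> R) := [set f | exists th, (forall j, smooth1 (th j)) /\ f = prodf th].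
apply: (@smooth_coind C); last by exists th.
move=> _ [{}th [{}sth ->]].
have sth' j : smooth1 ((th j)^`()%classic).
  by move=> n x; rewrite -derive1Sn; exact: sth.
split.
  apply: continuous_prodf => j x; apply/differentiable_continuous.
  by apply/derivable1_diffP; exact: (sth j 0%N).
move=> i; have H x : is_derive x (unitv R i) (prodf th) _ := is_derive_prodf (sth i 0%N _).
split; first by move=> x; case: (H x).
exists (fun j => if j == i then (th i)^`()%classic else th j); split.
  by move=> j; case: ifP.
by apply/funext => x; case: (H x).
Qed.

Definition bumpd (a b : E) (k : R) := prodf (fun j => bump (a ord0 j) (b ord0 j) k).

Lemma bumpd_Ccinfty (Om : set E) (a b : E) k : 0 <= k ->
  box (fun i => `[a ord0 i, b ord0 i]%classic) `<=` Om -> Ccinfty Om (bumpd a b k).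
Proof.
move=> k0 abO; split; first by apply: smooth_prodf => j; exact: bump_smooth.
exists (box (fun i => `[a ord0 i, b ord0 i]%classic)); split => //.
  by apply: rV_compact => i; exact: segment_compact.
move=> x /existsNP[i /= nx]; rewrite /bumpd /prodf (bigD1 i)//= bump_out ?mul0r//.
by move=> /andP[ax xb]; apply: nx; rewrite in_itv/= !ltW.
Qed.

Lemma bumpd_le a b k x : 0 <= k -> 
  `|bumpd a b k x| <= \1_(box (fun i => `]a ord0 i, b ord0 i[%classic)) x.
Proof.
move=> k0; rewrite indicE; have [h|h] := pselect (box (fun i => `]a ord0 i, b ord0 i[%classic) x).
  rewrite mem_set//= normr_prod; apply: prodr_ile1 => j _.
  by rewrite normr_ge0 ger0_norm ?bump_ge0 ?bump_le1.
rewrite memNset//=; move/existsNP : h => [i /= nx].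
by rewrite /bumpd /prodf (bigD1 i)//= bump_out ?mul0r ?normr0//.
Qed.

Lemma bumpd_cvg a b x : bumpd a b n.+1%:R x @[n --> \oo] -->
  (\1_(box (fun i => `]a ord0 i, b ord0 i[%classic)) x : R).
Proof.
have -> : (\1_(box (fun i => `]a ord0 i, b ord0 i[%classic)) x : R) =
    \prod_j \1_(`]a ord0 j, b ord0 j[%classic) (x ord0 j).
  rewrite indicE; have [h|h] := pselect (box (fun i => `]a ord0 i, b ord0 i[%classic) x).
    rewrite mem_set//= big1// => j _; rewrite indicE mem_set//; exact: h.
  rewrite memNset//=; move/existsNP : h => [i /= nx].
  by rewrite (bigD1 i)//= indicE memNset ?mul0r.
rewrite /bumpd /prodf; elim: (index_enum _) => [|j s IH].
  rewrite (_ : (fun n => _) = cst 1); first by rewrite big_nil; exact: cvg_cst.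
  by apply/funext => n; rewrite big_nil.
rewrite (_ : (fun n => _) = (fun n => bump (a ord0 j) (b ord0 j) n.+1%:R (x ord0 j)) *
    (fun n => \prod_(j <- s) bump (a ord0 j) (b ord0 j) n.+1%:R (x ord0 j))).
  by rewrite big_cons; apply: cvgM => //; exact: bump_cvg.
by apply/funext => n; rewrite big_cons.
Qed.

End test_functions.

(** * Density of test functions in L^2 *)

Section density.
Context (R : realType) (d : nat) (Om : set 'rV[R]_d).
Local Notation E := 'rV[R]_d.
Local Notation mu := (leb R d).
Hypothesis mOm : measurable Om.

(** Dominated convergence applied to the squared error, with majorant (2 |g|)^2. *)
Lemma L2_dominated (u : nat -> E -> R) (v g : E -> R) :
  (forall n, measurable_fun Om (u n)) -> L2 Om g ->
  (forall n x, Om x -> `|u n x| <= `|g x|) ->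
  (forall x, Om x -> u n x @[n --> \oo] --> v x) ->
  L2 Om v /\ nrm Om (v - u n) @[n --> \oo] --> 0.
Proof.
move=> mu_ Lg ug uv.
have mv : measurable_fun Om v by exact: measurable_fun_cvg mu_ uv.
have vg x : Om x -> `|v x| <= `|g x|.
  move=> Ox; have c : `|u n x| @[n --> \oo] --> `|v x| by apply: cvg_norm; exact: uv.
  rewrite -(cvg_lim _ c)//; apply: limr_le; first by apply/cvg_ex; eexists; exact: c.
  by apply: nearW => n; exact: ug.
have Lv : L2 Om v by exact: L2_le vg.
split => //.
have Lu n : L2 Om (u n) by apply: L2_le Lg _ => // x; exact: ug.
pose G : E -> R := fun x => (2 * `|g x|) ^+ 2.
have iG : mu.-integrable Om (EFin \o G).
  have [_] := L2Z mOm 2 (L2_norm mOm Lg); exact.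
have [||_ _ /=] := @dominated_convergence _ _ _ mu Om mOm
  (fun n x => ((v x - u n x) ^+ 2)%:E) (cst 0%E) (EFin \o G)
  (fun n => (measurable_EFinP _ _).2 (measurable_funX 2 (measurable_funB mv (mu_ n))))
  (measurable_cst _) _ iG _.
- apply: aeW => x Ox; rewrite [X in _ --> X](_ : _ = (0 ^+ 2)%:E); last by rewrite expr0n.
  apply: cvg_EFin; first exact: nearW.
  apply: (@cvg_comp _ _ _ (fun m => v x - u m x) (fun y => y ^+ 2) _ (nbhs (0 : R))).
    by rewrite -(subrr (v x)); apply: cvgB; [exact: cvg_cst|exact: uv].
  exact: exprn_continuous.
- apply: aeW => x n Ox; rewrite gee0_abs ?lee_fin ?sqr_ge0// /G.
  rewrite -[_ ^+ 2]real_normK ?num_real// lerXn2r ?nnegrE ?mulr_ge0//.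
  by rewrite (le_trans (ler_normB _ _))// mulr2n mulrDl mul1r lerD// ?vg ?ug.
rewrite integral0 => c0.
have {}c0 : (nrm Om (v - u n) ^+ 2)%:E @[n --> \oo] --> 0%:E.
  apply: cvg_trans c0; apply: near_eq_cvg; apply: nearW => n /=.
  by rewrite -L2_sqr_integral//; exact: L2B.
have {}c0 : nrm Om (v - u n) ^+ 2 @[n --> \oo] --> (0 : R) by exact: fine_cvg c0.
have -> : (fun n => nrm Om (v - u n)) = (fun n => Num.sqrt (nrm Om (v - u n) ^+ 2)).
  by apply/funext => n; rewrite sqrtr_sqr ger0_norm// nrm_ge0.
rewrite -[X in _ --> X]sqrtr0.
by apply: (@cvg_comp _ _ _ _ (@Num.sqrt R)) c0 _; exact: sqrt_continuous.
Qed.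

Hypothesis oOm : open Om.
Hypothesis fOm : (mu Om < +oo)%E.

(** The $L^2$ closure of the test functions, named because it is a closed subspace that can be
    enlarged step by step, from boxes to all of $L^2$. *)
Definition approximable (q : E -> R) : Prop :=
  L2 Om q /\ forall e, 0 < e -> exists2 phi, Ccinfty Om phi & nrm Om (q - phi) < e.

Lemma approximable_lim (u : nat -> E -> R) q : L2 Om q ->
  (forall n, approximable (u n)) -> nrm Om (q - u n) @[n --> \oo] --> 0 -> approximable q.
Proof.
move=> Lq Au c; split => // e e0.
have e2 : 0 < e / 2 by rewrite divr_gt0.
have /cvgrPdist_lt/(_ _ e2)[n _ /(_ n (leqnn n))] := c.
rewrite sub0r normrN ger0_norm ?nrm_ge0// => qn.
have [Ln /(_ _ e2)[phi Cphi nphi]] := Au n.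
exists phi => //.
have Lphi := Ccinfty_L2 mOm Cphi.
rewrite -(subrK (u n) q) -addrA (le_lt_trans (nrm_triangle mOm _ _))//; try exact: L2B.
by rewrite (splitr e) ltrD.
Qed.

Lemma approximable_lin a u v : approximable u -> approximable v -> approximable (a *: u + v).
Proof.
move=> [Lu Au] [Lv Av]; split; first by apply: L2D => //; exact: L2Z.
move=> e e0.
have e2 : 0 < e / 2 by rewrite divr_gt0.
have a1 : 0 < `|a| + 1 by rewrite ltr_wpDl.
have [phi Cphi nphi] := Au _ (divr_gt0 e2 a1).
have [psi Cpsi npsi] := Av _ e2.
exists (a *: phi + psi); first exact: Ccinfty_lin.
have Lphi := Ccinfty_L2 mOm Cphi.
have Lpsi := Ccinfty_L2 mOm Cpsi.
have -> : a *: u + v - (a *: phi + psi) = a *: (u - phi) + (v - psi).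
  by rewrite scalerBr opprD addrACA.
have Lup := L2B mOm Lu Lphi.
apply: (le_lt_trans (nrm_triangle mOm (L2Z mOm a Lup) (L2B mOm Lv Lpsi))).
rewrite (splitr e) ler_ltD// nrmZ//.
apply: (@le_trans _ _ ((`|a| + 1) * nrm Om (u - phi))).
  by rewrite ler_wpM2r ?nrm_ge0// lerDl.
by rewrite mulrC -ler_pdivlMr// ltW.
Qed.

Lemma Ccinfty_approximable phi : Ccinfty Om phi -> approximable phi.
Proof.
move=> C; split; first exact: Ccinfty_L2.
by move=> e e0; exists phi => //; rewrite subrr nrm0.
Qed.

Lemma approximable0 : approximable 0.
Proof. by apply: Ccinfty_approximable; exact: Ccinfty0. Qed.

Lemma approximableD u v : approximable u -> approximable v -> approximable (u + v).
Proof. by move=> Au Av; rewrite -[u]scale1r; exact: approximable_lin. Qed.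

Lemma approximableZ a u : approximable u -> approximable (a *: u).
Proof. by move=> Au; rewrite -[_ *: _]addr0; apply: approximable_lin => //; exact: approximable0. Qed.

Lemma approximableB u v : approximable u -> approximable v -> approximable (u - v).
Proof. by move=> Au Av; apply: approximableD => //; rewrite -scaleN1r; exact: approximableZ. Qed.

Lemma approximable_sum (I : Type) (s : seq I) (F : I -> E -> R) :
  (forall i, approximable (F i)) -> approximable (\sum_(i <- s) F i).
Proof.
move=> AF; elim: s => [|i s IH]; first by rewrite big_nil; exact: approximable0.
by rewrite big_cons; exact: approximableD.
Qed.

Lemma L2_indic (A : set E) : measurable A -> L2 Om (\1_A : E -> R).
Proof.
move=> mA; split; first exact: measurable_indic.
apply: (@le_integrable _ _ _ _ _ mOm _ (cst 1%:E)).
- by apply/measurable_EFinP; apply: measurable_funX; exact: measurable_indic.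
- move=> x _; rewrite !abse_EFin lee_fin normrX normr1 indicE.
  by case: (_ \in _); rewrite ?normr1 ?normr0 ?expr1n ?expr0n.
- apply/integrableP; split; first exact: measurable_cst.
  by rewrite (eq_integral (cst 1%E)) ?integral_cst ?mul1e// => x _ /=; rewrite normr1.
Qed.

Let obox (a b : E) : set E := box (fun i => `]a ord0 i, b ord0 i[%classic).
Let cbox (a b : E) : set E := box (fun i => `[a ord0 i, b ord0 i]%classic).

Lemma measurable_obox a b : measurable (obox a b).
Proof. by apply: measurable_box => i; exact: measurable_itv. Qed.

Lemma approximable_obox a b : cbox a b `<=` Om -> approximable \1_(obox a b).
Proof.
move=> abO.
have Cn n : Ccinfty Om (bumpd a b n.+1%:R) by exact: bumpd_Ccinfty.
have [||||L c] := @L2_dominated (fun n => bumpd a b n.+1%:R) \1_(obox a b) \1_(obox a b).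
- by move=> n; case: (Ccinfty_L2 mOm (Cn n)).
- exact: L2_indic (measurable_obox a b).
- by move=> n x _; apply: le_trans (bumpd_le _ _ _ _) (ler_norm _); exact: ler0n.
- by move=> x _; exact: bumpd_cvg.
by apply: (approximable_lim L _ c) => n; exact: Ccinfty_approximable.
Qed.

Definition oboxes : set (set E) := [set B | exists a b, B = obox a b].

Lemma setI_oboxes a b a' b' : obox a b `&` obox a' b' =
  obox (\row_i Num.max (a ord0 i) (a' ord0 i)) (\row_i Num.min (b ord0 i) (b' ord0 i)).
Proof.
apply/seteqP; split => x /=.
  move=> [H H'] i; have := H i; have := H' i.
  by rewrite /= !in_itv/= !mxE gt_max lt_min => /andP[-> ->] /andP[-> ->].
move=> H; split => i; have := H i; rewrite /= !in_itv/= !mxE gt_max lt_min.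
  by move=> /andP[/andP[-> _] /andP[-> _]].
by move=> /andP[/andP[_ ->] /andP[_ ->]].
Qed.

Lemma measurable_oboxes : measurable = <<s oboxes >> :> set (set E).
Proof.
apply/seteqP; split; last first.
  apply: smallest_sub; first exact: sigma_algebra_measurable.
  by move=> _ [a [b ->]]; exact: measurable_obox.
apply: smallest_sub; first exact: smallest_sigma_algebra.
rewrite -bigcup_seq; apply: bigcup_sub => i _ B [C mC <-].
rewrite setTI.
have mi : measurable_fun setT ((fun x : E => x ord0 i) : g_sigma_algebraType oboxes -> R).
  apply: (measurability _ (RGenOInfty.measurableE R)).
  move=> _ [_ [a ->] <-]; rewrite setTI.
  have oa : open ((fun x : E => x ord0 i) @^-1` `]a, +oo[%classic).
    have /continuousP : continuous (fun x : E => x ord0 i) by exact: coord_continuous.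
    by apply; exact: rray_open.
  have [D [b [c [_ ->]]]] := open_bigcup_box oa.
  apply: bigcup_measurable => n _; apply: sub_sigma_algebra.
  by exists (b n), (c n).
by have := mi measurableT C mC; rewrite setTI.
Qed.

(** Dynkin's theorem on the pi-system of open boxes. Intersecting with one fixed box whose closure
    lies in [Om] provides the unit of the Dynkin class and a common majorant for its countable
    unions. *)
Lemma approximable_indic_obox a b A : cbox a b `<=` Om -> measurable A ->
  approximable \1_(A `&` obox a b).
Proof.
move=> abO mA; rewrite measurable_oboxes in mA.
move: A mA; apply: (dynkin_induction (P := fun A => approximable \1_(A `&` obox a b)) measurable_oboxes).
- move=> _ _ [a1 [b1 ->]] [a2 [b2 ->]]; rewrite setI_oboxes; by eexists; eexists.
- by rewrite setTI; exact: approximable_obox.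
- move=> _ [a1 [b1 ->]]; rewrite setI_oboxes; apply: approximable_obox.
  apply: subset_trans abO => x H i; have := H i.
  rewrite /= !in_itv/= !mxE ge_max le_min => /andP[/andP[_ ->] /andP[_ ->]] //.
- move=> S mS AS.
  have -> : \1_(~` S `&` obox a b) = \1_(obox a b) - \1_(S `&` obox a b) :> (E -> R).
    apply/funext => x; rewrite !fctE !indicE !in_setI in_setC.
    by case: (x \in S); case: (x \in _) => /=; rewrite ?subrr ?subr0.
  by apply: approximableB => //; exact: approximable_obox.
move=> F mF tF AF.
have mFb n : measurable (F n `&` obox a b) by apply: measurableI => //; exact: measurable_obox.
(* Disjointness turns the sum of indicators into the indicator of the finite union, so that the
   indicator of the box dominates every [S n]. *)
pose S n : E -> R := \sum_(k < n) \1_(F k `&` obox a b).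
have SE n x : S n x = \1_(\big[setU/set0]_(k < n) F k `&` obox a b) x.
  rewrite /S fct_sumE; elim: n => [|n IH].
    by rewrite !big_ord0 set0I indicE in_set0.
  rewrite !big_ord_recr /= IH setIUl !indicE !in_setI in_setU !in_setI.
  have [xb|xb] := boolP (x \in obox a b); rewrite ?andbF ?andbT//= ?addr0//.
  have [xn|xn] := boolP (x \in F n); rewrite ?orbT ?orbF ?addr0//.
  rewrite memNset ?add0r// => xB.
  move: xB; rewrite -bigcup_mkord => -[k /= kn xk].
  have := tF k n I I; rewrite inE in xn => /(_ (ex_intro _ x (conj xk xn))) kE.
  by rewrite kE ltnn in kn.
have SA n : approximable (S n).
  by rewrite /S -(big_mkord xpredT (fun k => \1_(F k `&` obox a b) : E -> R)); exact: approximable_sum.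
have [||||L c] := @L2_dominated S \1_(\bigcup_k F k `&` obox a b) \1_(obox a b).
- by move=> n; case: (SA n) => -[].
- by apply: L2_indic; exact: measurable_obox.
- move=> n x _; rewrite SE !indicE in_setI; case: (x \in obox a b); rewrite ?andbF ?normr0//.
  by rewrite andbT normr1; case: (_ \in _); rewrite ?normr1 ?normr0.
- move=> x _; have [[[k _ xk] xb]|nx] := pselect ((\bigcup_k F k `&` obox a b) x).
    apply: cvg_near_cst; exists k.+1 => // n /= kn.
    rewrite SE !indicE !mem_set//; first by split => //; exists k.
    by split => //; rewrite -bigcup_mkord; exists k.
  rewrite indicE memNset//; apply: cvg_near_cst; apply: nearW => n.
  rewrite SE indicE memNset// => -[+ xb]; rewrite -bigcup_mkord => -[k _ xk].
  by apply: nx; split => //; exists k.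
exact: approximable_lim L SA c.
Qed.

(** [Om] is a countable union of admissible boxes; the indicators of [A] cut to finite unions of
    them converge to that of [A] on [Om]. *)
Lemma approximable_indic A : measurable A -> approximable \1_A.
Proof.
move=> mA; have [D [a [b [abO OmE]]]] := open_bigcup_box oOm.
pose B n := if `[< D n >] then obox (a n) (b n) else set0.
have OmB : Om = \bigcup_n B n.
  rewrite OmE; apply/seteqP; split => x [n Dn xn]; exists n => //.
    by rewrite /B; case: asboolP.
  by move: xn; rewrite /B; case: asboolP.
  by move: xn; rewrite /B; case: asboolP.
have mB n : measurable (B n) by rewrite /B; case: asboolP => // _; exact: measurable_obox.
have AB n C : measurable C -> approximable \1_(C `&` B n).
  move=> mC; rewrite /B; case: asboolP => [Dn|_].
    by apply: approximable_indic_obox => //; exact: abO.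
  by rewrite setI0 indic0; exact: approximable0.
pose U n := \big[setU/set0]_(k < n) B k.
have mU n : measurable (U n) by apply: bigsetU_measurable.
(* [C] stays general, since the induction step applies the one-box case to [C] minus [U n]. *)
have AU n C : measurable C -> approximable \1_(C `&` U n).
  elim: n C => [|n IH] C mC.
    by rewrite /U big_ord0 setI0 indic0; exact: approximable0.
  have -> : \1_(C `&` U n.+1) = \1_(C `&` U n) + \1_((C `\` U n) `&` B n) :> (E -> R).
    have UE : U n.+1 = U n `|` B n by rewrite /U big_ord_recr.
    apply/funext => x; rewrite [RHS](_ : _ = \1_(C `&` U n) x + \1_((C `\` U n) `&` B n) x)//.
    rewrite UE !indicE setDE !in_setI in_setU in_setC.
    by case: (x \in C); case: (x \in U n); case: (x \in B n); rewrite /= ?addr0 ?add0r.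
  by apply: approximableD; [exact: IH|apply: AB; exact: measurableD].
have [||||L c] := @L2_dominated (fun n => \1_(A `&` U n)) \1_A \1_A.
- by move=> n; case: (AU n A mA) => -[].
- exact: L2_indic.
- move=> n x _; rewrite !indicE in_setI; case: (x \in A) => //=; rewrite ?normr0//.
  by rewrite normr1; case: (_ \in _); rewrite ?normr1 ?normr0.
- move=> x; rewrite OmB => -[k _ xk]; apply: cvg_near_cst; exists k.+1 => // n /= kn.
  rewrite !indicE in_setI [x \in U n]mem_set ?andbT//.
  by rewrite /U -bigcup_mkord; exists k.
apply: approximable_lim L _ c => n; exact: AU.
Qed.

Lemma approximable_ge0 q : L2 Om q -> (forall x, 0 <= q x) -> approximable q.
Proof.
move=> Lq q0.
have mq : measurable_fun Om (EFin \o q) by apply/measurable_EFinP; case: Lq.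
pose g n := nnsfun_approx mOm mq n.
have h0 y : Om y -> (0 <= (EFin \o q) y)%E by rewrite /= lee_fin.
have cg x : Om x -> g n x @[n --> \oo] --> q x.
  move=> Ox; exact: fine_cvg (@cvg_nnsfun_approx _ _ _ _ mOm _ mq h0 x Ox).
have gq n x : Om x -> `|g n x| <= `|q x|.
  move=> Ox; rewrite (ger0_norm (q0 x)) ger0_norm ?fun_ge0//.
  have nd : {homo (fun n => g n x) : n m / (n <= m)%N >-> n <= m}.
    by move=> k m km; have /lefP := nd_nnsfun_approx mOm mq km; exact.
  rewrite -(cvg_lim _ (cg x Ox))//.
  by apply: (nondecreasing_cvgn_le nd); apply/cvg_ex; exists (q x); exact: cg.
have [L c] := @L2_dominated (fun n => g n) q q
  (fun n => measurable_funTS (measurable_funPT (g n))) Lq gq cg.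
apply: (approximable_lim L _ c) => n.
have -> : (g n : E -> R) = \sum_(y <- finmap.enum_fset (fset_set (range (g n))))
    y *: \1_(g n @^-1` [set y]).
  apply/funext => x; rewrite fct_sumE fimfunE fsbig_finite//.
apply: approximable_sum => y; apply: approximableZ; exact: approximable_indic.
Qed.

(** Nonnegative functions are increasing limits of simple functions, and q = (|q| + q) - |q| is a
    difference of two of them. *)
Lemma Ccinfty_dense q e : L2 Om q -> 0 < e ->
  exists2 phi, Ccinfty Om phi & nrm Om (q - phi) < e.
Proof.
move=> Lq; suff [_] : approximable q by exact.
have L1 : L2 Om (fun x => `|q x| + q x) by apply: L2D => //; exact: L2_norm.
have L0 := L2_norm mOm Lq.
have -> : q = (fun x => `|q x| + q x) - (fun x => `|q x|).
  by apply/funext => x; rewrite !fctE addrAC subrr add0r.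
apply: approximableB; apply: approximable_ge0 => // x.
by have := ler_norm (- q x); rewrite normrN; lra.
Qed.

End density.

Lemma integral_partial_rV (R : realType) d (i : 'I_d) (F : 'rV[R]_d -> R) :
  continuous F -> csupp F -> (forall x, derivable F x (unitv R i)) ->
  continuous ('D_(unitv R i) F) ->
  (\int[leb R d]_x ('D_(unitv R i) F x)%:E)%E = 0%E.
Proof. by case: d i F => [[]//|n] i F; exact: integral_partial_eq0. Qed.

Section cvg_aux.
Context (R : realType).

Lemma cvg0_le (u v : nat -> R) : (forall n, 0 <= u n <= v n) ->
  v n @[n --> \oo] --> 0 -> u n @[n --> \oo] --> (0 : R).
Proof.
move=> uv cv; apply: (@squeeze_cvgr _ _ _ _ (cst 0) v) => //; last exact: cvg_cst.
exact: nearW.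
Qed.

End cvg_aux.

(** * Weak derivatives and the Poincare inequality *)

Section weak_derivatives.
Context (R : realType) (d : nat) (Om : set 'rV[R]_d).
Local Notation E := 'rV[R]_d.
Local Notation mu := (leb R d).
Hypothesis oOm : open Om.
Hypothesis bOm : bounded_set Om.

Let mOm : measurable Om. Proof. exact: open_measurable_rV. Qed.

Lemma bounded_sub_cube : exists2 M, 0 < M & forall x : E, Om x -> forall i, `|x ord0 i| <= M.
Proof.
have [M [_ HM]] := bOm; exists (`|M| + 1); first by rewrite ltr_wpDl.
move=> x Ox i; apply: (le_trans (norm_coord_le _ _)).
by apply: HM => //; rewrite (le_lt_trans (ler_norm _))// ltrDl.
Qed.

Lemma bounded_leb_lty : (mu Om < +oo)%E.
Proof.
have [M M0 HM] := bounded_sub_cube.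
apply: (@le_lt_trans _ _ (mu (cube M))); last exact: leb_cube_lty.
apply: le_measure; rewrite ?inE; [exact: mOm|exact: measurable_cube|].
by move=> x Ox i; rewrite /= in_itv/= -ler_norml HM.
Qed.

Let fOm := bounded_leb_lty.

(** Fundamental lemma of the calculus of variations: (g, g) = (g, g - phi) for every test function
    phi, and density makes g - phi small. *)
Lemma ip_Ccinfty_eq0 g : L2 Om g -> (forall phi, Ccinfty Om phi -> ip Om g phi = 0) ->
  nrm Om g = 0.
Proof.
move=> Lg g0; apply/eqP; rewrite eq_le nrm_ge0 andbT; apply/ler_addgt0Pr => e e0.
rewrite add0r; have [phi C h] := Ccinfty_dense mOm oOm fOm Lg e0.
have Lp := Ccinfty_L2 mOm C.
have : nrm Om g ^+ 2 <= nrm Om g * nrm Om (g - phi).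
  rewrite nrm_sqr -[X in X <= _](_ : ip Om g (g - phi) = _).
    by apply: (le_trans (ler_norm _)); apply: ip_CS => //; exact: L2B.
  by rewrite ipBr// (g0 _ C) subr0.
have := nrm_ge0 Om g; rewrite le_eqVlt => /predU1P[<- _|gp]; first exact: ltW.
by rewrite expr2 ler_pM2l// => /le_lt_trans/(_ h)/ltW.
Qed.

(** It makes the choice inside [wpd] harmless, since any two candidates have the same inner
    products. *)
Lemma is_wpd_unique i u g h : L2 Om g -> L2 Om h -> is_wpd Om i u g ->
  is_wpd Om i u h -> nrm Om (g - h) = 0.
Proof.
move=> Lg Lh ug uh; apply: ip_Ccinfty_eq0; first exact: L2B.
move=> phi C; rewrite ipBl//; last exact: Ccinfty_L2.
apply/eqP; rewrite subr_eq0 -eqr_opp; apply/eqP.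
by rewrite -ug// -uh.
Qed.

Lemma is_wdiv_unique u g h : L2 Om g -> L2 Om h -> is_wdiv Om u g ->
  is_wdiv Om u h -> nrm Om (g - h) = 0.
Proof.
move=> Lg Lh ug uh; apply: ip_Ccinfty_eq0; first exact: L2B.
move=> phi C; rewrite ipBl//; last exact: Ccinfty_L2.
apply/eqP; rewrite subr_eq0 -eqr_opp; apply/eqP.
by rewrite -ug// -uh.
Qed.

Lemma H1_wpd i u : H1 Om u -> L2 Om (wpd Om i u) /\ is_wpd Om i u (wpd Om i u).
Proof.
move=> [_ /(_ i)[g Hg]]; exact: (xgetPex (fun=> 0) (P := [set g | L2 Om g /\ is_wpd Om i u g]) (ex_intro _ g Hg)).
Qed.

Lemma Hdiv_wdiv u : Hdiv Om u -> L2 Om (wdiv Om u) /\ is_wdiv Om u (wdiv Om u).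
Proof.
move=> [_ [g Hg]]; exact: (xgetPex (fun=> 0) (P := [set g | L2 Om g /\ is_wdiv Om u g]) (ex_intro _ g Hg)).
Qed.

Lemma is_wpd_lin i a u v g h : L2 Om u -> L2 Om v -> L2 Om g -> L2 Om h ->
  is_wpd Om i u g -> is_wpd Om i v h -> is_wpd Om i (a *: u + v) (a *: g + h).
Proof.
move=> Lu Lv Lg Lh ug vh phi C.
have Lp := Ccinfty_L2 mOm C.
have Lp' := Ccinfty_L2 mOm (Ccinfty_pderiv [:: i] C).
rewrite ipDl//; last exact: L2Z.
rewrite ipZl// ug// vh// ipDl//; last exact: L2Z.
by rewrite ipZl//; ring.
Qed.

Lemma H1_lin a u v : H1 Om u -> H1 Om v -> H1 Om (a *: u + v).
Proof.
move=> Hu Hv; have Lu := Hu.1; have Lv := Hv.1.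
split; first by apply: L2D => //; exact: L2Z.
move=> i; have [Lg ug] := H1_wpd i Hu; have [Lh vh] := H1_wpd i Hv.
exists (a *: wpd Om i u + wpd Om i v); split; last exact: is_wpd_lin.
by apply: L2D => //; exact: L2Z.
Qed.

Lemma H1B u v : H1 Om u -> H1 Om v -> H1 Om (u - v).
Proof. by move=> Hu Hv; rewrite addrC -scaleN1r; exact: H1_lin. Qed.

Lemma ip_eq_nrmB0 u v w : L2 Om u -> L2 Om v -> L2 Om w -> nrm Om (u - v) = 0 ->
  ip Om u w = ip Om v w.
Proof.
move=> Lu Lv Lw uv; apply/eqP; rewrite -subr_eq0 -ipBl// -normr_le0.
by rewrite (le_trans (ip_CS mOm (L2B mOm Lu Lv) Lw))// uv mul0r.
Qed.

Lemma nrm_eq_nrmB0 u v : L2 Om u -> L2 Om v -> nrm Om (u - v) = 0 ->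
  nrm Om u = nrm Om v.
Proof.
move=> Lu Lv uv; apply/eqP; rewrite -subr_eq0 -normr_le0.
by rewrite -uv; exact: nrm_ler_dist.
Qed.

Lemma wpdB i u v : H1 Om u -> H1 Om v ->
  nrm Om (wpd Om i (u - v) - (wpd Om i u - wpd Om i v)) = 0.
Proof.
move=> Hu Hv; have [Lg ug] := H1_wpd i Hu; have [Lh vh] := H1_wpd i Hv.
have [Lk wk] := H1_wpd i (H1B Hu Hv).
apply: (@is_wpd_unique i (u - v)) => //; first exact: L2B.
rewrite (_ : wpd Om i u - _ = (-1) *: wpd Om i v + wpd Om i u); last by rewrite scaleN1r addrC.
rewrite (_ : u - v = (-1) *: v + u); last by rewrite scaleN1r addrC.
by apply: is_wpd_lin => //; [exact: Hv.1|exact: Hu.1].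
Qed.

Lemma Rintegral_setT_support (F : E -> R) : (forall x, ~ Om x -> F x = 0) ->
  \int[mu]_(x in Om) F x = \int[mu]_x F x.
Proof.
move=> F0; rewrite Rintegral_mkcond; congr (fine _); apply: eq_integral => x _.
by rewrite patchE; case: ifPn => //; rewrite notin_setE => /F0 ->.
Qed.

Lemma pderiv1 i (phi : E -> R) : pderiv [:: i] phi = 'D_(unitv R i) phi.
Proof. by []. Qed.

(** The product with a test function [psi] is compactly supported in [Om], so the integral of its
    derivative vanishes; the product rule does the rest. *)
Lemma Ccinfty_is_wpd i phi : smooth phi -> is_wpd Om i phi ('D_(unitv R i) phi).
Proof.
move=> sphi psi Cpsi.
have spsi := Ccinfty_smooth Cpsi.
have sps := smoothM sphi spsi.
have Cp : Ccinfty Om (phi * psi).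
  split => //; have [_ [K [cK KO HK]]] := Cpsi.
  by exists K; split => // x nK; rewrite !fctE HK// mulr0.
have DE x : 'D_(unitv R i) (phi * psi) x =
    phi x * 'D_(unitv R i) psi x + 'D_(unitv R i) phi x * psi x.
  have dphi := @smooth_derivable _ _ phi i x sphi.
  have dpsi := @smooth_derivable _ _ psi i x spsi.
  by case: (is_derive_mulf dphi dpsi).
have cl f g : smooth f -> Ccinfty Om g -> L2 Om g /\ mu.-integrable Om (EFin \o (fun x => f x * g x)).
  move=> sf Cg; split; first exact: Ccinfty_L2.
  apply: (@integrableS _ _ _ _ setT) => //; apply: (@csupp_integrable _ _ (f * g)).
    apply: continuous_mulf; [exact: smooth_continuous|].
    exact/smooth_continuous/(Ccinfty_smooth Cg).
  have [_ [K [cK KO HK]]] := Cg.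
  by exists K => // x nK; rewrite !fctE HK// mulr0.
have H0 : \int[mu]_(x in Om) 'D_(unitv R i) (phi * psi) x = 0.
  rewrite Rintegral_setT_support; last first.
    by move=> x nO; apply: (Ccinfty_out (Ccinfty_pderiv [:: i] Cp)).
  rewrite /Rintegral integral_partial_rV//.
  - exact: smooth_continuous.
  - exact: Ccinfty_csupp Cp.
  - by move=> x; exact: smooth_derivable.
  - exact: (smooth_continuous (smooth_pderiv [:: i] sps)).
apply/eqP; rewrite -addr_eq0 /ip -RintegralD//; last 2 first.
- by have [] := cl _ _ sphi (Ccinfty_pderiv [:: i] Cpsi).
- by have [] := cl _ _ (smooth_pderiv [:: i] sphi) Cpsi.
by rewrite -[X in _ == X]H0; apply/eqP; congr (fine _); apply: eq_integral => x _; rewrite DE.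
Qed.

Lemma Ccinfty_H1 phi : Ccinfty Om phi -> H1 Om phi.
Proof.
move=> C; split; first exact: Ccinfty_L2.
move=> i; exists ('D_(unitv R i) phi); split; first exact: (Ccinfty_L2 mOm (Ccinfty_pderiv [:: i] C)).
exact/Ccinfty_is_wpd/(Ccinfty_smooth C).
Qed.

Lemma wpd_Ccinfty i phi : Ccinfty Om phi ->
  nrm Om (wpd Om i phi - 'D_(unitv R i) phi) = 0.
Proof.
move=> C; have [Lw ww] := H1_wpd i (Ccinfty_H1 C).
apply: (is_wpd_unique Lw _ ww); first exact: (Ccinfty_L2 mOm (Ccinfty_pderiv [:: i] C)).
exact/Ccinfty_is_wpd/(Ccinfty_smooth C).
Qed.

Lemma H1nrm_sqr u : H1nrm Om u ^+ 2 = nrm Om u ^+ 2 + \sum_i nrm Om (wpd Om i u) ^+ 2.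
Proof. by rewrite sqr_sqrtr// addr_ge0 ?sumr_ge0 ?sqr_ge0// => i _; exact: sqr_ge0. Qed.

Lemma H1nrm_ge0 u : 0 <= H1nrm Om u. Proof. exact: sqrtr_ge0. Qed.

Lemma nrm_le_H1nrm u : nrm Om u <= H1nrm Om u.
Proof.
rewrite -(@ler_pXn2r _ 2) ?nnegrE ?nrm_ge0 ?H1nrm_ge0// H1nrm_sqr lerDl.
by apply: sumr_ge0 => i _; exact: sqr_ge0.
Qed.

Lemma nrm_wpd_le_H1nrm i u : nrm Om (wpd Om i u) <= H1nrm Om u.
Proof.
rewrite -(@ler_pXn2r _ 2) ?nnegrE ?nrm_ge0 ?H1nrm_ge0// H1nrm_sqr (bigD1 i)//=.
rewrite addrCA lerDl addr_ge0 ?sqr_ge0//.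
by apply: sumr_ge0 => j _; exact: sqr_ge0.
Qed.

(** [H10] measures the error by the weak derivatives of u - phi_n; here they are traded for the
    classical derivatives of phi_n, to which the calculus of smooth functions applies. *)
Lemma H10_approx u : H10 Om u -> exists phi : nat -> E -> R,
  [/\ forall n, Ccinfty Om (phi n), H1nrm Om (u - phi n) @[n --> \oo] --> 0,
      nrm Om (u - phi n) @[n --> \oo] --> 0 &
      forall i, nrm Om (wpd Om i u - 'D_(unitv R i) (phi n)) @[n --> \oo] --> 0].
Proof.
move=> [Hu [phi [C c]]]; exists phi; split => //.
  by apply: cvg0_le c => n; rewrite nrm_ge0 nrm_le_H1nrm.
move=> i; apply: cvg0_le c => n; rewrite nrm_ge0/=.
have Hp := Ccinfty_H1 (C n).
have [Lu _] := H1_wpd i Hu; have [Lp _] := H1_wpd i Hp.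
have [Lup _] := H1_wpd i (H1B Hu Hp).
have LD : L2 Om ('D_(unitv R i) (phi n)) := Ccinfty_L2 mOm (Ccinfty_pderiv [:: i] (C n)).
have -> : nrm Om (wpd Om i u - 'D_(unitv R i) (phi n)) = nrm Om (wpd Om i (u - phi n)).
  apply/esym/nrm_eq_nrmB0 => //; first exact: L2B.
  apply/eqP; rewrite eq_le nrm_ge0 andbT.
  rewrite (_ : _ - _ = (wpd Om i (u - phi n) - (wpd Om i u - wpd Om i (phi n)))
     - (wpd Om i (phi n) - 'D_(unitv R i) (phi n))); last first.
    by apply/funext => y; rewrite !fctE; ring.
  have L1 := L2B mOm Lup (L2B mOm Lu Lp); have L2' := L2B mOm Lp LD.
  apply: (le_trans (nrm_triangle mOm L1 (L2N mOm L2'))).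
  by rewrite nrmN// wpdB// wpd_Ccinfty// addr0.
exact: nrm_wpd_le_H1nrm.
Qed.

(** The trace of the weak gradient is a weak divergence, and weak divergences are unique up to norm
    zero. *)
Lemma X_wdiv v : X Om v -> [/\ Hdiv Om v, L2 Om (wdiv Om v) &
  nrm Om (wdiv Om v - \sum_i wpd Om i (v i)) = 0].
Proof.
move=> Xv.
have Hv i : H1 Om (v i) := (Xv i).1.
have LS : L2 Om (\sum_i wpd Om i (v i)).
  by apply: L2_sum => // i _; case: (H1_wpd i (Hv i)).
have wS : is_wdiv Om v (\sum_i wpd Om i (v i)).
  move=> phi C; rewrite ip_suml//; last exact: Ccinfty_L2.
    by rewrite -sumrN; apply: eq_bigr => i _; case: (H1_wpd i (Hv i)) => _; exact.
  by move=> i; case: (H1_wpd i (Hv i)).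
have HD : Hdiv Om v.
  split; first by move=> i; exact: (Hv i).1.
  by exists (\sum_i wpd Om i (v i)).
have [Lw ww] := Hdiv_wdiv HD; split => //.
exact: is_wdiv_unique ww wS.
Qed.

Lemma L2_cst1 : L2 Om (cst 1 : E -> R).
Proof.
have L : L2 Om (\1_setT : E -> R) by exact: L2_indic.
apply: (L2_eq mOm _ L).
by move=> x _; rewrite indicE in_setT.
Qed.

Lemma Rintegral_ip1 u : \int[mu]_(x in Om) u x = ip Om u (cst 1).
Proof. by congr (fine _); apply: eq_integral => x _; rewrite mulr1. Qed.

(** Derivatives of test functions integrate to zero, and the constant 1 lies in $L^2$ of the bounded
    set [Om], so the identity passes to the limit. *)
Lemma H10_wpd_mean u i : H10 Om u -> ip Om (wpd Om i u) (cst 1) = 0.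
Proof.
move=> Hu; have [phi [C _ _ /(_ i) c]] := H10_approx Hu.
have LD n : L2 Om ('D_(unitv R i) (phi n)) := Ccinfty_L2 mOm (Ccinfty_pderiv [:: i] (C n)).
have [Lw _] := H1_wpd i Hu.1.
have z n : ip Om ('D_(unitv R i) (phi n)) (cst 1) = 0.
  rewrite -Rintegral_ip1 Rintegral_setT_support; last first.
    by move=> x nO; apply: (Ccinfty_out (Ccinfty_pderiv [:: i] (C n))).
  have sp := Ccinfty_smooth (C n).
  rewrite /Rintegral integral_partial_rV//.
  - exact: smooth_continuous.
  - exact: Ccinfty_csupp (C n).
  - by move=> x; exact: smooth_derivable.
  - exact: (smooth_continuous (smooth_pderiv [:: i] sp)).
have key n : `|ip Om (wpd Om i u) (cst 1)| <=
   nrm Om (wpd Om i u - 'D_(unitv R i) (phi n)) * nrm Om (cst 1).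
  rewrite -[X in `|X|]subr0 -(z n) -ipBl//; last exact: L2_cst1.
  by apply: ip_CS => //; [exact: L2B|exact: L2_cst1].
have ck : nrm Om (wpd Om i u - 'D_(unitv R i) (phi n)) * nrm Om (cst 1) @[n --> \oo] --> 0.
  by rewrite -(mul0r (nrm Om (cst 1))); apply: cvgMl.
have : cst `|ip Om (wpd Om i u) (cst 1)| n @[n --> \oo] --> (0 : R).
  by apply: cvg0_le ck => n; rewrite normr_ge0 key.
move=> /cvg_lim; rewrite lim_cst => // /(_ (@Rhausdorff R))/normr0P/eqP; exact.
Qed.

Lemma is_derive_coord i (x : E) : is_derive x (unitv R i) (fun y : E => y ord0 i) 1.
Proof.
have E1 : (fun h : R => h^-1 *: (((fun y : E => y ord0 i) \o shift x) (h *: unitv R i) - x ord0 i))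
    @ 0^' --> (1 : R).
  apply: cvg_near_cst; near=> h.
  rewrite /= !mxE !eqxx mulr1 addrK /GRing.scale /= mulVf//.
  by near: h; exact: nbhs_dnbhs_neq.
by apply: DeriveDef; [apply/cvg_ex; exists 1|exact/cvg_lim].
Unshelve. all: by end_near. Qed.

(** Integrating D_i(x_i phi^2) = phi^2 + 2 x_i phi D_i phi over [Om], where |x_i| <= M, gives
    |phi|^2 <= 2 M |phi| |D_i phi|. *)
Lemma Ccinfty_poincare : exists2 C, 0 <= C & forall i phi, Ccinfty Om phi ->
  nrm Om phi <= C * nrm Om ('D_(unitv R i) phi).
Proof.
have [M M0 HM] := bounded_sub_cube.
exists (2 * M); first by rewrite mulr_ge0// ltW.
move=> i phi C.
have sp := Ccinfty_smooth C.
have Lp := Ccinfty_L2 mOm C.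
have LD : L2 Om ('D_(unitv R i) phi) := Ccinfty_L2 mOm (Ccinfty_pderiv [:: i] C).
pose xi : E -> R := fun y => y ord0 i.
have cxi : continuous xi by exact: coord_continuous.
have cp := smooth_continuous sp.
have cD : continuous ('D_(unitv R i) phi) by exact: (smooth_continuous (smooth_pderiv [:: i] sp)).
pose F : E -> R := xi * (phi * phi).
have DF x : is_derive x (unitv R i) F (phi x * phi x + 2 * (xi x * phi x * 'D_(unitv R i) phi x)).
  have dp := @smooth_derivable _ _ phi i x sp.
  have dpp := is_derive_mulf dp dp.
  have [dxi Dxi] := is_derive_coord i x.
  have [d2 D2] := dpp.
  have [dF Fe] := is_derive_mulf dxi d2.
  apply: DeriveDef; first exact: dF.
  by rewrite Fe Dxi D2 /=; rewrite !fctE /xi; ring.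
have DFE : 'D_(unitv R i) F = phi * phi + cst 2 * (xi * phi * 'D_(unitv R i) phi).
  by apply/funext => x; case: (DF x) => _ ->.
have sF : csupp F.
  have [K cK HK] := Ccinfty_csupp C; exists K => // x nK; by rewrite /F !fctE HK// mul0r mulr0.
have L1 : L2 Om (xi * phi).
  apply: csupp_L2 => //; first exact: continuous_mulf.
  have [K cK HK] := Ccinfty_csupp C; exists K => // x nK; by rewrite !fctE HK// mulr0.
have cF : continuous F by apply: continuous_mulf => //; exact: continuous_mulf.
have dF x : derivable F x (unitv R i) by case: (DF x).
have cDF : continuous ('D_(unitv R i) F).
  rewrite DFE; apply: continuous_addf; first exact: continuous_mulf.
  apply: continuous_mulf; first exact: cst_continuous.
  by apply: continuous_mulf => //; exact: continuous_mulf.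
have H0 : \int[mu]_(x in Om) 'D_(unitv R i) F x = 0.
  rewrite Rintegral_setT_support; last first.
    by move=> x nO; have [_ ->] := DF x; rewrite (Ccinfty_out C nO); ring.
  by rewrite /Rintegral (integral_partial_rV cF sF dF cDF).
have : ip Om phi phi + 2 * ip Om (xi * phi) ('D_(unitv R i) phi) = 0.
  rewrite -H0 DFE -ipZl// /ip -RintegralD//; last 2 first.
  - exact: L2_integrable_mul.
  - by apply: L2_integrable_mul => //; exact: L2Z.
  by apply: eq_Rintegral => x _; rewrite !fctE /GRing.scale /=; ring.
move=> /eqP; rewrite addr_eq0 -nrm_sqr => /eqP e.
have b : nrm Om (xi * phi) <= M * nrm Om phi.
  have := nrm_le mOm L1.1 (L2Z mOm M Lp); rewrite nrmZ// gtr0_norm//; apply.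
  by move=> x Ox; rewrite !fctE normrM /GRing.scale /= normrM ler_wpM2r// (le_trans (HM _ Ox i))// ler_norm.
have := ip_CS mOm L1 LD; rewrite ler_norml => /andP[h _].
have h2 : nrm Om phi ^+ 2 <= (2 * M * nrm Om ('D_(unitv R i) phi)) * nrm Om phi.
  rewrite e; have := nrm_ge0 Om ('D_(unitv R i) phi); nra.
have := nrm_ge0 Om phi; rewrite le_eqVlt => /predU1P[<-|pp].
  by rewrite !mulr_ge0 ?nrm_ge0// ltW.
by move: h2; rewrite expr2 ler_pM2r.
Qed.

(** Passage to the limit from test functions. It later shows that [gradnrm] vanishes only on the
    zero class, so that the quotients in [dualnrm] are genuine. *)
Lemma H10_poincare : exists2 C, 0 <= C & forall i u, H10 Om u ->
  nrm Om u <= C * nrm Om (wpd Om i u).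
Proof.
have [C C0 H] := Ccinfty_poincare; exists C => // i u Hu.
have [phi [Cp _ c1 /(_ i) c2]] := H10_approx Hu.
have [Lw _] := H1_wpd i Hu.1.
apply/ler_addgt0Pr => e e0.
have C1 : 0 < C + 1 by rewrite ltr_wpDl.
have e2 : 0 < e / 2 by rewrite divr_gt0.
have e3 : 0 < e / 2 / (C + 1) by rewrite divr_gt0.
have /cvgrPdist_lt/(_ _ e2) n1 := c1.
have /cvgrPdist_lt/(_ _ e3) n2 := c2.
have [n [h1 h2]] : exists n, `|0 - nrm Om (u - phi n)| < e / 2 /\
   `|0 - nrm Om (wpd Om i u - 'D_(unitv R i) (phi n))| < e / 2 / (C + 1).
  have [n _ /(_ n (leqnn n))[]] := filterI n1 n2; by exists n.
rewrite !sub0r !normrN !ger0_norm ?nrm_ge0// in h1 h2.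
have LD : L2 Om ('D_(unitv R i) (phi n)) := Ccinfty_L2 mOm (Ccinfty_pderiv [:: i] (Cp n)).
have Lp := Ccinfty_L2 mOm (Cp n).
have t1 := nrm_ler_dist mOm Hu.1.1 Lp.
have t2 := nrm_ler_dist mOm Lw LD.
have p := H i _ (Cp n).
move: t1 t2; rewrite !ler_norml => /andP[_ t1] /andP[t2 _].
rewrite ltr_pdivlMr// in h2.
have := nrm_ge0 Om (wpd Om i u - 'D_(unitv R i) (phi n)).
nra.
Qed.

End weak_derivatives.

Lemma ladyzhenskaya2_algebra (R : realType) (a b c : R) :
  2 * (a * b) * (2 * (a * c)) = 4 * a ^+ 2 * (b * c).
Proof. ring. Qed.

(** The constant 9 dominates both the 4 of the plane and the 8 of space, and it is a square: taking
    roots gives the common factor 3 in the Sobolev bound. *)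
Lemma ladyzhenskaya2_bound (R : realType) (a b c H : R) : 0 <= a -> a <= H ->
  0 <= b -> b <= H -> 0 <= c -> c <= H -> 4 * a ^+ 2 * (b * c) <= 9 * H ^+ 4.
Proof.
move=> a0 aH b0 bH c0 cH; have H0 := le_trans a0 aH.
apply: (@le_trans _ _ (4 * H ^+ 2 * (H * H))).
  apply: ler_pM => //; first by rewrite mulr_ge0 ?sqr_ge0.
  - by rewrite mulr_ge0.
  - by rewrite ler_pM2l// lerXn2r.
  - exact: ler_pM.
have := exprn_ge0 4 H0; rewrite (_ : 4 * H ^+ 2 * (H * H) = 4 * H ^+ 4); last by ring.
lra.
Qed.

(** From 2 a b <= a^2 + b^2. It turns the product of two slice derivatives into a sum of squares,
    which can be integrated over the slices. *)
Lemma young_bound (R : realType) (a b A S : R) : 0 <= A -> A <= S ->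
  4 * A * (a * b) <= 2 * S * (a ^+ 2 + b ^+ 2).
Proof.
move=> A0 AS; apply: (@le_trans _ _ (2 * A * (a ^+ 2 + b ^+ 2))).
  have := mulr_ge0 A0 (sqr_ge0 (a - b)); nra.
by rewrite ler_wpM2r ?addr_ge0 ?sqr_ge0// ler_pM2l.
Qed.

Lemma ladyzhenskaya3_algebra (R : realType) (a b c e : R) :
  2 * (2 * (a * b)) * (c + e) = 4 * (a * b) * (c + e).
Proof. ring. Qed.

Lemma ladyzhenskaya3_bound (R : realType) (a b c e H : R) : 0 <= a -> a <= H ->
  0 <= b -> b <= H -> 0 <= c -> c <= H -> 0 <= e -> e <= H ->
  4 * (a * b) * (c ^+ 2 + e ^+ 2) <= 9 * H ^+ 4.
Proof.
move=> a0 aH b0 bH c0 cH e0 eH; have H0 := le_trans a0 aH.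
apply: (@le_trans _ _ (4 * (H * H) * (H ^+ 2 + H ^+ 2))).
  apply: ler_pM; try by rewrite ?mulr_ge0 ?addr_ge0 ?sqr_ge0.
    by rewrite ler_pM2l//; exact: ler_pM.
  by rewrite lerD// lerXn2r.
have := exprn_ge0 4 H0; rewrite (_ : 4 * (H * H) * (H ^+ 2 + H ^+ 2) = 8 * H ^+ 4); last by ring.
lra.
Qed.

(** * Ladyzhenskaya's inequality and the trilinear form *)

Section slices.
Context (R : realType) (n : nat) (i : 'I_n.+1).

(** Restriction to a hyperplane orthogonal to direction [i]; the inequality in space is obtained by
    integrating the planar one over such slices. *)
Definition slice (phi : 'rV[R]_n.+1 -> R) (z : R) : 'rV[R]_n -> R :=
  fun y => phi (ins i (z, y)).

Lemma norm_le_norm_ins z (y : 'rV[R]_n) : `|y| <= `|ins i (z, y)|.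
Proof.
apply: norm_rV_le => // j; rewrite -(ins_lift i (z, y) j); exact: norm_coord_le.
Qed.

Lemma continuous_ins_r z : continuous (fun y : 'rV[R]_n => ins i (z, y)).
Proof.
move=> y; apply/(@cvgrPdist_lt _ _ _ (nbhs y)) => e e0; near=> y'.
apply: (@le_lt_trans _ _ `|y - y'|); last first.
  by near: y'; apply: cvgr_dist_lt => //; exact: cvg_id.
apply: norm_rV_le => // k; rewrite !mxE /=.
case: unliftP => [j|] _; last by rewrite subrr normr0.
by have := norm_coord_le (y - y') j; rewrite !mxE.
Unshelve. all: by end_near. Qed.

Lemma ins_add_unitv z h (y : 'rV[R]_n) j :
  ins i (z, h *: unitv R j + y) = h *: unitv R (lift i j) + ins i (z, y).
Proof.
apply/rowP => k; rewrite !mxE /=; case: unliftP => [l|] -> /=.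
  by rewrite !mxE eqxx /= (inj_eq lift_inj).
by rewrite (negbTE (neq_lift _ _)) mulr0 add0r.
Qed.

Lemma is_derive_slice phi z j y : derivable phi (ins i (z, y)) (unitv R (lift i j)) ->
  is_derive y (unitv R j) (slice phi z) (slice ('D_(unitv R (lift i j)) phi) z y).
Proof.
move=> dphi.
have E : (fun h : R => h^-1 *: ((slice phi z \o shift y) (h *: unitv R j) - slice phi z y)) =
   (fun h : R => h^-1 *: ((phi \o shift (ins i (z, y))) (h *: unitv R (lift i j)) - phi (ins i (z, y)))).
  by apply/funext => h; rewrite /slice /= ins_add_unitv.
by apply: DeriveDef; rewrite /derivable /derive E.
Qed.

Lemma smooth_slice phi z : smooth phi -> smooth (slice phi z).
Proof.
move=> sphi.
apply: (@smooth_coind _ _ [set f | exists2 psi, smooth psi & f = slice psi z]); last by exists phi.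
move=> _ [psi spsi ->]; split.
  move=> y; apply: (@continuous_comp _ _ _ (fun y => ins i (z, y)) psi).
    exact: continuous_ins_r.
  exact: smooth_continuous.
move=> j; split.
  by move=> y; case: (is_derive_slice (@smooth_derivable _ _ _ (lift i j) (ins i (z, y)) spsi)).
exists ('D_(unitv R (lift i j)) psi); first exact: (smooth_pderiv [:: lift i j] spsi).
apply/funext => y.
by case: (is_derive_slice (@smooth_derivable _ _ _ (lift i j) (ins i (z, y)) spsi)).
Qed.

Lemma derive_slice phi z j : smooth phi ->
  'D_(unitv R j) (slice phi z) = slice ('D_(unitv R (lift i j)) phi) z.
Proof.
move=> sphi; apply/funext => y.
by case: (is_derive_slice (@smooth_derivable _ _ _ (lift i j) (ins i (z, y)) sphi)).
Qed.

Lemma compact_cube d M : compact (cube M : set 'rV[R]_d).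
Proof. by apply: rV_compact => j; exact: segment_compact. Qed.

Lemma csupp_slice phi z : csupp phi -> csupp (slice phi z).
Proof.
move=> /csupp_bound[M M0 HM]; exists (cube M); first exact: compact_cube.
move=> y ny; apply: HM; apply: lt_le_trans (norm_le_norm_ins z y).
by rewrite ltNge; apply/negP => /(cubeP _ (ltW M0)).
Qed.

Lemma csupp_mulr d (f g : 'rV[R]_d -> R) : csupp f -> csupp (f * g).
Proof. by move=> [K cK HK]; exists K => // x /HK; rewrite !fctE => ->; rewrite mul0r. Qed.

End slices.

Section ladyzhenskaya.
Context (R : realType).
Local Open Scope ereal_scope.

Lemma integral_leb0 (f : 'rV[R]_0 -> \bar R) : measurable_fun setT f ->
  \int[leb R 0]_y f y = f (0%R : 'rV[R]_0).
Proof. by move=> mf; rewrite /= integral_dirac// diracT mul1e. Qed.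

Lemma integral_leb1 (f : 'rV[R]_1 -> \bar R) : measurable_fun setT f ->
  (forall x, 0 <= f x) ->
  \int[leb R 1]_y f y = \int[lebesgue_measure]_t f (const_mx t).
Proof.
move=> mf f0; rewrite (integral_ins ord0)//; apply: eq_integral => t _.
rewrite integral_leb0; last first.
  apply: (measurableT_comp mf); apply: measurable_fun_rVP => k.
  rewrite (_ : (fun x => _) = cst t) //.
  by apply/funext => x; rewrite mxE; case: unliftP => // -[].
congr f; apply/rowP => k; rewrite !mxE.
by case: unliftP => // -[].
Qed.

Lemma abs_sqr_derive d (phi : 'rV[R]_d -> R) i x : smooth phi ->
  'D_(unitv R i) (phi * phi)%R x = (2 * (phi x * 'D_(unitv R i) phi x))%R.
Proof.
move=> sphi; have dp := @smooth_derivable _ _ _ i x sphi.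
by case: (is_derive_mulf dp dp) => _ ->; ring.
Qed.

Let meas_abs d (F : 'rV[R]_d -> R) : continuous F ->
  measurable_fun setT (fun x => (`|F x|)%:E).
Proof.
by move=> cF; apply/measurable_EFinP; apply: measurableT_comp => //; exact: continuous_measurable_rV.
Qed.

(* The product bound [phi^2 <= a(x1)] and [phi^2 <= b(x0)] with [a], [b] line integrals separates the variables. *)
Lemma ladyzhenskaya2 (phi : 'rV[R]_2 -> R) : smooth phi -> csupp phi ->
  \int[leb R 2]_x ((phi x ^+ 2) ^+ 2)%:E <=
  (\int[leb R 2]_x (`|'D_(unitv R ord0) (phi * phi)%R x|)%:E) *
  (\int[leb R 2]_x (`|'D_(unitv R ord_max) (phi * phi)%R x|)%:E).
Proof.
move=> sphi csphi.
pose F : 'rV[R]_2 -> R := (phi * phi)%R.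
have sF : smooth F by exact: smoothM.
have cF : csupp F by exact: csupp_mulr.
have cDF i : continuous ('D_(unitv R i) F) := smooth_continuous (smooth_pderiv [:: i] sF).
pose h i (x : 'rV[R]_2) := (`|'D_(unitv R i) F x|)%:E.
have mh i : measurable_fun setT (h i) by exact: meas_abs (cDF i).
have h0 i x : 0 <= h i x by rewrite lee_fin.
pose a (i : 'I_2) (y : 'rV[R]_1) := \int[lebesgue_measure]_t h i (ins i (t, y)).
have ma i : measurable_fun setT (a i) by exact: measurable_integral_ins (mh i) (h0 i).
have a0 i y : 0 <= a i y by exact: integral_ge0.
have Fa i x : (`|F x|)%:E <= a i (rem i x).
  apply: norm_le_integral_line => //; first exact: smooth_continuous.
  by move=> y; exact: smooth_derivable.
have iA i : \int[leb R 1]_y a i y = \int[leb R 2]_x h i x by rewrite (integral_ins' i).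
clearbody a.
apply: (@le_trans _ _ (\int[leb R 2]_x (a ord0 (rem ord0 x) * a ord_max (rem ord_max x)))).
  apply: ge0_le_integral => //.
  - by move=> x _; rewrite lee_fin sqr_ge0.
  - apply/measurable_EFinP; apply: measurable_funX; apply: measurable_funX.
    exact: continuous_measurable_rV (smooth_continuous sphi).
  - by apply: emeasurable_funM; apply: measurableT_comp => //; exact: measurable_rem.
  - move=> x _; have -> : ((phi x ^+ 2) ^+ 2)%R = (`|F x| * `|F x|)%R.
      by rewrite -expr2 real_normK ?num_real// /F !fctE expr2.
    by rewrite EFinM; apply: lee_pmul => //; rewrite lee_fin.
rewrite (integral_ins' ord0); last 2 first.
- by apply: emeasurable_funM; apply: measurableT_comp => //; exact: measurable_rem.
- by move=> x; exact: mule_ge0.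
(* In dimension two, deleting the last coordinate leaves only coordinate 0, so the integrand is a
   function of [y] times a function of [t]. *)
have E t y : rem ord_max (ins ord0 (t, y)) = const_mx t :> 'rV[R]_1.
  apply/rowP => k; rewrite !mxE.
  have -> : lift ord_max k = ord0 :> 'I_2 by apply/val_inj; case: k => -[].
  by rewrite unlift_none.
have mc : measurable_fun setT (fun t : R => a ord_max (const_mx t)).
  apply: (measurableT_comp (ma ord_max)); apply: measurable_fun_rVP => k.
  rewrite (_ : (fun x => _) = id); first exact: measurable_id.
  by apply/funext => x; rewrite mxE.
have E2 y : \int[lebesgue_measure]_t (a ord0 (rem ord0 (ins ord0 (t, y))) * a ord_max (rem ord_max (ins ord0 (t, y))))
   = a ord0 y * \int[lebesgue_measure]_t a ord_max (const_mx t).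
  by rewrite -ge0_integralZl//; apply: eq_integral => t _; rewrite rem_ins E.
under eq_integral do rewrite E2.
rewrite ge0_integralZr//; last exact: integral_ge0.
by rewrite iA -integral_leb1// iA.
Qed.

(** D_i(phi^2) = 2 phi D_i phi, followed by Cauchy-Schwarz. *)
Lemma integral_abs_sqr_derive_le d (phi : 'rV[R]_d -> R) i : smooth phi -> csupp phi ->
  \int[leb R d]_x (`|'D_(unitv R i) (phi * phi)%R x|)%:E <=
  (2 * (nrm setT phi * nrm setT ('D_(unitv R i) phi)))%:E.
Proof.
move=> sphi cphi.
have sD := smooth_pderiv [:: i] sphi.
have L1 : L2 setT phi by apply: csupp_L2 => //; exact: smooth_continuous.
have L2' : L2 setT ('D_(unitv R i) phi).
  by apply: csupp_L2 => //; [exact: smooth_continuous sD|exact: csupp_derive].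
have mT : measurable [set: 'rV[R]_d] by [].
have La1 := L2_norm mT L1; have La2 := L2_norm mT L2'.
have iP := L2_integrable_mul mT La1 La2.
have -> : \int[leb R d]_x (`|'D_(unitv R i) (phi * phi)%R x|)%:E =
    (2 * ip setT (fun x => `|phi x|%R) (fun x => `|'D_(unitv R i) phi x|%R))%:E.
  rewrite EFinM /ip /Rintegral fineK; last exact: integrable_fin_num.
  rewrite -integralZl//; apply: eq_integral => x _.
  by rewrite abs_sqr_derive// -EFinM !normrM (ger0_norm (ler0n _ 2)).
rewrite lee_fin ler_pM2l// (le_trans (ler_norm _))//.
by rewrite (le_trans (ip_CS mT La1 La2))// !nrm_norm.
Qed.

Lemma ladyzhenskaya2_nrm (phi : 'rV[R]_2 -> R) : smooth phi -> csupp phi ->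
  \int[leb R 2]_x ((phi x ^+ 2) ^+ 2)%:E <=
  (4 * nrm setT phi ^+ 2 * (nrm setT ('D_(unitv R ord0) phi) * nrm setT ('D_(unitv R ord_max) phi)))%:E.
Proof.
move=> sphi cphi; apply: (le_trans (ladyzhenskaya2 sphi cphi)).
apply: (@le_trans _ _ ((2 * (nrm setT phi * nrm setT ('D_(unitv R ord0) phi)))%:E *
   (2 * (nrm setT phi * nrm setT ('D_(unitv R ord_max) phi)))%:E)).
  apply: lee_pmul; try exact: integral_ge0; exact: integral_abs_sqr_derive_le.
by rewrite -EFinM ladyzhenskaya2_algebra.
Qed.

Lemma measurable_integral_ins_l n (i : 'I_n.+1) (f : 'rV[R]_n.+1 -> \bar R) :
  measurable_fun setT f -> (forall x, 0 <= f x) ->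
  measurable_fun setT (fun z : R => \int[leb R n]_y f (ins i (z, y))).
Proof.
move=> mf f0.
have := @measurable_fun_fubini_tonelli_F _ _ _ _ R (leb R n) (fun p => f (ins i p)).
by apply => //; exact: (measurableT_comp mf (measurable_ins i)).
Qed.

Lemma ge0_integralZD (c : \bar R) (f g : R -> \bar R) :
  measurable_fun setT f -> measurable_fun setT g ->
  (forall x, 0 <= f x) -> (forall x, 0 <= g x) -> 0 <= c ->
  \int[lebesgue_measure]_x (c * (f x + g x)) =
  c * (\int[lebesgue_measure]_x f x + \int[lebesgue_measure]_x g x).
Proof.
move=> mf mg f0 g0 c0; rewrite ge0_integralZl//.
- by rewrite ge0_integralD.
- exact: emeasurable_funD.
- by move=> x _; exact: adde_ge0.
Qed.

(** The planar inequality holds on each slice orthogonal to the last direction. Its factor |s_z|^2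
    is at most [S] for all z, the product of the two slice derivatives is replaced by a sum of
    squares, and the result is integrated over z. *)
Lemma ladyzhenskaya3_nrm (phi : 'rV[R]_3 -> R) : smooth phi -> csupp phi ->
  forall D, (forall j, D j = nrm setT ('D_(unitv R j) phi)) ->
  \int[leb R 3]_x ((phi x ^+ 2) ^+ 2)%:E <=
  (4 * (nrm setT phi * D ord_max) *
    (D (lift ord_max ord0) ^+ 2 + D (lift ord_max ord_max) ^+ 2))%:E.
Proof.
move=> sphi cphi D DE.
pose i : 'I_3 := ord_max.
pose s z := slice i phi z.
have ss z : smooth (s z) by exact: smooth_slice.
have cs z : csupp (s z) by exact: csupp_slice.
have cphi' := smooth_continuous sphi.
have mT n : measurable [set: 'rV[R]_n] by [].
have Ls z : L2 setT (s z) by apply: csupp_L2 => //; exact: smooth_continuous.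
have cD j : continuous ('D_(unitv R j) phi) := smooth_continuous (smooth_pderiv [:: j] sphi).
have LD j : L2 setT ('D_(unitv R j) phi) by apply: csupp_L2 => //; exact: csupp_derive.
have LDs j z : L2 setT ('D_(unitv R j) (s z)).
  apply: csupp_L2 => //; last exact: csupp_derive.
  exact: (smooth_continuous (smooth_pderiv [:: j] (ss z))).
pose S := (2 * (nrm setT phi * D ord_max))%R.
have S0 : (0 <= S)%R by rewrite /S DE !mulr_ge0// nrm_ge0.
(* On every line in direction [i] the value of phi^2 is at most the line integral of |D_i(phi^2)|;
   integrating over the plane gives a bound uniform in [z]. *)
have sS z : (nrm setT (s z) ^+ 2 <= S)%R.
  rewrite -lee_fin -L2_sqr_integral//.
  rewrite /S DE; apply: le_trans (integral_abs_sqr_derive_le i sphi cphi).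
  have sF : smooth (phi * phi)%R by exact: smoothM.
  have cF : csupp (phi * phi)%R by exact: csupp_mulr.
  have cDF : continuous ('D_(unitv R i) (phi * phi)%R) := smooth_continuous (smooth_pderiv [:: i] sF).
  have mDF : measurable_fun setT (fun x => (`|'D_(unitv R i) (phi * phi)%R x|)%:E).
    apply/measurable_EFinP; apply: measurableT_comp => //; exact: continuous_measurable_rV.
  rewrite (integral_ins' i)//.
  apply: ge0_le_integral => //.
  - by move=> y _; rewrite lee_fin sqr_ge0.
  - by apply/measurable_EFinP; apply: measurable_funX; case: (Ls z).
  - exact: (measurable_integral_ins i mDF).
  - move=> y _; have := @norm_le_integral_line _ _ i (phi * phi)%R (smooth_continuous sF) cF
      (fun x => @smooth_derivable _ _ _ i x sF) cDF (ins i (z, y)).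
    by rewrite rem_ins /= fctE -expr2 ger0_norm ?sqr_ge0.
pose Dz j (z : R) : \bar R := \int[leb R 2]_y (('D_(unitv R (lift i j)) phi (ins i (z, y))) ^+ 2)%:E.
have DzE j z : Dz j z = (nrm setT ('D_(unitv R j) (s z)) ^+ 2)%:E.
  rewrite -(L2_sqr_integral (mT _) (LDs j z)); apply: eq_integral => y _.
  have Dsl := congr1 (fun g => g y) (@derive_slice R 2 i phi z j sphi).
  exact: (congr1 (fun r : R => (r ^+ 2)%:E) (esym Dsl)).
have mD2 j : measurable_fun setT (fun x => (('D_(unitv R (lift i j)) phi x) ^+ 2)%:E).
  by apply/measurable_EFinP; apply: measurable_funX; exact: continuous_measurable_rV.
have D20 j x : 0 <= (('D_(unitv R (lift i j)) phi x) ^+ 2)%:E by rewrite lee_fin sqr_ge0.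
have mDz j : measurable_fun setT (Dz j) by exact: (measurable_integral_ins_l i (mD2 j) (D20 j)).
have Dz0 j z : 0 <= Dz j z by rewrite DzE lee_fin sqr_ge0.
have iDz j : \int[lebesgue_measure]_z Dz j z = (D (lift i j) ^+ 2)%:E.
  by rewrite DE -L2_sqr_integral// (integral_ins i).
have m4 : measurable_fun setT (fun x => ((phi x ^+ 2) ^+ 2)%:E).
  by apply/measurable_EFinP; do 2 apply: measurable_funX; exact: continuous_measurable_rV.
have p0 x : 0 <= ((phi x ^+ 2) ^+ 2)%:E by rewrite lee_fin sqr_ge0.
have mS : measurable_fun setT (fun z => Dz ord0 z + Dz ord_max z) by exact: emeasurable_funD.
have S2 : 0 <= (2 * S)%:E by rewrite lee_fin mulr_ge0.
clearbody Dz.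
rewrite (integral_ins i)//.
apply: (@le_trans _ _ (\int[lebesgue_measure]_z ((2 * S)%:E * (Dz ord0 z + Dz ord_max z)))).
  apply: ge0_le_integral => //.
  - by move=> z _; exact: integral_ge0.
  - exact: (measurable_integral_ins_l i m4 p0).
  - exact: measurable_funeM mS.
  - move=> z _; apply: (le_trans (ladyzhenskaya2_nrm (ss z) (cs z))).
    rewrite !DzE -EFinD -EFinM lee_fin.
    exact: young_bound (sqr_ge0 _) (sS z).
rewrite (ge0_integralZD (mDz ord0) (mDz ord_max) (Dz0 ord0) (Dz0 ord_max) S2).
rewrite (iDz ord0) (iDz ord_max) -EFinD -EFinM lee_fin /S.
by rewrite ladyzhenskaya3_algebra.
Qed.

End ladyzhenskaya.

(** * The Sobolev inequality for test functions *)

Section sobolev.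
Context (R : realType) (d : nat) (Om : set 'rV[R]_d).
Hypothesis d23 : d = 2%N \/ d = 3%N.
Local Notation E := 'rV[R]_d.
Local Notation mu := (leb R d).
Hypothesis oOm : open Om.
Hypothesis bOm : bounded_set Om.

Let mOm : measurable Om. Proof. exact: open_measurable_rV. Qed.

Lemma nrm_setT_support (u : E -> R) : (forall x, ~ Om x -> u x = 0) -> nrm setT u = nrm Om u.
Proof.
move=> u0; congr Num.sqrt; rewrite /ip (Rintegral_setT_support (Om := Om))//.
by move=> x /u0 ->; rewrite mul0r.
Qed.

(** [nrm Om (phi * phi)] is the squared $L^4$ norm, so this is the embedding of $H^1$ in $L^4$ for
    test functions; each factor in Ladyzhenskaya's inequality is at most the $H^1$ norm. *)
Lemma Ccinfty_sobolev phi : Ccinfty Om phi ->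
  nrm Om (phi * phi) <= 3 * H1nrm Om phi ^+ 2.
Proof.
move=> C; have sp := Ccinfty_smooth C; have cp := Ccinfty_csupp C.
pose H := H1nrm Om phi.
have H0 : 0 <= H := H1nrm_ge0 Om phi.
have nD i : nrm setT ('D_(unitv R i) phi) <= H.
  rewrite nrm_setT_support; last by move=> x; exact: (Ccinfty_out (Ccinfty_pderiv [:: i] C)).
  have LD : L2 Om ('D_(unitv R i) phi) := Ccinfty_L2 mOm (Ccinfty_pderiv [:: i] C).
  have [Lw _] := H1_wpd i (Ccinfty_H1 oOm C).
  rewrite -(nrm_eq_nrmB0 oOm Lw LD); first exact: nrm_wpd_le_H1nrm.
  exact: wpd_Ccinfty.
have n1 : nrm setT phi <= H.
  rewrite nrm_setT_support; last by move=> x; exact: Ccinfty_out C.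
  exact: nrm_le_H1nrm.
have key : (\int[mu]_x ((phi x ^+ 2) ^+ 2)%:E <= (9 * H ^+ 4)%:E)%E.
  case: d23 => dE; subst d.
    apply: (le_trans (ladyzhenskaya2_nrm sp cp)); rewrite lee_fin.
    exact: (ladyzhenskaya2_bound (nrm_ge0 _ _) n1 (nrm_ge0 _ _) (nD ord0) (nrm_ge0 _ _) (nD ord_max)).
  apply: (le_trans (ladyzhenskaya3_nrm sp cp (D := fun j => nrm setT ('D_(unitv R j) phi)) (fun=> erefl))); rewrite lee_fin.
  exact: (ladyzhenskaya3_bound (nrm_ge0 _ _) n1 (nrm_ge0 _ _) (nD _) (nrm_ge0 _ _) (nD _) (nrm_ge0 _ _) (nD _)).
have L : L2 Om (phi * phi) := Ccinfty_L2 mOm (CcinftyM C C).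
rewrite -(@ler_pXn2r _ 2) ?nnegrE ?nrm_ge0 ?mulr_ge0 ?sqr_ge0// -lee_fin -L2_sqr_integral//.
rewrite (_ : (3 * H ^+ 2) ^+ 2 = 9 * H ^+ 4); last by ring.
apply: le_trans key; rewrite [leLHS](_ : _ = \int[mu]_(x in Om) ((phi x ^+ 2) ^+ 2)%:E)%E.
  apply: ge0_subset_integral => //; last by move=> x _; rewrite lee_fin sqr_ge0.
  apply/measurable_EFinP; do 2 apply: measurable_funX.
  exact: continuous_measurable_rV (smooth_continuous sp).
by apply: eq_integral => x _; rewrite fctE -expr2.
Qed.

End sobolev.

Lemma cvg_eq_seq (R : realType) (f g : nat -> R) (a b : R) : (forall n, f n = g n) -> a = b ->
  g n @[n --> \oo] --> b -> f n @[n --> \oo] --> a.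
Proof. by move=> /funext -> ->. Qed.

Lemma cvgn_sum (R : realType) (I : Type) (s : seq I) (f : I -> nat -> R) (l : I -> R) :
  (forall i, f i n @[n --> \oo] --> l i) ->
  \sum_(i <- s) f i n @[n --> \oo] --> \sum_(i <- s) l i.
Proof.
move=> fl; elim: s => [|i s IH].
  rewrite big_nil; apply: (@cvg_eq_seq _ _ (cst 0) _ 0) => //; last exact: cvg_cst.
  by move=> n; rewrite big_nil.
rewrite big_cons; apply: (@cvg_eq_seq _ _ (fun n => f i n + \sum_(j <- s) f j n)) erefl _.
  by move=> n; rewrite big_cons.
by apply: cvgD => //; exact: fl.
Qed.

(** * Products of functions in L^4 and lower semicontinuity of the L^4 norm *)

Section L4.
Context (R : realType) (d : nat) (Om : set 'rV[R]_d).
Hypothesis mOm : measurable Om.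
Local Notation E := 'rV[R]_d.
Local Notation mu := (leb R d).
Implicit Types u v phi : E -> R.

Lemma measurable_mulf u v : measurable_fun Om u -> measurable_fun Om v ->
  measurable_fun Om (u * v).
Proof. exact: measurable_funM. Qed.

Lemma L2_mul u v : measurable_fun Om u -> measurable_fun Om v ->
  L2 Om (u * u) -> L2 Om (v * v) -> L2 Om (u * v).
Proof.
move=> mu_ mv Lu Lv; apply: (L2_le mOm _ (L2D mOm Lu Lv)); first exact: measurable_mulf.
move=> x _; rewrite !fctE [leRHS]ger0_norm ?addr_ge0 -?expr2 ?sqr_ge0// normrM.
rewrite -[u x ^+ 2]real_normK ?num_real// -[v x ^+ 2]real_normK ?num_real//.
have := sqr_ge0 (`|u x| - `|v x|); have := normr_ge0 (u x); have := normr_ge0 (v x); nra.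
Qed.

Lemma nrm_mul_sqr u v : measurable_fun Om u -> measurable_fun Om v ->
  L2 Om (u * u) -> L2 Om (v * v) ->
  nrm Om (u * v) ^+ 2 <= nrm Om (u * u) * nrm Om (v * v).
Proof.
move=> mu_ mv Lu Lv; rewrite nrm_sqr.
have -> : ip Om (u * v) (u * v) = ip Om (u * u) (v * v).
  by apply: eq_Rintegral => x _; rewrite !fctE; ring.
exact: le_trans (ler_norm _) (ip_CS mOm Lu Lv).
Qed.

(* On the set where |u| <= M, testing
   phi_n^2 against the bounded function u^2 passes to the limit. *)
Lemma nrm_trunc_sqr_le u (phi : nat -> E -> R) K M : 0 <= K -> L2 Om u ->
  (forall n, L2 Om (phi n)) -> (forall n, L2 Om (phi n * phi n)) ->
  nrm Om (u - phi n) @[n --> \oo] --> 0 ->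
  (forall e, 0 < e -> \forall n \near \oo, nrm Om (phi n * phi n) <= K + e) ->
  let a : E -> R := fun x => u x ^+ 2 * \1_[set x | Om x /\ `|u x| <= M] x in
  0 <= M -> L2 Om a /\ nrm Om a <= K.
Proof.
move=> K0 Lu Lp Lpp c bK a M0.
pose A := [set x | Om x /\ `|u x| <= M].
have mA : measurable A.
  have -> : A = Om `&` (fun x => `|u x|) @^-1` `]-oo, M]%classic.
    by apply/seteqP; split => x /=; rewrite in_itv.
  have [mau _] := L2_norm mOm Lu.
  exact: mau.
have i01 x : 0 <= (\1_A x : R) <= 1 by rewrite indicE; case: (_ \in _); rewrite ?lexx ?ler01.
have aM x : `|a x| <= M * `|u x|.
  rewrite /a -/A indicE; have [xA|xA] := pselect (A x); last first.
    by rewrite memNset// mulr0 normr0 mulr_ge0.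
  by rewrite mem_set// mulr1 normrX expr2 ler_wpM2r//; case: xA.
have aM2 x : `|a x| <= M ^+ 2.
  rewrite /a -/A indicE; have [xA|xA] := pselect (A x); last first.
    by rewrite memNset// mulr0 normr0 sqr_ge0.
  by rewrite mem_set// mulr1 normrX lerXn2r ?nnegrE//; case: xA.
have ma : measurable_fun Om a.
  by apply: measurable_funM; [apply: measurable_funX; case: Lu|exact: measurable_indic].
have La : L2 Om a.
  apply: (L2_le mOm ma (L2Z mOm M Lu)) => x _.
  have -> : (M *: u) x = M * u x by [].
  by rewrite [leRHS]normrM (ger0_norm M0); exact: aM.
split => //.
have scale_dom (g : E -> R) x : `|(a * g) x| <= `|(M ^+ 2 *: g) x|.
  have -> : (a * g) x = a x * g x by [].
  have -> : (M ^+ 2 *: g) x = M ^+ 2 * g x by [].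
  by rewrite [leLHS]normrM [leRHS]normrM (ger0_norm (sqr_ge0 M)) ler_wpM2r.
have Lap n : L2 Om (a * (phi n + u)).
  have L := L2D mOm (Lp n) Lu.
  apply: (L2_le mOm _ (L2Z mOm (M ^+ 2) L)); first by apply: measurable_mulf => //; case: L.
  by move=> x _; exact: scale_dom.
have nap n : nrm Om (a * (phi n + u)) <= M ^+ 2 * (2 * nrm Om u + nrm Om (u - phi n)).
  have L := L2D mOm (Lp n) Lu.
  have : nrm Om (a * (phi n + u)) <= nrm Om (M ^+ 2 *: (phi n + u)).
    apply: (nrm_le mOm _ (L2Z mOm _ L)); first by case: (Lap n).
    by move=> x _; exact: scale_dom.
  move=> h; apply: (le_trans h); rewrite nrmZ// (ger0_norm (sqr_ge0 M)) ler_wpM2l ?sqr_ge0//.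
  have := nrm_triangle mOm (Lp n) Lu.
  have := nrm_ler_dist mOm Lu (Lp n); rewrite ler_norml => /andP[]; lra.
have key n : nrm Om a ^+ 2 <= nrm Om a * nrm Om (phi n * phi n) +
   M ^+ 2 * (2 * nrm Om u + nrm Om (u - phi n)) * nrm Om (u - phi n).
  (* On the truncation set [a] equals u^2, hence a^2 = a phi_n^2 + a (u + phi_n) (u - phi_n); off it
     all terms vanish. *)
  have E1 : ip Om a a = ip Om a (phi n * phi n) + ip Om (a * (phi n + u)) (u - phi n).
    rewrite /ip -RintegralD//; last 2 first.
    - exact: L2_integrable_mul.
    - by apply: L2_integrable_mul => //; exact: L2B.
    apply: eq_Rintegral => x _; rewrite !fctE /a -/A indicE.
    by case: (x \in A); rewrite /= ?mulr1 ?mulr0; ring.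
  rewrite nrm_sqr E1 lerD//; first exact: le_trans (ler_norm _) (ip_CS mOm La (Lpp n)).
  apply: le_trans (ler_norm _) _; apply: le_trans (ip_CS mOm (Lap n) (L2B mOm Lu (Lp n))) _.
  by rewrite ler_wpM2r ?nrm_ge0.
have := nrm_ge0 Om a; rewrite le_eqVlt => /predU1P[<-//|a0].
apply/ler_addgt0Pr => e e0.
(* [B] bounds the coefficient of the error in [key] once nrm (u - phi_n) < 1; the added 1 keeps it
   positive when M = 0. *)
pose B := M ^+ 2 * (2 * nrm Om u + 1) + 1.
have B0 : 0 < B by rewrite ltr_wpDl// mulr_ge0 ?sqr_ge0// addr_ge0// mulr_ge0// nrm_ge0.
have e2 : 0 < e / 2 by rewrite divr_gt0.
have e3 : 0 < nrm Om a * (e / 2) / B by rewrite divr_gt0// mulr_gt0.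
have [n [h1 h2 h3]] : exists n, [/\ nrm Om (phi n * phi n) <= K + e / 2,
    nrm Om (u - phi n) < 1 & nrm Om (u - phi n) < nrm Om a * (e / 2) / B].
  have /cvgrPdist_lt/(_ _ ltr01) n1 := c.
  have /cvgrPdist_lt/(_ _ e3) n2 := c.
  have [n _ /(_ n (leqnn n))[]] := filterI (bK _ e2) (filterI n1 n2).
  move=> h [h1 h2]; rewrite /= sub0r normrN ger0_norm ?nrm_ge0// in h1.
  by rewrite /= sub0r normrN ger0_norm ?nrm_ge0// in h2; exists n.
rewrite ltr_pdivlMr// in h3.
have d0 := nrm_ge0 Om (u - phi n).
have u0 := nrm_ge0 Om u.
have k := key n.
have h4 : M ^+ 2 * (2 * nrm Om u + nrm Om (u - phi n)) * nrm Om (u - phi n) <= nrm Om (u - phi n) * B.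
  rewrite mulrC ler_wpM2l// /B -[leLHS]addr0 lerD// ler_wpM2l ?sqr_ge0//.
  by rewrite lerD2l ltW.
have h5 : nrm Om a * nrm Om (phi n * phi n) <= nrm Om a * (K + e / 2) by rewrite ler_pM2l.
have : nrm Om a * nrm Om a <= nrm Om a * (K + e).
  rewrite -expr2; apply: (le_trans k).
  have -> : nrm Om a * (K + e) = nrm Om a * (K + e / 2) + nrm Om a * (e / 2) by field.
  rewrite lerD//.
  by apply: (le_trans h4); rewrite ltW.
by rewrite ler_pM2l.
Qed.

(** The truncations at level m increase to u^2 and all have norm at most [K], so monotone
    convergence applies. The hypothesis with K + e says that the upper limit of the approximating
    norms is at most [K]. *)
Lemma L4_lower_semicontinuous u (phi : nat -> E -> R) K : 0 <= K -> L2 Om u ->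
  (forall n, L2 Om (phi n)) -> (forall n, L2 Om (phi n * phi n)) ->
  nrm Om (u - phi n) @[n --> \oo] --> 0 ->
  (forall e, 0 < e -> \forall n \near \oo, nrm Om (phi n * phi n) <= K + e) ->
  L2 Om (u * u) /\ nrm Om (u * u) <= K.
Proof.
move=> K0 Lu Lp Lpp c bK.
pose a (m : nat) : E -> R := fun x => u x ^+ 2 * \1_[set x | Om x /\ `|u x| <= m%:R] x.
have aP m : L2 Om (a m) /\ nrm Om (a m) <= K.
  exact: (nrm_trunc_sqr_le K0 Lu Lp Lpp c bK (ler0n R m)).
have aE m x : Om x -> `|u x| <= m%:R -> a m x = u x ^+ 2.
  by move=> Ox um; rewrite /a indicE mem_set ?mulr1.
have a0 m x : 0 <= a m x by rewrite mulr_ge0 ?sqr_ge0// indicE.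
have and' x : {homo a ^~ x : n m / (n <= m)%N >-> n <= m}.
  move=> n m nm; rewrite /a ler_wpM2l ?sqr_ge0// !indicE.
  have [[Ox un]|nx] := pselect (Om x /\ `|u x| <= n%:R); last by rewrite memNset.
  rewrite mem_set// mem_set//=; split => //.
  by apply: (le_trans un); rewrite ler_nat.
have ca x : Om x -> a m x @[m --> \oo] --> (u * u) x.
  move=> Ox; apply: cvg_near_cst; near=> m.
  rewrite aE//; near: m; exact: nbhs_infty_ger.
have muu : measurable_fun Om (u * u) by apply: measurable_mulf; case: Lu.
pose g' m x := ((a m x) ^+ 2)%:E.
have cg x : Om x -> g' m x @[m --> \oo] --> ((u * u) x ^+ 2)%:E.
  move=> Ox; apply: cvg_EFin; first exact: nearW.
  apply: (@cvg_comp _ _ _ (a ^~ x) (fun y => y ^+ 2)); first exact: ca.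
  exact: exprn_continuous.
have cI := @cvg_monotone_convergence _ _ _ mu Om mOm g'.
have {cI} : (\int[mu]_(x in Om) g' n x @[n --> \oo] --> \int[mu]_(x in Om) limn (g' ^~ x))%E.
  apply: cI.
  - by move=> m; apply/measurable_EFinP; apply: measurable_funX; case: (aP m) => -[].
  - by move=> m x _; rewrite lee_fin sqr_ge0.
  - by move=> x _ n m nm; rewrite lee_fin lerXn2r ?nnegrE// and'.
rewrite (eq_integral (fun x => ((u * u) x ^+ 2)%:E)); last first.
  by move=> x /[!inE] Ox; exact/cvg_lim/cg.
move=> cI.
have iK : (\int[mu]_(x in Om) ((u * u) x ^+ 2)%:E <= (K ^+ 2)%:E)%E.
  rewrite -(cvg_lim _ cI)//; apply: lime_le; first by apply/cvg_ex; eexists; exact: cI.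
  apply: nearW => m; have [La nK] := aP m.
  by rewrite /g' L2_sqr_integral// lee_fin lerXn2r ?nnegrE ?nrm_ge0.
have Luu : L2 Om (u * u).
  split => //; apply/integrableP; split.
    by apply/measurable_EFinP; exact: measurable_funX.
  under eq_integral do rewrite gee0_abs ?lee_fin ?sqr_ge0//.
  by apply: le_lt_trans iK _; rewrite ltry.
split => //; move: iK; rewrite L2_sqr_integral// lee_fin ler_pXn2r ?nnegrE ?nrm_ge0//.
Unshelve. all: by end_near. Qed.

End L4.

(** * The embedding of H^1_0 in L^4 and the cancellation of the trilinear form *)

Section trilinear.
Local Opaque nrm H1nrm wpd wdiv.
Context (R : realType) (d : nat) (Om : set 'rV[R]_d).
Hypothesis d23 : d = 2%N \/ d = 3%N.
Local Notation E := 'rV[R]_d.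
Local Notation mu := (leb R d).
Hypothesis oOm : open Om.
Hypothesis bOm : bounded_set Om.

Let mOm : measurable Om. Proof. exact: open_measurable_rV. Qed.

(** It allows the Sobolev bound to be applied to the error u - phi_n, which then tends to 0 in
    $L^4$. *)
Lemma H10_sub_Ccinfty u phi : H10 Om u -> Ccinfty Om phi -> H10 Om (u - phi).
Proof.
move=> [Hu [psi [C c]]] Cphi; split; first exact: H1B (Ccinfty_H1 _ _).
exists (fun n => psi n - phi); split; first by move=> n; exact: CcinftyB.
have -> : (fun n => H1nrm Om (u - phi - (psi n - phi))) = (fun n => H1nrm Om (u - psi n)).
  by apply/funext => n; congr H1nrm; apply/funext => x; rewrite !fctE; ring.
exact: c.
Qed.

Lemma cvgn_H1nrm u (phi : nat -> E -> R) : H10 Om u -> (forall n, Ccinfty Om (phi n)) ->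
  H1nrm Om (u - phi n) @[n --> \oo] --> 0 -> H1nrm Om (phi n) ^+ 2 @[n --> \oo] --> H1nrm Om u ^+ 2.
Proof.
move=> Hu C c.
have Lu := Hu.1.1.
have Lp n : L2 Om (phi n) by exact: Ccinfty_L2.
have cn (F : nat -> E -> R) v : (forall n, L2 Om (F n)) -> L2 Om v ->
    nrm Om (v - F n) @[n --> \oo] --> 0 -> nrm Om (F n) ^+ 2 @[n --> \oo] --> nrm Om v ^+ 2.
  move=> LF Lv cF; apply: (@cvg_comp _ _ _ (fun n => nrm Om (F n)) (fun y => y ^+ 2) _ (nbhs (nrm Om v))).
    apply/cvgrPdist_le => e e0.
    have /cvgrPdist_le/(_ _ e0) := cF; apply: filterS => n.
    rewrite sub0r normrN ger0_norm ?nrm_ge0//; apply: le_trans.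
    exact: nrm_ler_dist.
  exact: exprn_continuous.
have EU := H1nrm_sqr Om u.
have EP n := H1nrm_sqr Om (phi n).
apply: (cvg_eq_seq EP EU).
apply: cvgD.
  apply: cn => //; apply: cvg0_le c => n; by rewrite nrm_ge0 nrm_le_H1nrm.
apply: cvgn_sum => i.
have [Lw _] := H1_wpd i Hu.1.
have Lwp n : L2 Om (wpd Om i (phi n)) by case: (H1_wpd i (Ccinfty_H1 oOm (C n))).
apply: cn => //; apply: cvg0_le c => n; rewrite nrm_ge0/=.
have Hp := Ccinfty_H1 oOm (C n).
have [Lup _] := H1_wpd i (H1B oOm Hu.1 Hp).
have e := nrm_eq_nrmB0 oOm Lup (L2B mOm Lw (Lwp n)) (wpdB oOm bOm i Hu.1 Hp).
by rewrite -e nrm_wpd_le_H1nrm.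
Qed.

Lemma third_error (A B e : R) : - (e / 3) <= A - B -> 3 * B <= 3 * A + e.
Proof. lra. Qed.

(** The bound for test functions survives the limit: their $H^1$ norms converge, and the $L^4$ norm
    is lower semicontinuous. *)
Lemma H10_sobolev u : H10 Om u ->
  L2 Om (u * u) /\ nrm Om (u * u) <= 3 * H1nrm Om u ^+ 2.
Proof.
move=> Hu; have [phi [C c cu _]] := H10_approx oOm bOm Hu.
apply: (@L4_lower_semicontinuous _ _ _ mOm u phi) => //.
- by rewrite mulr_ge0 ?sqr_ge0.
- exact: Hu.1.1.
- by move=> n; exact: Ccinfty_L2.
- by move=> n; apply: Ccinfty_L2 => //; exact: CcinftyM.
- move=> e e0.
  have e3 : 0 < e / 3 by rewrite divr_gt0.
  have /cvgrPdist_le/(_ _ e3) := cvgn_H1nrm Hu C c.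
  apply: filterS => n; rewrite ler_norml => /andP[h _].
  apply: (le_trans (Ccinfty_sobolev d23 oOm bOm (C n))).
  exact: third_error.
Qed.

Lemma cvg_ip (a b : nat -> E -> R) a0 b0 : (forall n, L2 Om (a n)) -> (forall n, L2 Om (b n)) ->
  L2 Om a0 -> L2 Om b0 -> nrm Om (a0 - a n) @[n --> \oo] --> 0 ->
  nrm Om (b0 - b n) @[n --> \oo] --> 0 -> ip Om (a n) (b n) @[n --> \oo] --> ip Om a0 b0.
Proof.
move=> La Lb La0 Lb0 ca cb.
apply/cvgrPdist_le => e e0.
have : nrm Om (a0 - a n) * (nrm Om b0 + nrm Om (b0 - b n)) + nrm Om a0 * nrm Om (b0 - b n) @[n --> \oo]
    --> 0 * (nrm Om b0 + 0) + nrm Om a0 * 0.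
  by apply: cvgD; [apply: cvgM => //; apply: cvgD => //; exact: cvg_cst|apply: cvgMr].
rewrite mul0r mulr0 addr0 => /cvgrPdist_le/(_ _ e0); apply: filterS => n.
have n1 := nrm_ge0 Om (a0 - a n); have n2 := nrm_ge0 Om (b0 - b n).
have n3 := nrm_ge0 Om a0; have n4 := nrm_ge0 Om b0.
rewrite sub0r normrN ger0_norm; last by rewrite addr_ge0 ?mulr_ge0 ?addr_ge0.
apply: le_trans.
have LA := L2B mOm La0 (La n); have LB := L2B mOm Lb0 (Lb n).
have -> : ip Om a0 b0 - ip Om (a n) (b n) = ip Om (a0 - a n) (b n) + ip Om a0 (b0 - b n).
  by rewrite ipBl// ipBr//; ring.
apply: (le_trans (ler_normD _ _)); rewrite lerD//; last exact: ip_CS.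
apply: (le_trans (ip_CS mOm LA (Lb n))); rewrite ler_wpM2l//.
have := nrm_ler_dist mOm Lb0 (Lb n); rewrite ler_norml => /andP[]; lra.
Qed.

Lemma Rintegral_ip_sum (I : Type) (s : seq I) (F G : I -> E -> R) :
  (forall i, L2 Om (F i)) -> (forall i, L2 Om (G i)) ->
  mu.-integrable Om (EFin \o (fun x => \sum_(i <- s) F i x * G i x)) /\
  \sum_(i <- s) ip Om (F i) (G i) = \int[mu]_(x in Om) \sum_(i <- s) F i x * G i x.
Proof.
move=> LF LG; elim: s => [|i s [IH1 IH2]].
  have E0 : (fun x : E => \sum_(i <- [::]) F i x * G i x) = cst 0.
    by apply/funext => x; rewrite big_nil.
  rewrite E0 big_nil; split; first exact: integrable0.
  by rewrite Rintegral_cst// mul0r.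
have E1 : (fun x : E => \sum_(i <- i :: s) F i x * G i x) =
   (fun x => F i x * G i x + \sum_(i <- s) F i x * G i x).
  by apply/funext => x; rewrite big_cons.
rewrite E1 big_cons IH2; split.
  have := integrableD mOm (L2_integrable_mul mOm (LF i) (LG i)) IH1.
  by apply: eq_integrable.
by rewrite RintegralD//; exact: L2_integrable_mul.
Qed.

Lemma nrm_mul_cvg0 (u : E -> R) (e : nat -> E -> R) : measurable_fun Om u -> L2 Om (u * u) ->
  (forall n, measurable_fun Om (e n)) -> (forall n, L2 Om (e n * e n)) ->
  nrm Om (e n * e n) @[n --> \oo] --> 0 -> nrm Om (u * e n) @[n --> \oo] --> 0.
Proof.
move=> mu_ Luu me Lee c.
have -> : (fun n => nrm Om (u * e n)) = (fun n => Num.sqrt (nrm Om (u * e n) ^+ 2)).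
  by apply/funext => n; rewrite sqrtr_sqr ger0_norm// nrm_ge0.
rewrite -[X in _ --> X]sqrtr0.
apply: (@cvg_comp _ _ _ _ (@Num.sqrt R) _ (nbhs (0 : R))); last exact: sqrt_continuous.
apply: (@cvg0_le _ _ (fun n => nrm Om (u * u) * nrm Om (e n * e n))).
  by move=> n; rewrite sqr_ge0/=; exact: nrm_mul_sqr.
by rewrite -(mulr0 (nrm Om (u * u))); exact: cvgMr.
Qed.

(* Testing the weak divergence of [w] against phi_n^2, where phi_n tends to [w j]. *)
Lemma bstar_component w j : X Om w ->
  2 * \sum_i ip Om (w i * w j) (wpd Om i (w j)) = - ip Om (wdiv Om w) (w j * w j).
Proof.
move=> Xw.
have [phi [C c cu cD]] := H10_approx oOm bOm (Xw j).
have [HD Lw ww] := X_wdiv oOm bOm Xw.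
have [_ isw] := Hdiv_wdiv HD.
have Lwi i : L2 Om (w i) := (Xw i).1.1.
have mwi i : measurable_fun Om (w i) := (Lwi i).1.
have Lwii i : L2 Om (w i * w i) by case: (H10_sobolev (Xw i)).
have Lp n : L2 Om (phi n) by exact: Ccinfty_L2.
have mp n : measurable_fun Om (phi n) := (Lp n).1.
have Lpp n : L2 Om (phi n * phi n) by apply: Ccinfty_L2 => //; exact: CcinftyM.
have LD i n : L2 Om ('D_(unitv R i) (phi n)) := Ccinfty_L2 mOm (Ccinfty_pderiv [:: i] (C n)).
have Lc i : L2 Om (wpd Om i (w j)) by case: (H1_wpd i (Xw j).1).
pose e n : E -> R := w j - phi n.
have He n : H10 Om (e n) by exact: H10_sub_Ccinfty.
have Le n : L2 Om (e n) := (He n).1.1.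
have me n : measurable_fun Om (e n) := (Le n).1.
have Lee n : L2 Om (e n * e n) by case: (H10_sobolev (He n)).
(* Approximation in $H^1$ is approximation in $L^4$, by the Sobolev bound applied to [e n]. *)
have cee : nrm Om (e n * e n) @[n --> \oo] --> 0.
  apply: (@cvg0_le _ _ (fun n => 3 * (H1nrm Om (e n) * H1nrm Om (e n)))).
    by move=> n; rewrite nrm_ge0 -expr2; case: (H10_sobolev (He n)).
  have : 3 * (H1nrm Om (e n) * H1nrm Om (e n)) @[n --> \oo] --> (3 * (0 * 0) : R) by apply: cvgMr; exact: cvgM.
  by rewrite !mulr0.
have Lwij i k : L2 Om (w i * w k) by exact: L2_mul.
have Lwp i n : L2 Om (w i * phi n) by exact: L2_mul.
have c1 i : nrm Om (w i * w j - w i * phi n) @[n --> \oo] --> 0.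
  rewrite (_ : (fun n => _) = (fun n => nrm Om (w i * e n))); first exact: nrm_mul_cvg0.
  by apply/funext => n; rewrite /e mulrBr.
have c2 : nrm Om (w j * w j - phi n * phi n) @[n --> \oo] --> 0.
  apply: (@cvg0_le _ _ (fun n => 2 * nrm Om (w j * e n) + nrm Om (e n * e n))).
    move=> n; rewrite nrm_ge0/=.
    have Lje : L2 Om (w j * e n) by exact: L2_mul.
    have -> : w j * w j - phi n * phi n = 2 *: (w j * e n) - e n * e n.
      by apply/funext => x; rewrite /e !fctE /GRing.scale /=; ring.
    apply: (le_trans (nrm_triangle mOm (L2Z mOm 2 Lje) (L2N mOm (Lee n)))).
    by rewrite nrmN// nrmZ// ger0_norm.
  have : 2 * nrm Om (w j * e n) + nrm Om (e n * e n) @[n --> \oo] --> (2 * 0 + 0 : R).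
    by apply: cvgD => //; apply: cvgMr; exact: nrm_mul_cvg0.
  by rewrite mulr0 addr0.
(* phi_n^2 is itself a test function with D_i(phi_n^2) = 2 phi_n D_i phi_n. *)
have eqn n : 2 * \sum_i ip Om (w i * phi n) ('D_(unitv R i) (phi n)) = - ip Om (wdiv Om w) (phi n * phi n).
  rewrite -isw; last exact: CcinftyM.
  rewrite mulr_sumr; apply: eq_bigr => i _.
  rewrite -(ipZl mOm 2 (Lwp i n) (LD i n)).
  apply: eq_Rintegral => x _; rewrite pderiv1 abs_sqr_derive; last exact: Ccinfty_smooth (C n).
  by rewrite !fctE /GRing.scale /=; ring.
have l1 : 2 * \sum_i ip Om (w i * phi n) ('D_(unitv R i) (phi n)) @[n --> \oo] -->
    2 * \sum_i ip Om (w i * w j) (wpd Om i (w j)).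
  by apply: cvgMr; apply: cvgn_sum => i; exact: cvg_ip.
have l2 : - ip Om (wdiv Om w) (phi n * phi n) @[n --> \oo] --> - ip Om (wdiv Om w) (w j * w j).
  apply: cvgN; apply: cvg_ip => //.
  rewrite (_ : (fun n => _) = cst 0); first exact: cvg_cst.
  by apply/funext => n; rewrite subrr nrm0.
apply: (@cvg_unique _ (@Rhausdorff R) _ _ _ _ l1).
by rewrite (_ : (fun n => _) = (fun n => - ip Om (wdiv Om w) (phi n * phi n)))//; exact/funext.
Qed.

(** In each component the convective term is minus one half of the divergence term, which is exactly
    the weight of the latter in [bstar]. *)
Lemma bstar_eq0 w : X Om w -> bstar Om w w w = 0.
Proof.
move=> Xw; rewrite /bstar /vip mulr_sumr -big_split /= big1// => j _.
have Lwi i : L2 Om (w i) := (Xw i).1.1.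
have Lwij i k : L2 Om (w i * w k).
  by apply: L2_mul => //; [case: (Lwi i)|case: (Lwi k)|case: (H10_sobolev (Xw i))|case: (H10_sobolev (Xw k))].
have Lc i : L2 Om (wpd Om i (w j)) by case: (H1_wpd i (Xw j).1).
have -> : ip Om (convect Om w w j) (w j) = \sum_i ip Om (w i * w j) (wpd Om i (w j)).
  have [_ ->] := @Rintegral_ip_sum _ (index_enum 'I_d) (fun i => w i * w j) (fun i => wpd Om i (w j)) (fun i => Lwij i j) Lc.
  apply: eq_Rintegral => x _; rewrite /convect mulr_suml; apply: eq_bigr => i _.
  by rewrite !fctE; ring.
have -> : ip Om (fun x => wdiv Om w x * w j x) (w j) = ip Om (wdiv Om w) (w j * w j).
  by apply: eq_Rintegral => x _; rewrite !fctE mulrA.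
have := bstar_component j Xw; lra.
Qed.

End trilinear.

(** * Integration in time *)

Section nonmeasurable_integral.
Context d (T : measurableType d) (R : realType) (mu : {measure set T -> \bar R}).
Local Open Scope ereal_scope.

(** The integral of a nonnegative function is a supremum over the simple functions below it, and
    this set grows with the function, measurable or not. *)
Lemma ge0_le_integral_nonmeas (D : set T) (f g : T -> \bar R) :
  (forall x, D x -> 0 <= f x) -> (forall x, D x -> f x <= g x) ->
  \int[mu]_(x in D) f x <= \int[mu]_(x in D) g x.
Proof.
move=> f0 fg; rewrite !ge0_integralE//; last by move=> x Dx; exact: le_trans (f0 _ Dx) (fg _ Dx).
apply: le_ereal_sup => _ [h hf <-]; exists h => // x.
apply: le_trans (hf x) _; rewrite !patchE; case: ifPn => // /[!inE] Dx; exact: fg.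
Qed.

(** A simple function below [f] is multiplied by the indicator of the complement of [N]: its
    integral is kept since [N] is null, and the product lies below [g], on [N] because g >= 0
    there. *)
Lemma ae_ge0_le_integral_nonmeas (D N : set T) (f g : T -> \bar R) :
  measurable D -> measurable N -> mu N = 0 ->
  (forall x, D x -> 0 <= f x) -> (forall x, D x -> 0 <= g x) ->
  (forall x, D x -> ~ N x -> f x <= g x) ->
  \int[mu]_(x in D) f x <= \int[mu]_(x in D) g x.
Proof.
move=> mD mN N0 f0 g0 fg.
rewrite [leLHS]ge0_integralE//; apply: ge_ereal_sup => _ [h hf <-].
have -> : sintegral mu h = \int[mu]_(x in D) (h x)%:E.
  rewrite integral_nnsfun//; congr sintegral; apply/funext => x.
  rewrite patchE; case: ifPn => //; rewrite notin_setE => nD.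
  have := hf x; rewrite patchE memNset//.
  by rewrite lee_fin => h0; apply/eqP; rewrite eq_le h0 fun_ge0.
have mh : measurable_fun D (EFin \o h) by apply/measurable_EFinP; exact: measurable_funTS.
have mNc : measurable_fun D (\1_(~` N) : T -> R) by exact: measurable_indic (measurableC mN).
have -> : \int[mu]_(x in D) (h x)%:E = \int[mu]_(x in D) (h x * \1_(~` N) x)%:E.
  apply: ge0_ae_eq_integral => //.
  - by apply/measurable_EFinP; apply: measurable_funM => //; exact: measurable_funTS.
  - by move=> x _; rewrite lee_fin fun_ge0.
  - by move=> x _; rewrite lee_fin mulr_ge0// fun_ge0.
  exists N; split => // x /= nx; apply: contrapT => nN; apply: nx => Dx.
  by rewrite indicE mem_set ?mulr1.
apply: ge0_le_integral_nonmeas => x Dx; first by rewrite lee_fin mulr_ge0// fun_ge0.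
rewrite indicE; have [nN|nN] := pselect (N x).
  by rewrite memNset ?mulr0 ?g0//= => /(_ nN).
rewrite mem_set//= mulr1; apply: le_trans (fg _ Dx nN).
by have := hf x; rewrite patchE mem_set.
Qed.

Lemma ae_ge0_eq_integral_nonmeas (D N : set T) (f g : T -> \bar R) :
  measurable D -> measurable N -> mu N = 0 ->
  (forall x, D x -> 0 <= f x) -> (forall x, D x -> 0 <= g x) ->
  (forall x, D x -> ~ N x -> f x = g x) ->
  \int[mu]_(x in D) f x = \int[mu]_(x in D) g x.
Proof.
move=> mD mN N0 f0 g0 fg; apply/eqP; rewrite eq_le.
apply/andP; split; apply: (@ae_ge0_le_integral_nonmeas D N) => // x Dx nN.
  by rewrite fg.
by rewrite fg.
Qed.

(** Needed because the integrands in [is_time_derivative] are not assumed measurable; positive and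
    negative parts are treated separately. *)
Lemma ae_eq_Rintegral_nonmeas (D N : set T) (f g : T -> R) :
  measurable D -> measurable N -> mu N = 0 ->
  (forall x, D x -> ~ N x -> f x = g x) ->
  (\int[mu]_(x in D) f x = \int[mu]_(x in D) g x)%R.
Proof.
move=> mD mN N0 fg; rewrite /Rintegral integralE [in RHS]integralE; congr (fine (_ - _)).
  apply: (ae_ge0_eq_integral_nonmeas mD mN N0) => // x Dx nN.
  by rewrite !funeposE fg.
apply: (ae_ge0_eq_integral_nonmeas mD mN N0) => // x Dx nN.
by rewrite !funenegE fg.
Qed.

Lemma integrable_mull (D : set T) (k : R) (f : T -> R) : measurable D ->
  mu.-integrable D (EFin \o f) -> mu.-integrable D (EFin \o (fun t => k * f t)%R).
Proof.
by move=> mD iF; have := integrableZl mD k iF; apply: eq_integrable => // t _; rewrite /= EFinM.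
Qed.

Lemma integrable_addr (D : set T) (f g : T -> R) : measurable D ->
  mu.-integrable D (EFin \o f) -> mu.-integrable D (EFin \o g) ->
  mu.-integrable D (EFin \o (fun t => f t + g t)%R).
Proof.
by move=> mD iF iG; have := integrableD mD iF iG; apply: eq_integrable => // t _; rewrite /= EFinD.
Qed.

Lemma integrable_subr (D : set T) (f g : T -> R) : measurable D ->
  mu.-integrable D (EFin \o f) -> mu.-integrable D (EFin \o g) ->
  mu.-integrable D (EFin \o (fun t => f t - g t)%R).
Proof.
by move=> mD iF iG; have := integrableB mD iF iG; apply: eq_integrable => // t _; rewrite /= EFinB.
Qed.

Lemma integrable_dom (D : set T) (f g : T -> R) : measurable D ->
  measurable_fun D f -> mu.-integrable D (EFin \o g) ->
  (forall t, D t -> `|f t| <= g t)%R -> mu.-integrable D (EFin \o f).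
Proof.
move=> mD mf ig fg; apply: (le_integrable mD _ _ ig); first exact/measurable_EFinP.
by move=> t Dt; rewrite /= lee_fin (le_trans (fg _ Dt))// ler_norm.
Qed.

Lemma integrable_bounded_mull (D : set T) (h f : T -> R) (M : R) : measurable D ->
  measurable_fun D h -> (forall t, D t -> `|h t| <= M)%R ->
  mu.-integrable D (EFin \o f) -> mu.-integrable D (EFin \o (fun t => h t * f t)%R).
Proof.
move=> mD mh hM iF; have [/measurable_EFinP mf _] := integrableP _ _ _ iF.
apply: (@integrable_dom _ _ (fun t => M * `|f t|)%R mD).
- exact: measurable_funM.
- by apply: integrable_mull => //; have := integrable_norm iF; exact: eq_integrable.
- by move=> t Dt; rewrite normrM ler_wpM2r// hM.
Qed.

Lemma integrable_EFin_measurable (D : set T) (f : T -> R) :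
  mu.-integrable D (EFin \o f) -> measurable_fun D f.
Proof. by case/integrableP => /measurable_EFinP. Qed.

End nonmeasurable_integral.

(** * Integrals over intervals, approximate identities, a telescoping argument *)

Section interval_integrals.
Context (R : realType).
Local Notation leb1 := (@lebesgue_measure R).
Local Notation "\I[ a , b ] f" := (\int[leb1]_(t in `[a, b]) f t)
  (at level 10, a, b at level 9, f at level 10).

Lemma integrable_sub_itv (a b c e : R) (f : R -> R) : a <= c -> e <= b ->
  leb1.-integrable `[a, b] (EFin \o f) -> leb1.-integrable `[c, e] (EFin \o f).
Proof.
move=> ac eb; apply: integrableS; [exact: measurable_itv|exact: measurable_itv|].
by move=> t /=; rewrite !in_itv/= => /andP[ct te]; rewrite (le_trans ac)//= (le_trans te).
Qed.

Lemma Rintegral_itv_split (a b c : R) (f : R -> R) : a <= b -> b <= c ->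
  leb1.-integrable `[a, c] (EFin \o f) ->
  \I[a, c] f = \I[a, b] f + \I[b, c] f.
Proof.
move=> ab bc iF.
have := @Rintegral_itvB R f (BLeft a) (BRight c) b iF.
rewrite !bnd_simp ab bc => /(_ isT isT).
rewrite Rintegral_itv_obnd_cbnd.
  by move=> <-; rewrite addrC subrK.
apply: integrableS iF; [exact: measurable_itv|exact: measurable_itv|].
by move=> t /=; rewrite !in_itv/= => /andP[ct ->]; rewrite (le_trans ab (ltW ct)).
Qed.

Lemma Rintegral_itv1 (a : R) f : \I[a, a] f = 0.
Proof. by rewrite set_itv1 Rintegral_set1. Qed.

Lemma Rintegral_derive1 (F : R -> R) a b : a <= b -> (forall x, derivable F x 1) ->
  continuous (F^`()%classic) -> \I[a, b] (F^`()%classic) = F b - F a.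
Proof.
move=> ab dF cF; move: ab; rewrite le_eqVlt => /predU1P[->|ab].
  by rewrite Rintegral_itv1 subrr.
have cFF : continuous F by move=> x; apply/differentiable_continuous/derivable1_diffP.
suff E : (\int[leb1]_(t in `[a, b]) (F^`()%classic t)%:E = (F b)%:E - (F a)%:E)%E.
  by rewrite /Rintegral; under eq_integral do over; rewrite E.
have dFo : derivable_oo_LRcontinuous F a b.
  split; first by move=> x _; exact: dF.
  - by apply: cvg_at_right_filter; exact: cFF.
  - by apply: cvg_at_left_filter; exact: cFF.
have cab : {within `[a, b], continuous (F^`()%classic)} by exact: continuous_subspaceT.
by apply: (@continuous_FTC2 R (F^`()%classic) F a b ab cab dFo).
Qed.

Lemma continuous_integrable_itv (f : R -> R) a b : continuous f ->
  leb1.-integrable `[a, b] (EFin \o f).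
Proof.
move=> cf; apply: continuous_compact_integrable; first exact: segment_compact.
exact: continuous_subspaceT.
Qed.

(** The mass of [chi n] tends to 1, and it escapes from [B], the only place where [h] may be far
    from [l]. *)
Lemma approximate_identity (D : set (measurableTypeR R)) (chi : nat -> R -> R) (h : R -> R) (l M : R) :
  measurable D -> measurable_fun D h -> (forall t, D t -> `|h t| <= M) ->
  (forall n, leb1.-integrable D (EFin \o chi n)) ->
  (forall n t, D t -> 0 <= chi n t) ->
  \int[leb1]_(t in D) chi n t @[n --> \oo] --> (1 : R) ->
  (forall e, 0 < e -> exists B : set (measurableTypeR R), [/\ measurable B, B `<=` D,
     forall t, D t -> ~ B t -> `|h t - l| <= e &
     \int[leb1]_(t in B) chi n t @[n --> \oo] --> (0 : R)]) ->
  \int[leb1]_(t in D) (h t * chi n t) @[n --> \oo] --> l.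
Proof.
move=> mD mh hM ichi chi0 c1 cB.
have ihchi n : leb1.-integrable D (EFin \o (fun t => h t * chi n t)).
  have mchi : measurable_fun D (chi n) by case/integrableP: (ichi n) => /measurable_EFinP.
  have iM : leb1.-integrable D (EFin \o (fun t => M * chi n t)).
    exact: integrable_mull.
  apply: (integrable_dom mD _ iM) => [|t Dt]; first exact: measurable_funM.
  by rewrite normrM (ger0_norm (chi0 _ _ Dt)) ler_wpM2r ?chi0 ?hM.
apply/cvgrPdist_le => e e0.
have e4 : 0 < e / 4 by rewrite divr_gt0.
have [B [mB BD hB cB0]] := cB _ e4.
(* [K] bounds both |l| and |h - l|, and the 1 makes it positive. *)
pose K := `|M| + `|l| + 1.
have K0 : 0 < K by rewrite ltr_wpDl ?addr_ge0.
have e4K : 0 < e / (4 * K) by rewrite divr_gt0// mulr_gt0.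
have e4l : 0 < Num.min 1 (e / (4 * K)) by rewrite lt_min ltr01.
have /cvgrPdist_le/(_ _ e4l) n1 := c1.
have /cvgrPdist_le/(_ _ e4K) n2 := cB0.
move: n1 n2; apply: filterS2 => n.
set I1 := \int[leb1]_(t in D) chi n t; set I2 := \int[leb1]_(t in B) chi n t => h1 h2.
have I20 : 0 <= I2 by apply: Rintegral_ge0 => t /BD; exact: chi0.
rewrite sub0r normrN ger0_norm// in h2.
have h1' : `|1 - I1| <= 1 by rewrite (le_trans h1)// ge_min lexx.
have h1'' : `|1 - I1| <= e / (4 * K) by rewrite (le_trans h1)// ge_min lexx orbT.
have I10 : 0 <= I1 by apply: Rintegral_ge0; exact: chi0.
have I12 : I1 <= 2 by move: h1'; rewrite ler_norml => /andP[? ?]; lra.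
have E : \int[leb1]_(t in D) (h t * chi n t) - l * I1 = \int[leb1]_(t in D) ((h t - l) * chi n t).
  rewrite -RintegralZl// -RintegralB//; last first.
    have := integrableZl mD l (ichi n); apply: eq_integrable => // t _; by rewrite /= EFinM.
  by apply: eq_Rintegral => t _; rewrite mulrBl.
have chiB : leb1.-integrable D (EFin \o (fun t => chi n t * \1_B t)).
  have mchi : measurable_fun D (chi n) by case/integrableP: (ichi n) => /measurable_EFinP.
  apply: (le_integrable mD (f := EFin \o (fun t => chi n t * \1_B t)) _ _ (ichi n)).
    by apply/measurable_EFinP; apply: measurable_funM => //; exact: measurable_indic.
  move=> t Dt; rewrite /= lee_fin normrM ler_piMr//.
  by rewrite indicE; case: (_ \in _); rewrite ?normr1 ?normr0.
have IB : \int[leb1]_(t in D) (chi n t * \1_B t) = I2.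
  rewrite /I2 Rintegral_mkcond [RHS]Rintegral_mkcond; apply: eq_Rintegral => t _.
  rewrite !patchE indicE; have [tB|tB] := boolP (t \in B); last by rewrite mulr0; case: ifP.
  by rewrite mulr1 ifT//; rewrite !inE in tB *; exact: BD.
have bnd : `|\int[leb1]_(t in D) ((h t - l) * chi n t)| <= e / 4 * I1 + K * I2.
  have ihl : leb1.-integrable D (EFin \o (fun t => (h t - l) * chi n t)).
    have il : leb1.-integrable D (EFin \o (fun t => l * chi n t)).
      have := integrableZl mD l (ichi n); apply: eq_integrable => // t _; by rewrite /= EFinM.
    have := integrableB mD (ihchi n) il; apply: eq_integrable => // t _.
    by rewrite /= -EFinB mulrBl.
  apply: (le_trans (le_normr_Rintegral mD ihl)).
  have i1 : leb1.-integrable D (EFin \o (fun t => e / 4 * chi n t)).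
    have := integrableZl mD (e / 4) (ichi n); apply: eq_integrable => // t _; by rewrite /= EFinM.
  have i2 : leb1.-integrable D (EFin \o (fun t => K * (chi n t * \1_B t))).
    have := integrableZl mD K chiB; apply: eq_integrable => // t _; by rewrite /= EFinM.
  rewrite /I1 -IB -!RintegralZl// -RintegralD//.
  apply: le_Rintegral => //.
  - have := integrable_norm ihl; exact: eq_integrable.
  - have := integrableD mD i1 i2; exact: eq_integrable.
  move=> t Dt; rewrite normrM (ger0_norm (chi0 n t Dt)) indicE.
  have c0 := chi0 n t Dt.
  have [tB|tB] := pselect (B t).
    rewrite mem_set//= mulr1.
    have : `|h t - l| <= K.
      apply: (le_trans (ler_normB _ _)); rewrite /K -addrA lerD//.
        by apply: le_trans (hM _ Dt) _; exact: ler_norm.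
      by rewrite lerDl.
    have := mulr_ge0 (ltW e4) c0; nra.
  by rewrite memNset//= !mulr0 addr0 ler_wpM2r// hB.
have -> : l - \int[leb1]_(t in D) (h t * chi n t) =
   l * (1 - I1) - \int[leb1]_(t in D) ((h t - l) * chi n t) by rewrite -E; ring.
apply: (le_trans (ler_normB _ _)); rewrite normrM.
(* The error is |l| |1 - I1|, plus e/4 times I1 <= 2, plus K I2: together e/4 + e/2 + e/4. *)
apply: (@le_trans _ _ (K * (e / (4 * K)) + (e / 4 * 2 + K * (e / (4 * K))))).
  apply: lerD; first by apply: ler_pM => //; rewrite /K; have := normr_ge0 M; lra.
  apply: (le_trans bnd); apply: lerD; first by rewrite ler_wpM2l// ltW.
  by rewrite ler_wpM2l// ltW.
have -> : K * (e / (4 * K)) = e / 4 by field; rewrite gt_eqF.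
lra.
Qed.

(* Cutting [[0, T]] into n pieces of equal [m]-increment gives |phi T - phi 0| <= C (m T - m 0)^2 / n. *)
Lemma monotone_telescope (m phi : R -> R) (T C : R) : 0 <= T -> 0 <= C ->
  {within `[0, T], continuous m} ->
  (forall a b, 0 <= a -> a <= b -> b <= T -> m a <= m b) ->
  (forall a b, 0 <= a -> a <= b -> b <= T -> `|phi b - phi a| <= C * (m b - m a) ^+ 2) ->
  phi T = phi 0.
Proof.
move=> T0 C0 cm mm H.
pose M := m T - m 0.
have M0 : 0 <= M by rewrite subr_ge0 mm.
have key n : `|phi T - phi 0| <= C * M ^+ 2 / n.+1%:R.
  have n0 : (0 : R) < n.+1%:R by [].
  pose y k := m 0 + M * (k%:R / n.+1%:R).
  have yM k : (k <= n.+1)%N -> m 0 <= y k <= m T.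
    move=> kn; have k0 : 0 <= (k%:R / n.+1%:R : R) by rewrite divr_ge0.
    have k1 : (k%:R / n.+1%:R : R) <= 1 by rewrite ler_pdivrMr// mul1r ler_nat.
    have h1 : M * (k%:R / n.+1%:R) <= M by exact: ler_piMr.
    by rewrite /y lerDl mulr_ge0//= -lerBrDl.
  (* Points where [m] takes the equally spaced values, from the intermediate value theorem; 0 is a
     dummy beyond k = n + 1. *)
  have /choice[t tP] k : exists c, (k <= n.+1)%N -> 0 <= c <= T /\ m c = y k.
    have [kn|] := leqP k n.+1; last by exists 0.
    have [c cT mc] : exists2 c, c \in `[0, T] & m c = y k.
      apply: IVT => //; have /andP[h1 h2] := yM _ kn.
      by rewrite ge_min h1 le_max h2 orbT.
    by exists c => _; rewrite in_itv in cT.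
  have st k : (k < n.+1)%N -> `|phi (t k.+1) - phi (t k)| <= C * (M / n.+1%:R) ^+ 2.
    move=> kn; have [/andP[a0 aT] ma] := tP k (ltnW kn).
    have [/andP[b0 bT] mb] := tP k.+1 kn.
    have yy : y k.+1 - y k = M / n.+1%:R by rewrite /y -addn1 natrD; ring.
    (* Nothing orders two consecutive points a priori; if they are reversed, monotonicity of [m]
       forces the common increment M / (n + 1) to be 0. *)
    have [tt|tt] := leP (t k) (t k.+1).
      by have := H _ _ a0 tt bT; rewrite ma mb yy.
    have my : m (t k.+1) <= m (t k) by exact: mm (ltW tt) _.
    have Mn : 0 <= M / n.+1%:R by rewrite divr_ge0.
    have e0 : M / n.+1%:R = 0 by apply/eqP; rewrite eq_le Mn -yy -ma -mb subr_le0 my.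
    have := H _ _ b0 (ltW tt) aT; rewrite distrC ma mb -[X in X ^+ 2]opprB yy.
    by rewrite e0 oppr0.
  have te k : (k <= n.+1)%N -> `|phi (t k) - phi (t 0%N)| <= k%:R * (C * (M / n.+1%:R) ^+ 2).
    elim: k => [|k IH] kn; first by rewrite subrr normr0 mul0r.
    apply: le_trans (ler_distD (phi (t k)) _ _) _.
    rewrite -[k.+1%:R]natr1 mulrDl mul1r addrC; apply: lerD; [exact: IH (ltnW kn)|exact: st].
  have p0 : phi (t 0%N) = phi 0.
    have [/andP[a0 aT] ma] := tP 0%N isT.
    have := H _ _ (lexx 0) a0 aT; rewrite ma /y mul0r mulr0 addr0 subrr expr0n mulr0.
    by rewrite normr_le0 subr_eq0 => /eqP.
  have pT : phi (t n.+1) = phi T.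
    have [/andP[a0 aT] ma] := tP n.+1 (leqnn _).
    have := H _ _ a0 aT (lexx T).
    have -> : m (t n.+1) = m T by rewrite ma /y divff ?mulr1 /M; [ring|rewrite gt_eqF].
    by rewrite subrr expr0n mulr0 normr_le0 subr_eq0 => /eqP.
  have := te _ (leqnn n.+1); rewrite p0 pT => h; apply: (le_trans h).
  rewrite le_eqVlt; apply/orP; left; apply/eqP; field.
  by rewrite gt_eqF.
apply/eqP; rewrite -subr_eq0 -normr_le0; apply/ler_addgt0Pr => e e0; rewrite add0r.
have c : C * M ^+ 2 / n.+1%:R @[n --> \oo] --> C * M ^+ 2 * 0 by apply: cvgMr; exact: cvg_harmonic.
rewrite mulr0 in c; have /cvgrPdist_le/(_ _ e0)[n _ /(_ n (leqnn n))] := c.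
rewrite sub0r normrN => h; apply: le_trans (key n) _; exact: le_trans (ler_norm _) h.
Qed.

End interval_integrals.

(** * The du Bois-Reymond lemma on a time interval *)

Section du_bois_reymond.
Context (R : realType).
Local Notation leb1 := (@lebesgue_measure R).
Local Notation "\I[ a , b ] f" := (\int[leb1]_(t in `[a, b]) f t)
  (at level 10, a, b at level 9, f at level 10).

Lemma Rintegral_dominated d (S : measurableType d) (mu : {measure set S -> \bar R})
    (D : set S) (u : nat -> S -> R) (v g : S -> R) : measurable D ->
  (forall n, measurable_fun D (u n)) -> mu.-integrable D (EFin \o g) ->
  (forall n x, D x -> `|u n x| <= g x) ->
  (forall x, D x -> u n x @[n --> \oo] --> v x) ->
  mu.-integrable D (EFin \o v) /\
  \int[mu]_(x in D) u n x @[n --> \oo] --> \int[mu]_(x in D) v x.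
Proof.
move=> mD mu_ ig ug uv.
have mv : measurable_fun D v by exact: measurable_fun_cvg mu_ uv.
have [||||iv _ c] := @dominated_convergence _ _ _ mu D mD
  (fun n => EFin \o u n) (EFin \o v) (EFin \o g) _ _ _ ig _.
- by move=> n; exact/measurable_EFinP.
- exact/measurable_EFinP.
- by apply: aeW => x Dx; apply: cvg_EFin; [exact: nearW|exact: uv].
- by apply: aeW => x n Dx /=; rewrite lee_fin ug.
split => //; apply: fine_cvg; rewrite /Rintegral fineK//; exact: integrable_fin_num.
Qed.

Lemma is_derive_bump (a b k x : R) : is_derive x 1 (bump a b k)
  (flat (k *: 'X^2) (k * (x - a)) * flat 1 (k * (b - x)) +
   flat 1 (k * (x - a)) * flat (- k *: 'X^2) (k * (b - x))).
Proof. by have := is_derive_flat_prod a b k 1 1 x; rewrite derivC subr0 mulr1. Qed.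

Lemma derive1_bump (a b k x : R) : (bump a b k)^`()%classic x =
  flat (k *: 'X^2) (k * (x - a)) * flat 1 (k * (b - x)) +
   flat 1 (k * (x - a)) * flat (- k *: 'X^2) (k * (b - x)).
Proof. by have [_] := is_derive_bump a b k x; rewrite derive1E. Qed.

Lemma derive1_bump_out (a b k x : R) : 0 <= k -> ~ (a < x < b) ->
  (bump a b k)^`()%classic x = 0.
Proof.
move=> k0 /negP; rewrite negb_and -!leNgt derive1_bump => /orP[h|h].
  by rewrite !(flat0 _ (x := k * (x - a))) ?mul0r ?addr0// mulr_ge0_le0// subr_le0.
by rewrite !(flat0 _ (x := k * (b - x))) ?mulr0 ?addr0// mulr_ge0_le0// subr_le0.
Qed.

Lemma derive1_bump_in (a b k x : R) : 0 < k -> a < x < b ->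
  (bump a b k)^`()%classic x =
  k * bump a b k x * ((k * (x - a))^-1 ^+ 2 - (k * (b - x))^-1 ^+ 2).
Proof.
move=> k0 /andP[ax xb]; rewrite derive1_bump /bump !flatZ /flat !mulr_gt0 ?subr_gt0//.
by rewrite -polyC1 !hornerXn !hornerC; ring.
Qed.

(** Inside the interval the sign is that of (x - a)^-2 - (b - x)^-2, which is nonnegative as long as
    [x] is no farther from [a] than from [b]. *)
Lemma derive1_bump_ge0 (a b k x : R) : 0 < k -> x <= (a + b) / 2 ->
  0 <= (bump a b k)^`()%classic x.
Proof.
move=> k0 xm; have [axb|] := boolP (a < x < b); last first.
  by move/negP => h; rewrite derive1_bump_out// ltW.
rewrite derive1_bump_in//; move: axb => /andP[ax xb].
apply: mulr_ge0; first by rewrite mulr_ge0 ?bump_ge0 ?(ltW k0).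
rewrite subr_ge0 lerXn2r ?nnegrE ?invr_ge0 ?mulr_ge0 ?subr_ge0 ?(ltW ax) ?(ltW xb) ?(ltW k0)//.
by rewrite lef_pV2 ?posrE ?mulr_gt0 ?subr_gt0// ler_pM2l//; lra.
Qed.

Lemma derive1_bump_le0 (a b k x : R) : 0 < k -> (a + b) / 2 <= x ->
  (bump a b k)^`()%classic x <= 0.
Proof.
move=> k0 xm; have [axb|] := boolP (a < x < b); last first.
  by move/negP => h; rewrite derive1_bump_out// ltW.
rewrite derive1_bump_in//; move: axb => /andP[ax xb].
apply: mulr_ge0_le0; first by rewrite mulr_ge0 ?bump_ge0 ?(ltW k0).
rewrite subr_le0 lerXn2r ?nnegrE ?invr_ge0 ?mulr_ge0 ?subr_ge0 ?(ltW ax) ?(ltW xb) ?(ltW k0)//.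
by rewrite lef_pV2 ?posrE ?mulr_gt0 ?subr_gt0// ler_pM2l//; lra.
Qed.

Lemma continuous_derive1_bump (a b k : R) : continuous (bump a b k)^`()%classic.
Proof.
by move=> x; apply/differentiable_continuous/derivable1_diffP; exact: (@bump_smooth R a b k 1).
Qed.

Lemma derivable_bump (a b k x : R) : derivable (bump a b k) x 1.
Proof. exact: (@bump_smooth R a b k 0). Qed.

Lemma continuous_bump (a b k : R) : continuous (bump a b k).
Proof. by move=> x; apply/differentiable_continuous/derivable1_diffP/derivable_bump. Qed.

Lemma within_continuous_bounded (a b : R) (h : R -> R) : a <= b ->
  {within `[a, b], continuous h} -> exists M, forall t, `[a, b]%classic t -> `|h t| <= M.
Proof.
move=> ab ch; have [c _ hc] := EVT_max ab ch; have [e _ he] := EVT_min ab ch.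
exists (`|h c| + `|h e|) => t tab.
have h1 := hc _ tab; have h2 := he _ tab.
have := ler_norm (h c); have := ler_norm (- h e); rewrite normrN.
have := normr_ge0 (h c); have := normr_ge0 (h e).
by rewrite ler_norml; lra.
Qed.

Lemma within_continuous_integrable (a b : R) (h : R -> R) :
  {within `[a, b], continuous h} -> leb1.-integrable `[a, b] (EFin \o h).
Proof. by apply: continuous_compact_integrable; exact: segment_compact. Qed.

Lemma within_continuous_sub (a b c e : R) (h : R -> R) : a <= c -> e <= b ->
  {within `[a, b], continuous h} -> {within `[c, e], continuous h}.
Proof.
move=> ac eb; apply: continuous_subspaceW => t /=; rewrite !in_itv/= => /andP[ct te].
by rewrite (le_trans ac ct) (le_trans te eb).
Qed.

Lemma within_continuous_dist (a b : R) (h : R -> R) (t : R) : a <= t <= b ->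
  {within `[a, b], continuous h} -> forall e, 0 < e -> exists2 dl, 0 < dl &
  forall s, a <= s <= b -> `|s - t| < dl -> `|h s - h t| <= e.
Proof.
move=> tab /subspace_continuousP/(_ t) ch e e0.
have /cvgrPdist_le/(_ _ e0) := ch tab.
rewrite near_withinE => /nbhs_ballP[dl /= dl0 H]; exists dl => // s sab st.
by rewrite distrC; apply: H => //; rewrite /ball/= distrC.
Qed.

(** On the left half the derivative of the bump is nonnegative, with mass tending to 1, while its
    mass on [c, m] tends to 0 for a < c <= m: an approximate identity at [a]. *)
Lemma derive1_bump_left (a b : R) (h : R -> R) : a < b ->
  {within `[a, (a + b) / 2], continuous h} ->
  \I[a, (a + b) / 2] (fun t => h t * (bump a b n.+1%:R)^`()%classic t) @[n --> \oo] --> h a.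
Proof.
move=> ab ch; set m := (a + b) / 2.
have am : a < m by rewrite /m; lra.
have mb : m < b by rewrite /m; lra.
have [M hM] := within_continuous_bounded (ltW am) ch.
have bump1 c : a < c < b -> bump a b n.+1%:R c @[n --> \oo] --> (1 : R).
  by move=> acb; have := @bump_cvg R a b c; rewrite indicE mem_set//= in_itv.
have FTC c : c <= m -> (fun n => \I[c, m] ((bump a b n.+1%:R)^`()%classic)) =
    (fun n => bump a b n.+1%:R m - bump a b n.+1%:R c).
  move=> cm; apply/funext => n; apply: Rintegral_derive1 => //.
    by move=> x; exact: derivable_bump.
  exact: continuous_derive1_bump.
have mI c e : measurable (`[c, e]%classic : set (measurableTypeR R)) by exact: measurable_itv.
apply: (@approximate_identity R `[a, m]%classic (fun n => (bump a b n.+1%:R)^`()%classic) h (h a) M).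
- exact: mI.
- exact: integrable_EFin_measurable (within_continuous_integrable ch).
- exact: hM.
- by move=> n; apply: continuous_integrable_itv; exact: continuous_derive1_bump.
- by move=> n t /=; rewrite in_itv/= => /andP[_ tm]; exact: derive1_bump_ge0.
- rewrite (FTC _ (ltW am)) -[X in _ --> X]subr0; apply: cvgB; first by apply: bump1; rewrite am.
  rewrite (_ : (fun n => bump a b n.+1%:R a) = cst 0); first exact: cvg_cst.
  by apply/funext => n; rewrite bump_out// ltxx.
- move=> e e0; have [|dl dl0 H] := within_continuous_dist _ ch e0 (t := a).
    by rewrite lexx ltW.
  pose c := Num.min m (a + dl / 2).
  have ac : a < c by rewrite /c lt_min am/= ltrDl divr_gt0.
  have cm : c <= m by rewrite /c ge_min lexx.
  exists `[c, m]%classic; split.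
  + exact: mI.
  + by move=> t /=; rewrite !in_itv/= => /andP[/(le_trans (ltW ac)) -> ->].
  + move=> t /= ta tc; apply: H => //; move: ta tc; rewrite !in_itv/= => /andP[at_ tm].
    rewrite tm andbT => /negP; rewrite -ltNge /c lt_min => /andP[_ ?].
    rewrite ger0_norm ?subr_ge0//; lra.
  + rewrite (FTC _ cm) -(subrr (1 : R)); apply: cvgB; apply: bump1; first by rewrite am.
    by rewrite ac (le_lt_trans cm).
Qed.

Lemma derive1_bump_right (a b : R) (h : R -> R) : a < b ->
  {within `[(a + b) / 2, b], continuous h} ->
  \I[(a + b) / 2, b] (fun t => h t * (bump a b n.+1%:R)^`()%classic t) @[n --> \oo] --> - h b.
Proof.
move=> ab ch; set m := (a + b) / 2.
have am : a < m by rewrite /m; lra.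
have mb : m < b by rewrite /m; lra.
have [M hM] := within_continuous_bounded (ltW mb) ch.
have bump1 c : a < c < b -> bump a b n.+1%:R c @[n --> \oo] --> (1 : R).
  by move=> acb; have := @bump_cvg R a b c; rewrite indicE mem_set//= in_itv.
have cd n : continuous (bump a b n.+1%:R)^`()%classic by exact: continuous_derive1_bump.
have idb n c e : leb1.-integrable `[c, e] (EFin \o (bump a b n.+1%:R)^`()%classic).
  exact: continuous_integrable_itv.
have mI c e : measurable (`[c, e]%classic : set (measurableTypeR R)) by exact: measurable_itv.
have FTC c : m <= c -> (fun n => \I[m, c] (fun t => -1 * (bump a b n.+1%:R)^`()%classic t)) =
    (fun n => bump a b n.+1%:R m - bump a b n.+1%:R c).
  move=> cm; apply/funext => n; rewrite RintegralZl// Rintegral_derive1//.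
    by rewrite mulN1r opprB.
  by move=> x; exact: derivable_bump.
suff H : \I[m, b] (fun t => h t * (-1 * (bump a b n.+1%:R)^`()%classic t)) @[n --> \oo] --> h b.
  have E : (fun n => \I[m, b] (fun t => h t * (bump a b n.+1%:R)^`()%classic t)) =
     (fun n => - \I[m, b] (fun t => h t * (-1 * (bump a b n.+1%:R)^`()%classic t))).
    apply/funext => n; rewrite -[RHS]mulN1r -RintegralZl.
    - by apply: eq_Rintegral => t _; ring.
    - exact: mI.
    - apply: (integrable_bounded_mull (mI m b) _ hM).
        exact: integrable_EFin_measurable (within_continuous_integrable ch).
      by apply: (integrable_mull (-1) (mI m b)); exact: idb.
  by rewrite E; apply: cvgN.
apply: (@approximate_identity R `[m, b]%classic (fun n t => -1 * (bump a b n.+1%:R)^`()%classic t) h (h b) M).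
- exact: mI.
- exact: integrable_EFin_measurable (within_continuous_integrable ch).
- exact: hM.
- by move=> n; apply: integrable_mull; [exact: mI|exact: idb].
- move=> n t /=; rewrite in_itv/= => /andP[tm _].
  by rewrite mulN1r oppr_ge0; exact: derive1_bump_le0.
- rewrite (FTC _ (ltW mb)) -[X in _ --> X]subr0; apply: cvgB; first by apply: bump1; rewrite am.
  rewrite (_ : (fun n => bump a b n.+1%:R b) = cst 0); first exact: cvg_cst.
  by apply/funext => n; rewrite bump_out// ltxx andbF.
- move=> e e0; have [|dl dl0 H] := within_continuous_dist _ ch e0 (t := b).
    by rewrite lexx ltW.
  pose c := Num.max m (b - dl / 2).
  have cb : c < b by rewrite /c gt_max mb/= ltrBlDr ltrDl divr_gt0.
  have cm : m <= c by rewrite /c le_max lexx.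
  exists `[m, c]%classic; split.
  + exact: mI.
  + by move=> t /=; rewrite !in_itv/= => /andP[-> /le_trans]; apply; exact: ltW.
  + move=> t /= ta tc; apply: H => //; move: ta tc; rewrite !in_itv/= => /andP[mt tb].
    rewrite mt/= => /negP; rewrite -ltNge /c gt_max => /andP[_ ?].
    rewrite ler0_norm ?subr_le0//; lra.
  + rewrite (FTC _ cm) -(subrr (1 : R)); apply: cvgB; apply: bump1; first by rewrite am.
    by rewrite cb (lt_le_trans am).
Qed.

(** Bumps on ]a, b[ serve as test functions: the side with the derivative tends to h(a) - h(b), and
    the other one to minus the integral of [k] over ]a, b[. *)
Lemma du_bois_reymond_interior (T a b : R) (h k : R -> R) : 0 < a -> a < b -> b < T ->
  {within `[0, T], continuous h} -> leb1.-integrable `[0, T] (EFin \o k) ->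
  (forall psi, time_test T psi ->
     \I[0, T] (fun t => h t * psi^`()%classic t) = - \I[0, T] (fun t => k t * psi t)) ->
  h b - h a = \I[a, b] k.
Proof.
move=> a0 ab bT ch ik H.
have mI c e : measurable (`[c, e]%classic : set (measurableTypeR R)) by exact: measurable_itv.
have T0 : 0 <= T by apply: ltW; apply: lt_trans bT; exact: lt_trans ab.
set m := (a + b) / 2.
have am : a < m by rewrite /m; lra.
have mb : m < b by rewrite /m; lra.
have tt n : time_test T (bump a b n.+1%:R).
  split; first exact: bump_smooth.
  exists a, b; split => // t nt; apply: bump_out => // /andP[h1 h2]; apply: nt.
  by rewrite !ltW.
have ip n : leb1.-integrable `[0, T] (EFin \o (fun t => h t * (bump a b n.+1%:R)^`()%classic t)).
  have [M hM] := within_continuous_bounded T0 ch.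
  have ib : leb1.-integrable `[0, T] (EFin \o (bump a b n.+1%:R)^`()%classic).
    by apply: continuous_integrable_itv; exact: continuous_derive1_bump.
  apply: (integrable_bounded_mull (mI 0 T) _ hM ib).
  exact: integrable_EFin_measurable (within_continuous_integrable ch).
have z (c e : R) n : e <= a \/ b <= c ->
    \I[c, e] (fun t => h t * (bump a b n.+1%:R)^`()%classic t) = 0.
  move=> ce; rewrite /Rintegral integral0_eq ?fine0// => t.
  rewrite /= in_itv/= => /andP[ct te]; rewrite derive1_bump_out ?mulr0//.
  move=> /andP[h1 h2]; case: ce => h3; first by have := lt_le_trans h1 te; rewrite ltNge h3.
  by have := le_lt_trans ct h2; rewrite ltNge h3.
have E n : \I[0, T] (fun t => h t * (bump a b n.+1%:R)^`()%classic t) =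
   \I[a, m] (fun t => h t * (bump a b n.+1%:R)^`()%classic t) +
   \I[m, b] (fun t => h t * (bump a b n.+1%:R)^`()%classic t).
  rewrite (@Rintegral_itv_split R 0 a T)//; [|exact: ltW|by apply: ltW; exact: lt_trans bT].
  rewrite z; last by left.
  rewrite add0r (@Rintegral_itv_split R a m T)//; [|exact: ltW|by apply: ltW; exact: lt_trans bT|].
    rewrite (@Rintegral_itv_split R m b T)//; [|exact: ltW|exact: ltW|].
      by rewrite [X in _ + (_ + X)]z ?addr0//; right.
    by apply: integrable_sub_itv (ip n) => //; apply: ltW; exact: lt_trans am.
  by apply: integrable_sub_itv (ip n) => //; exact: ltW.
have c1 : \I[0, T] (fun t => h t * (bump a b n.+1%:R)^`()%classic t) @[n --> \oo] --> h a + - h b.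
  rewrite (funext E); apply: cvgD.
    by apply: derive1_bump_left => //; apply: within_continuous_sub ch; rewrite ltW//; exact: lt_trans bT.
  by apply: derive1_bump_right => //; apply: within_continuous_sub ch; rewrite ltW//; exact: lt_trans am.
have ik' : leb1.-integrable `[0, T] (EFin \o (fun t => `|k t|)).
  by have := integrable_norm ik; exact: eq_integrable.
have mkb n : measurable_fun (`[0, T]%classic : set (measurableTypeR R)) (fun t => k t * bump a b n.+1%:R t).
  apply: measurable_funM; first exact: integrable_EFin_measurable ik.
  apply: (@integrable_EFin_measurable _ _ _ leb1).
  by apply: continuous_integrable_itv; exact: continuous_bump.
have [||_ c2] := @Rintegral_dominated _ _ leb1 `[0, T]%classic _
  (fun t => k t * \1_(`]a, b[%classic) t) _ (mI 0 T) mkb ik'.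
- by move=> n t _; rewrite normrM ler_piMr// ger0_norm ?bump_ge0//; exact: bump_le1.
- by move=> t _; apply: cvgM; [exact: cvg_cst|exact: bump_cvg].
have c3 : \I[0, T] (fun t => h t * (bump a b n.+1%:R)^`()%classic t) @[n --> \oo] -->
   - \I[0, T] (fun t => k t * \1_(`]a, b[%classic) t).
  rewrite (_ : (fun n => _) = (fun n => - \I[0, T] (fun t => k t * bump a b n.+1%:R t))).
    exact: cvgN.
  by apply/funext => n; exact: H.
have hab : h a - h b = - \I[0, T] (fun t => k t * \1_(`]a, b[%classic) t).
  by apply: (@cvg_unique _ (@Rhausdorff R) _ _ _ _ c1 c3).
suff hk : \I[0, T] (fun t => k t * \1_(`]a, b[%classic) t) = \I[a, b] k by rewrite -[LHS]opprB hab hk opprK.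
rewrite -Rintegral_itv_obnd_cbnd; last first.
  apply: integrableS ik; [exact: mI|exact: measurable_itv|].
  by move=> t /=; rewrite !in_itv/= => /andP[h1 h2]; rewrite (ltW (lt_trans a0 h1)) (le_trans h2)// ltW.
rewrite -Rintegral_itv_bndo_bndc; last first.
  apply: integrableS ik; [exact: mI|exact: measurable_itv|].
  by move=> t /=; rewrite !in_itv/= => /andP[h1 h2]; rewrite (ltW (lt_trans a0 h1)) ltW// (lt_trans h2).
rewrite Rintegral_mkcond [RHS]Rintegral_mkcond; apply: eq_Rintegral => t _.
rewrite !patchE indicE; have [tB|tB] := boolP (t \in `]a, b[%classic); last by rewrite mulr0; case: ifP.
rewrite mulr1 ifT//; move: tB; rewrite !inE/= !in_itv/= => /andP[h1 h2].
by rewrite (ltW (lt_trans a0 h1)) ltW// (lt_trans h2).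
Qed.

(** By the interior case, [h] minus the primitive of [k] is constant on ]0, T[; continuity carries
    the constant to the endpoints. *)
Lemma du_bois_reymond (T : R) (h k : R -> R) : 0 < T ->
  {within `[0, T], continuous h} -> leb1.-integrable `[0, T] (EFin \o k) ->
  (forall psi, time_test T psi ->
     \I[0, T] (fun t => h t * psi^`()%classic t) = - \I[0, T] (fun t => k t * psi t)) ->
  forall a b, 0 <= a -> a <= b -> b <= T -> h b - h a = \I[a, b] k.
Proof.
move=> T0 ch ik H.
pose m t := \I[0, t] k.
have cm : {within `[0, T], continuous m}.
  exact: parameterized_integral_continuous (ltW T0) ik.
pose g t := h t - m t.
have cg : {within `[0, T], continuous g}.
  by move=> t; apply: cvgB; [exact: ch|exact: cm].
have mE a b : 0 <= a -> a <= b -> b <= T -> m b - m a = \I[a, b] k.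
  move=> a0 ab bT; rewrite /m (@Rintegral_itv_split R 0 a b)//; first by rewrite addrC addKr.
  exact: integrable_sub_itv ik.
have gint a b : 0 < a -> a <= b -> b < T -> g b = g a.
  move=> a0; rewrite le_eqVlt => /predU1P[->//|ab] bT; apply/eqP; rewrite -subr_eq0; apply/eqP.
  have := du_bois_reymond_interior a0 ab bT ch ik H.
  rewrite -(mE a b (ltW a0) (ltW ab) (ltW bT)) /g; lra.
have gc t : 0 <= t <= T -> g t = g (T / 2).
  move=> tT; apply/eqP; rewrite -subr_eq0 -normr_le0; apply/ler_addgt0Pr => e e0; rewrite add0r.
  have [dl dl0 Hd] := within_continuous_dist tT cg e0.
  (* From [t] one moves towards the middle of the interval by at most T/4, which stays inside ]0,
     T[. *)
  have [s [s0 sT] st] : exists2 s, 0 < s /\ s < T & `|s - t| < dl.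
    move: tT => /andP[t0 tT].
    have [tle|tgt] := leP t (T / 2).
      exists (t + Num.min (T / 4) (dl / 2)); last first.
        rewrite addrAC subrr add0r ger0_norm ?le_min ?divr_ge0 ?ltW//.
        by rewrite gt_min; apply/orP; right; lra.
      have h1 : 0 < Num.min (T / 4) (dl / 2) by rewrite lt_min !divr_gt0.
      have h2 : Num.min (T / 4) (dl / 2) <= T / 4 by rewrite ge_min lexx.
      by split; lra.
    exists (t - Num.min (T / 4) (dl / 2)); last first.
      rewrite addrAC subrr add0r normrN ger0_norm ?le_min ?divr_ge0 ?ltW//.
      by rewrite gt_min; apply/orP; right; lra.
    have h1 : 0 < Num.min (T / 4) (dl / 2) by rewrite lt_min !divr_gt0.
    have h2 : Num.min (T / 4) (dl / 2) <= T / 4 by rewrite ge_min lexx.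
    by split; lra.
  have gs : g s = g (T / 2).
    by have [hs|hs] := leP s (T / 2); [apply/esym|]; apply: gint => //; lra.
  by rewrite distrC -gs; apply: Hd => //; rewrite !ltW.
move=> a b a0 ab bT; rewrite -mE//.
have := gc a; have := gc b; rewrite a0 (le_trans a0 ab) bT (le_trans ab bT) /g => /(_ isT) + /(_ isT); lra.
Qed.

End du_bois_reymond.

(** * Absolutely continuous functions with values in L^2 *)

Section L2_valued.
Context (R : realType) (d : nat) (Om : set 'rV[R]_d) (mOm : measurable Om).
Local Notation E := 'rV[R]_d.
Local Notation leb1 := (@lebesgue_measure R).
Local Notation RM := (measurableTypeR R).
Local Notation L2 := (L2 Om).
Local Notation ip := (ip Om).
Local Notation nrm := (nrm Om).

Lemma measurable_segment (a b : R) : measurable (`[a, b]%classic : set RM).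
Proof. exact: measurable_itv. Qed.

(* Unlike in [strongly_measurable], the approximations converge at every time. *)
Definition tmeas (u : R -> E -> R) : Prop := (forall t, L2 (u t)) /\
  exists s : nat -> R -> E -> R, (forall n, bochner_simple L2 (s n)) /\
    forall t, nrm (u t - s n t) @[n --> \oo] --> 0.

Lemma bochner_simple_L2 s : bochner_simple L2 s -> forall t, L2 (s t).
Proof.
by move=> [n [A [c [mA Lc sE]]]] t; rewrite sE; apply: L2_sum => // i _; exact: L2Z.
Qed.

Lemma bochner_simple_ip (D : set RM) s u : measurable D -> bochner_simple L2 s ->
  (forall t, D t -> L2 (u t)) ->
  (forall c, L2 c -> measurable_fun D (fun t => ip c (u t))) ->
  measurable_fun D (fun t => ip (s t) (u t)).
Proof.
move=> mD [n [A [c [mA Lc sE]]]] Lu mu_.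
apply: (@eq_measurable_fun _ _ _ _ D
  (fun t => \sum_(i < n) (\1_(A i) t : R) * ip (c i) (u t))).
  move=> t; rewrite inE => Dt; rewrite sE ip_suml//; last exact: Lu.
    by apply: eq_bigr => i _; rewrite ipZl//; exact: Lu.
  by move=> i; exact: L2Z.
apply: measurable_sum => i; apply: measurable_funM; last exact: mu_.
have mAi : measurable (A i : set RM) by exact: mA.
exact: measurable_indic.
Qed.

Lemma cvg_ipl (a : nat -> E -> R) (a0 b : E -> R) : (forall n, L2 (a n)) -> L2 a0 -> L2 b ->
  nrm (a0 - a n) @[n --> \oo] --> 0 -> ip (a n) b @[n --> \oo] --> ip a0 b.
Proof.
move=> La L0 Lb c; apply/cvgrPdist_le => e e0.
have c' : nrm (a0 - a n) * nrm b @[n --> \oo] --> 0 * nrm b by apply: cvgM => //; exact: cvg_cst.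
rewrite mul0r in c'; have /cvgrPdist_le/(_ _ e0) := c'; apply: filterS => n.
rewrite sub0r normrN ger0_norm ?mulr_ge0 ?nrm_ge0//; apply: le_trans.
by rewrite -ipBl//; apply: ip_CS => //; exact: L2B.
Qed.

(** Replacing the first argument by its simple approximations reduces measurability to inner
    products with fixed vectors. *)
Lemma tmeas_ip (D : set RM) u' u : measurable D -> tmeas u' ->
  (forall t, D t -> L2 (u t)) ->
  (forall c, L2 c -> measurable_fun D (fun t => ip c (u t))) ->
  measurable_fun D (fun t => ip (u' t) (u t)).
Proof.
move=> mD [Lu' [s [ss sc]]] Lu mu_.
apply: (@measurable_fun_cvg _ _ _ D (fun n t => ip (s n t) (u t))).
  by move=> n; exact: bochner_simple_ip.
move=> t Dt; apply: cvg_ipl => //; last exact: Lu.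
by move=> n; exact: bochner_simple_L2.
Qed.

Lemma tmeas_ipl (D : set RM) u q : measurable D -> tmeas u -> L2 q ->
  measurable_fun D (fun t => ip (u t) q).
Proof. by move=> mD tu Lq; apply: tmeas_ip => // c Lc; exact: measurable_cst. Qed.

Lemma tmeas_nrm (D : set RM) u : measurable D -> tmeas u ->
  measurable_fun D (fun t => nrm (u t)).
Proof.
move=> mD tu; rewrite /Defs.nrm; apply: (@measurableT_comp _ _ _ _ _ _ (@Num.sqrt R)).
  by apply: continuous_measurable_fun; exact: sqrt_continuous.
apply: tmeas_ip => //; first by move=> t _; case: tu.
by move=> c Lc; under eq_fun do rewrite ipC; exact: tmeas_ipl.
Qed.

Lemma bochner_simple_lin (a : R) s r : bochner_simple L2 s -> bochner_simple L2 r ->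
  bochner_simple L2 (fun t => a *: s t + r t).
Proof.
move=> [n [A [c [mA Lc sE]]]] [m [B [e [mB Le rE]]]].
exists (n + m)%N, (fun i : 'I_(n + m) => match fintype.split i with inl j => A j | inr k => B k end),
  (fun i : 'I_(n + m) => match fintype.split i with inl j => a *: c j | inr k => e k end); split.
- by move=> i; case: fintype.split.
- by move=> i; case: fintype.split => j //; exact: L2Z.
move=> t; rewrite sE rE big_split_ord/= scaler_sumr; congr (_ + _).
  by apply: eq_bigr => i _; rewrite (unsplitK (inl i)) !scalerA mulrC.
by apply: eq_bigr => i _; rewrite (unsplitK (inr i)).
Qed.

Lemma L2_lin (a : R) u v : L2 u -> L2 v -> L2 (a *: u + v).
Proof. by move=> Lu Lv; apply: L2D => //; exact: L2Z. Qed.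

Lemma nrm_lin_le (a : R) u v : L2 u -> L2 v -> nrm (a *: u + v) <= `|a| * nrm u + nrm v.
Proof.
move=> Lu Lv; apply: le_trans (nrm_triangle mOm (L2Z mOm a Lu) Lv) _.
by rewrite nrmZ.
Qed.

Lemma tmeas_lin (a : R) u v : tmeas u -> tmeas v -> tmeas (fun t => a *: u t + v t).
Proof.
move=> [Lu [s [ss sc]]] [Lv [r [rs rc]]]; split; first by move=> t; exact: L2_lin.
exists (fun n t => a *: s n t + r n t); split; first by move=> n; exact: bochner_simple_lin.
move=> t; apply: (@cvg0_le _ _ (fun n => `|a| * nrm (u t - s n t) + nrm (v t - r n t))).
  move=> n; rewrite nrm_ge0/= opprD addrACA -scalerBr.
  have Ls := bochner_simple_L2 (ss n) t; have Lr := bochner_simple_L2 (rs n) t.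
  by apply: nrm_lin_le; exact: L2B.
rewrite -[X in _ --> X](addr0 0) -[X in X + _](mulr0 `|a|).
by apply: cvgD => //; apply: cvgM => //; exact: cvg_cst.
Qed.

(** The linear map [L] is a component for velocities and the identity for scalar functions, so one
    statement serves both. The exceptional times are collected in a measurable null set. *)
Lemma bochner_L2_tmeas (V : lmodType R) (D : set V) (N : V -> \bar R) (L : V -> E -> R)
    (T : R) (u : R -> V) :
  (forall a x y, L (a *: x + y) = a *: L x + L y) ->
  (forall v, D v -> L2 (L v)) -> (forall v, (nrm (L v))%:E <= N v)%E ->
  bochner_L2 D N T u ->
  exists u', [/\ tmeas u', leb1.-integrable `[0, T] (EFin \o (fun t => nrm (u' t))) &
    exists M : set RM, [/\ measurable M, leb1 M = 0 &
      forall t, 0 <= t <= T -> ~ M t -> u' t = L (u t) /\ D (u t)]].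
Proof.
move=> linL DL LN [[M1 [mM1 M10 M1P]] [s [ss [M2 [mM2 M20 M2P]]]] uN].
pose L' : {linear V -> (E -> R)} := HB.pack L (GRing.isLinear.Build R V (E -> R) *:%R L linL).
have LL' : L = L' by [].
pose M := M1 `|` M2.
have mM : measurable M by exact: measurableU.
have M0 : leb1 M = 0 by rewrite null_set_setU.
have H t : 0 <= t <= T -> ~ M t -> D (u t) /\ N (u t - s n t) @[n --> \oo] --> 0%E.
  move=> tT nM; split; apply: contrapT => h; apply: nM; [left|right].
    by apply: M1P => /(_ tT).
  by apply: M2P => /(_ tT).
pose A : set RM := `[0, T]%classic `\` M.
have mA : measurable A by apply: measurableD => //; exact: measurable_segment.
have AP t : A t -> 0 <= t <= T /\ ~ M t by rewrite /A /= in_itv.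
(* Zero at exceptional times; cutting the simple approximations off in the same way makes them
   converge at every time. *)
pose u' t := (\1_A t : R) *: L (u t).
have u'A t : A t -> u' t = L (u t) by move=> At; rewrite /u' indicE mem_set// scale1r.
have u'nA t : ~ A t -> u' t = 0 by move=> At; rewrite /u' indicE memNset// scale0r.
have tu' : tmeas u'.
  split.
    move=> t; have [At|At] := pselect (A t); last by rewrite u'nA//; exact: L2_0.
    by rewrite u'A//; apply: DL; have [] := H t (AP t At).1 (AP t At).2.
  exists (fun n t => (\1_A t : R) *: L (s n t)); split.
    move=> n; have [k [B [c [mB Dc sE]]]] := ss n.
    exists k, (fun i => A `&` B i), (fun i => L (c i)); split.
    - by move=> i; exact: measurableI.
    - by move=> i; exact: DL.
    - move=> t; rewrite sE LL' linear_sum scaler_sumr; apply: eq_bigr => i _.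
      have -> : L' ((\1_(B i) t : R) *: c i) = (\1_(B i) t : R) *: L' (c i) by exact: linearZ.
      rewrite scalerA; congr (_ *: _); rewrite !indicE (in_setI t A (B i)).
      by case: (t \in A); rewrite ?mul1r ?mul0r.
  move=> t; have [At|At] := pselect (A t); last first.
    rewrite (_ : (fun n => _) = cst 0); first exact: cvg_cst.
    by apply/funext => n; rewrite u'nA// indicE memNset// scale0r subrr nrm0.
  rewrite (_ : (fun n => _) = (fun n => nrm (L (u t - s n t)))); last first.
    by apply/funext => n; rewrite u'A// indicE mem_set// scale1r LL' linearB.
  have [_ c] := H t (AP t At).1 (AP t At).2.
  suff c' : (nrm (L (u t - s n t)))%:E @[n --> \oo] --> 0%:E by exact: fine_cvg c'.
  apply: (squeeze_cvge _ (cvg_cst 0%E) c).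
  by apply: nearW => n; rewrite lee_fin nrm_ge0 LN.
exists u'; split => //; last first.
  exists M; split => // t tT nM; split; last by have [] := H t tT nM.
  by rewrite u'A//; split => //=; rewrite in_itv.
have mn := tmeas_nrm (measurable_segment 0 T) tu'.
have i2 : leb1.-integrable `[0, T] (EFin \o (fun t => nrm (u' t) ^+ 2)).
  apply/integrableP; split; first by apply/measurable_EFinP; exact: measurable_funX.
  apply: le_lt_trans uN; apply: ge0_le_integral_nonmeas => t tI; first exact: abse_ge0.
  rewrite /= ger0_norm ?sqr_ge0// EFin_expe.
  have [At|At] := pselect (A t); last first.
    by rewrite !expe2 u'nA// nrm0 mul0e; apply: mule_ge0; apply: le_trans (LN _); rewrite lee_fin nrm_ge0.
  rewrite u'A// !expe2; apply: lee_pmul => //; by rewrite lee_fin nrm_ge0.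
(* On a bounded interval x <= 1 + x^2 passes from square integrability to integrability. *)
have i1 : leb1.-integrable `[0, T] (EFin \o (fun=> 1 : R)).
  by apply: continuous_integrable_itv => x; exact: cvg_cst.
apply: (integrable_dom (measurable_segment 0 T) mn (integrable_addr (measurable_segment 0 T) i1 i2)).
move=> t _; rewrite ger0_norm ?nrm_ge0//.
have := sqr_ge0 (nrm (u' t) - 1); have := nrm_ge0 Om (u' t).
move: (nrm (u' t)) => x; nra.
Qed.

(* [u] is the L^2-valued primitive of [u'] on [[0, T]]. *)
Definition AC (T : R) (u u' : R -> E -> R) : Prop :=
  [/\ forall t, 0 <= t <= T -> L2 (u t), tmeas u',
      leb1.-integrable `[0, T] (EFin \o (fun t => nrm (u' t))) &
      forall q a b, L2 q -> 0 <= a -> a <= b -> b <= T ->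
        ip (u b) q - ip (u a) q = \int[leb1]_(t in `[a, b]) ip (u' t) q].

Lemma integrable_ipl (T : R) u' q : tmeas u' ->
  leb1.-integrable `[0, T] (EFin \o (fun t => nrm (u' t))) -> L2 q ->
  leb1.-integrable `[0, T] (EFin \o (fun t => ip (u' t) q)).
Proof.
move=> tu' iu' Lq.
apply: (integrable_dom (measurable_segment 0 T) (tmeas_ipl (measurable_segment 0 T) tu' Lq)
  (integrable_mull (nrm q) (measurable_segment 0 T) iu')) => t _.
by rewrite mulrC; apply: ip_CS => //; case: tu'.
Qed.

Lemma AC_lin (T a : R) u u' v v' : AC T u u' -> AC T v v' ->
  AC T (fun t => a *: u t + v t) (fun t => a *: u' t + v' t).
Proof.
move=> [Lu tu iu Hu] [Lv tv iv Hv]; split.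
- by move=> t tT; apply: L2_lin; [exact: Lu|exact: Lv].
- exact: tmeas_lin.
- apply: (integrable_dom (measurable_segment 0 T) (tmeas_nrm (measurable_segment 0 T) (tmeas_lin a tu tv))
   (integrable_addr (measurable_segment 0 T) (integrable_mull `|a| (measurable_segment 0 T) iu) iv)).
  move=> t _; rewrite ger0_norm ?nrm_ge0//; apply: nrm_lin_le; by [case: tu|case: tv].
- move=> q b c Lq b0 bc cT.
  have bT := le_trans bc cT; have c0 := le_trans b0 bc.
  have E1 : \int[leb1]_(t in `[b, c]) ip (a *: u' t + v' t) q =
     a * (\int[leb1]_(t in `[b, c]) ip (u' t) q) + \int[leb1]_(t in `[b, c]) ip (v' t) q.
    have iq := integrable_sub_itv b0 cT (integrable_ipl tu iu Lq).
    have jq := integrable_sub_itv b0 cT (integrable_ipl tv iv Lq).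
    have mI := measurable_segment b c.
    rewrite -RintegralZl// -RintegralD//; last exact: integrable_mull.
    apply: eq_Rintegral => t _.
    case: tu => Lu' _; case: tv => Lv' _; by rewrite ipDl ?ipZl//; exact: L2Z.
  rewrite E1 -(Hu q b c)// -(Hv q b c)//.
  have Lub : L2 (u b) by apply: Lu; rewrite b0.
  have Luc : L2 (u c) by apply: Lu; rewrite c0.
  have Lvb : L2 (v b) by apply: Lv; rewrite b0.
  have Lvc : L2 (v c) by apply: Lv; rewrite c0.
  rewrite (ipDl mOm (L2Z mOm a Lub) Lvb Lq) (ipDl mOm (L2Z mOm a Luc) Lvc Lq).
  rewrite (ipZl mOm a Lub Lq) (ipZl mOm a Luc Lq).
  by move: (ip (u b) q) (ip (u c) q) (ip (v b) q) (ip (v c) q) => x1 x2 x3 x4; ring.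
Qed.

(** The weak identity is tested with q = u(b) - u(a) itself, and one factor of its norm is divided
    out. *)
Lemma AC_dist (T : R) u u' a b : AC T u u' -> 0 <= a -> a <= b -> b <= T ->
  nrm (u b - u a) <= \int[leb1]_(t in `[a, b]) nrm (u' t).
Proof.
move=> [Lu tu iu Hu] a0 ab bT; have bT' := le_trans ab bT; have b0 := le_trans a0 ab.
have Lub : L2 (u b) by apply: Lu; rewrite b0.
have Lua : L2 (u a) by apply: Lu; rewrite a0.
set q := u b - u a; have Lq : L2 q by exact: L2B.
have mI := measurable_segment a b.
have iq := integrable_sub_itv a0 bT (integrable_ipl tu iu Lq).
have iu' := integrable_sub_itv a0 bT iu.
have E1 : nrm q ^+ 2 = \int[leb1]_(t in `[a, b]) ip (u' t) q.
  by rewrite nrm_sqr -Hu// {1}/q ipBl.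
have E2 : nrm q ^+ 2 <= nrm q * \int[leb1]_(t in `[a, b]) nrm (u' t).
  rewrite E1 -RintegralZl//; apply: le_Rintegral => //; first exact: integrable_mull.
  move=> t _; apply: (le_trans (ler_norm _)); rewrite mulrC; apply: ip_CS => //; by case: tu.
have I0 : 0 <= \int[leb1]_(t in `[a, b]) nrm (u' t) by apply: Rintegral_ge0 => t _; exact: nrm_ge0.
have [q0|q0] := eqVneq (nrm q) 0; first by rewrite q0.
by move: E2; rewrite expr2 ler_pM2l// lt_neqAle eq_sym q0 nrm_ge0.
Qed.

Lemma AC_measurable_ip (T : R) u u' q : 0 <= T -> AC T u u' -> L2 q ->
  measurable_fun (`[0, T]%classic : set RM) (fun t => ip q (u t)).
Proof.
move=> T0 [Lu tu iu Hu] Lq.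
have iq := integrable_ipl tu iu Lq.
apply: (@eq_measurable_fun _ _ _ _ _
  (fun t => ip q (u 0) + parameterized_integral leb1 0 t (fun t => ip (u' t) q))).
  move=> t; rewrite inE/= in_itv/= => /andP[t0 tT].
  by rewrite /parameterized_integral -(Hu q 0 t)// ipC [ip q (u t)]ipC addrC subrK.
apply: measurable_funD; first exact: measurable_cst.
apply: (@integrable_EFin_measurable _ _ _ leb1).
by apply: within_continuous_integrable; exact: parameterized_integral_continuous.
Qed.

Lemma AC_bounded (T : R) u u' : AC T u u' -> exists M, forall t, 0 <= t <= T -> nrm (u t) <= M.
Proof.
move=> ac; have [Lu tu iu Hu] := ac.
exists (\int[leb1]_(t in `[0, T]) nrm (u' t) + nrm (u 0)) => t /andP[t0 tT].
have T0 := le_trans t0 tT.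
have Lt : L2 (u t) by apply: Lu; rewrite t0.
have L0 : L2 (u 0) by apply: Lu; rewrite lexx.
have -> : u t = (u t - u 0) + u 0 by rewrite subrK.
apply: le_trans (nrm_triangle mOm (L2B mOm Lt L0) L0) _; apply: lerD => //.
apply: (le_trans (AC_dist ac (lexx _) t0 tT)).
rewrite (@Rintegral_itv_split R 0 t T)// lerDl.
by apply: Rintegral_ge0 => s _; exact: nrm_ge0.
Qed.

Lemma AC_integrable_ip (T : R) u u' : 0 <= T -> AC T u u' ->
  leb1.-integrable `[0, T] (EFin \o (fun t => ip (u' t) (u t))).
Proof.
move=> T0 ac; have [Lu tu iu Hu] := ac.
have [M hM] := AC_bounded ac.
have mip : measurable_fun (`[0, T]%classic : set RM) (fun t => ip (u' t) (u t)).
  apply: (tmeas_ip (measurable_segment 0 T) tu).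
    by move=> t; rewrite /= in_itv/=; exact: Lu.
  by move=> c Lc; exact: AC_measurable_ip ac Lc.
apply: (integrable_dom (measurable_segment 0 T) mip (integrable_mull M (measurable_segment 0 T) iu)).
move=> t; rewrite /= in_itv/= => tT.
have Lut := Lu _ tT; have Lu't : L2 (u' t) by case: tu.
apply: (le_trans (ip_CS mOm Lu't Lut)); rewrite mulrC ler_wpM2r ?nrm_ge0//; exact: hM.
Qed.

Lemma AC_energy (T : R) u u' : 0 <= T -> AC T u u' ->
  nrm (u T) ^+ 2 - nrm (u 0) ^+ 2 = 2 * \int[leb1]_(t in `[0, T]) ip (u' t) (u t).
Proof.
move=> T0 ac; have [Lu tu iu Hu] := ac.
have iG := AC_integrable_ip T0 ac.
pose m t := \int[leb1]_(s in `[0, t]) nrm (u' s).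
pose Phi t := nrm (u t) ^+ 2 - 2 * \int[leb1]_(s in `[0, t]) ip (u' s) (u s).
have cm : {within `[0, T], continuous m} by exact: parameterized_integral_continuous.
have mE a b : 0 <= a -> a <= b -> b <= T -> m b - m a = \int[leb1]_(t in `[a, b]) nrm (u' t).
  move=> a0 ab bT; rewrite /m (@Rintegral_itv_split R 0 a b)//; first by rewrite addrC addKr.
  exact: integrable_sub_itv iu.
have mm a b : 0 <= a -> a <= b -> b <= T -> m a <= m b.
  by move=> a0 ab bT; rewrite -subr_ge0 mE//; apply: Rintegral_ge0 => t _; exact: nrm_ge0.
have : Phi T = Phi 0.
  apply: (@monotone_telescope R m Phi T 2) => // a b a0 ab bT.
  have aT := le_trans ab bT; have b0 := le_trans a0 ab.
  have Lub : L2 (u b) by apply: Lu; rewrite b0.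
  have Lua : L2 (u a) by apply: Lu; rewrite a0.
  have Ls : L2 (u b + u a) by exact: L2D.
  have mI := measurable_segment a b.
  have iS := integrable_sub_itv a0 bT (integrable_ipl tu iu Ls).
  have iGab := integrable_sub_itv a0 bT iG.
  (* The difference of squares is (u(b) - u(a), u(b) + u(a)), and [AC] applies because the second
     factor does not depend on time. *)
  have E1 : nrm (u b) ^+ 2 - nrm (u a) ^+ 2 = \int[leb1]_(t in `[a, b]) ip (u' t) (u b + u a).
    rewrite -Hu// !nrm_sqr (ipDr mOm Lub Lua Lub) (ipDr mOm Lub Lua Lua) [ip (u a) (u b)]ipC.
    by move: (ip (u b) (u b)) (ip (u b) (u a)) (ip (u a) (u a)) => x y z; ring.
  have E2 : \int[leb1]_(s in `[0, b]) ip (u' s) (u s) - \int[leb1]_(s in `[0, a]) ip (u' s) (u s) =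
     \int[leb1]_(s in `[a, b]) ip (u' s) (u s).
    rewrite (@Rintegral_itv_split R 0 a b)//; first by rewrite addrC addKr.
    exact: integrable_sub_itv iG.
  have E3 : Phi b - Phi a = \int[leb1]_(t in `[a, b]) (ip (u' t) (u b + u a) - 2 * ip (u' t) (u t)).
    rewrite RintegralB//; last exact: integrable_mull.
    rewrite RintegralZl// -E1 -E2 /Phi.
    move: (nrm (u b) ^+ 2) (nrm (u a) ^+ 2) => x y.
    move: (\int[leb1]_(s in `[0, b]) ip (u' s) (u s)) (\int[leb1]_(s in `[0, a]) ip (u' s) (u s)) => z w.
    by ring.
  have iD : leb1.-integrable `[a, b]
     (EFin \o (fun t => ip (u' t) (u b + u a) - 2 * ip (u' t) (u t))).
    by apply: integrable_subr => //; exact: integrable_mull.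
  have iu' := integrable_sub_itv a0 bT iu.
  rewrite E3; apply: (le_trans (le_normr_Rintegral mI iD)).
  have -> : 2 * (m b - m a) ^+ 2 = \int[leb1]_(t in `[a, b]) (2 * (m b - m a) * nrm (u' t)).
    by rewrite RintegralZl// -mE//; ring.
  apply: le_Rintegral => //.
  - by have := integrable_norm iD; exact: eq_integrable.
  - exact: integrable_mull.
  move=> t; rewrite /= in_itv/= => /andP[at_ tb].
  have t0 := le_trans a0 at_; have tT := le_trans tb bT.
  have Lt : L2 (u t) by apply: Lu; rewrite t0.
  have Lu't : L2 (u' t) by case: tu.
  have Lbt := L2B mOm Lub Lt; have Lta := L2B mOm Lt Lua.
  (* Both differences have norm at most m(b) - m(a), and integrating |u'| supplies the second such
     factor of the quadratic bound. *)
  have -> : ip (u' t) (u b + u a) - 2 * ip (u' t) (u t) = ip (u' t) (u b - u t) - ip (u' t) (u t - u a).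
    rewrite (ipDr mOm Lub Lua Lu't) (ipBr mOm Lub Lt Lu't) (ipBr mOm Lt Lua Lu't).
    by move: (ip (u' t) (u b)) (ip (u' t) (u a)) (ip (u' t) (u t)) => x y z; ring.
  apply: (le_trans (ler_normB _ _)).
  have h1 : nrm (u b - u t) <= m b - m a.
    apply: (le_trans (AC_dist ac t0 tb bT)); rewrite -mE//.
    by rewrite lerD2l lerN2; exact: mm.
  have h2 : nrm (u t - u a) <= m b - m a.
    apply: (le_trans (AC_dist ac a0 at_ tT)); rewrite -mE//.
    by rewrite lerD2r; exact: mm.
  have h3 := ip_CS mOm Lu't Lbt; have h4 := ip_CS mOm Lu't Lta.
  have n0 := nrm_ge0 Om (u' t).
  have h5 := ler_wpM2l n0 h1; have h6 := ler_wpM2l n0 h2.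
  have -> : 2 * (m b - m a) * nrm (u' t) = nrm (u' t) * (m b - m a) + nrm (u' t) * (m b - m a).
    by move: (nrm (u' t)) (m b - m a) => x y; ring.
  apply: lerD; [exact: le_trans h3 h5|exact: le_trans h4 h6].
rewrite /Phi Rintegral_itv1 mulr0 subr0.
move: (nrm (u T) ^+ 2) (nrm (u 0) ^+ 2) (\int[leb1]_(s in `[0, T]) ip (u' s) (u s)) => x y z h.
by rewrite -h; ring.
Qed.

Lemma L2_continuous_ip (T : R) u q : L2_continuous Om T u -> L2 q ->
  {within `[0, T], continuous (fun t => ip (u t) q)}.
Proof.
move=> cu Lq; apply/subspace_continuousP => t tT.
have [Lt ct] := cu t tT.
have ct' : nrm (u s - u t) * nrm q @[s --> within `[0, T] (nbhs t)] --> 0 * nrm q.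
  by apply: cvgM => //; exact: cvg_cst.
rewrite mul0r in ct'; apply/cvgrPdist_le => e e0.
have /cvgrPdist_le/(_ _ e0) := ct'; rewrite !near_withinE; apply: filterS => s + sT => /(_ sT).
have [Ls _] := cu s sT.
rewrite sub0r normrN ger0_norm ?mulr_ge0 ?nrm_ge0//; apply: le_trans.
by rewrite distrC -ipBl//; apply: ip_CS => //; exact: L2B.
Qed.

(** For each fixed [q] the scalar function (u(t), q) is continuous and falls under the du
    Bois-Reymond lemma. *)
Lemma time_derivative_AC (T : R) u ut u' (M : set RM) : 0 < T ->
  is_time_derivative Om T u ut -> L2_continuous Om T u -> tmeas u' ->
  leb1.-integrable `[0, T] (EFin \o (fun t => nrm (u' t))) ->
  measurable M -> leb1 M = 0 -> (forall t, 0 <= t <= T -> ~ M t -> u' t = ut t) ->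
  AC T u u'.
Proof.
move=> T0 du cu tu' iu' mM M0 u'E; split => //; first by move=> t /cu[].
move=> q a b Lq a0 ab bT.
apply: (@du_bois_reymond R T (fun t => ip (u t) q)) => //.
- exact: L2_continuous_ip.
- exact: integrable_ipl.
move=> psi tpsi; rewrite (du q psi Lq tpsi); apply: (congr1 -%R).
apply: (ae_eq_Rintegral_nonmeas (measurable_segment 0 T) mM M0) => t.
by rewrite /= in_itv/= => tT nM; rewrite u'E.
Qed.

End L2_valued.

(** * Adding an integrable function below a nonmeasurable integrand *)

Section integral_lemmas.
Context d (S : measurableType d) (R : realType) (mu : {measure set S -> \bar R}).

(** Additivity is applied only after [h] has been replaced by a simple function [s] below it; the
    finite integral of [g] is first moved to the right, which exposes the supremum over [s]. *)
Lemma nonmeas_integral_add_le (D N : set S) (h k : S -> \bar R) (g : S -> R) :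
  measurable D -> (mu D < +oo)%E -> measurable N -> mu N = 0 ->
  (forall x, D x -> 0 <= h x)%E -> (forall x, D x -> 0 <= k x)%E ->
  mu.-integrable D (EFin \o g) ->
  (forall x, D x -> ~ N x -> h x + (g x)%:E <= k x)%E ->
  (\int[mu]_(x in D) h x + (\int[mu]_(x in D) g x)%R%:E <= \int[mu]_(x in D) k x)%E.
Proof.
move=> mD Doo mN N0 h0 k0 ig hgk.
rewrite -leeBrDr// [leLHS]ge0_integralE//; apply: ge_ereal_sup => _ [s hs <-].
have -> : sintegral mu s = (\int[mu]_(x in D) (s x)%:E)%E.
  rewrite integral_nnsfun//; congr sintegral; apply/funext => x.
  rewrite patchE; case: ifPn => //; rewrite notin_setE => nD.
  have := hs x; rewrite patchE memNset//.
  by rewrite lee_fin => s0; apply/eqP; rewrite eq_le s0 fun_ge0.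
have ms : measurable_fun D s by exact: measurable_funTS.
have is_ : mu.-integrable D (EFin \o s).
  apply: measurable_bounded_integrable => //.
  have := simple_bounded s; apply: filterS => M HM x _; exact: HM.
rewrite leeBrDr//.
have sE : (\int[mu]_(x in D) (s x)%:E = (\int[mu]_(x in D) s x)%R%:E)%E.
  by rewrite /Rintegral fineK//; exact: integrable_fin_num.
rewrite sE -EFinD -RintegralD//.
have isg := integrable_addr mD is_ ig.
(* The comparison without measurability asks for nonnegative functions; the positive part of s + g
   is still below [k], because k >= 0. *)
have mM : measurable_fun D (fun x => Num.max (s x + g x) 0).
  apply: measurable_maxr; last exact: measurable_cst.
  exact: integrable_EFin_measurable isg.
apply: (@le_trans _ _ (\int[mu]_(x in D) (Num.max (s x + g x) 0)%:E)%E).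
  rewrite /Rintegral fineK; last exact: integrable_fin_num.
  apply: le_integral => //.
    apply: (integrable_dom mD mM (g := fun x => `|s x + g x|)).
      by have := integrable_norm isg; exact: eq_integrable.
    move=> x _; rewrite ger0_norm ?le_max ?lexx ?orbT// ge_max normr_ge0 andbT; exact: ler_norm.
  by move=> x _; rewrite lee_fin le_max lexx.
apply: (ae_ge0_le_integral_nonmeas mD mN N0) => // x Dx.
  by rewrite lee_fin le_max lexx orbT.
move=> nN; have [sg|sg] := leP 0 (s x + g x); last by exact: k0.
apply: le_trans (hgk _ Dx nN); rewrite EFinD leeD2r//.
by have := hs x; rewrite patchE mem_set.
Qed.

Lemma Rintegral_sum (D : set S) (I : Type) (r : seq I) (F : I -> S -> R) : measurable D ->
  (forall i, mu.-integrable D (EFin \o F i)) ->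
  mu.-integrable D (EFin \o (fun x => \sum_(i <- r) F i x)) /\
  \int[mu]_(x in D) (\sum_(i <- r) F i x) = \sum_(i <- r) \int[mu]_(x in D) F i x.
Proof.
move=> mD iF; elim: r => [|i r [IH1 IH2]].
  have E : (fun x => \sum_(i <- [::]) F i x) = cst 0 by apply/funext => x; rewrite big_nil.
  rewrite big_nil E; split.
    by have := integrable0 mu D; apply: eq_integrable.
  by rewrite /Rintegral integral0_eq ?fine0.
have E : (fun x => \sum_(j <- i :: r) F j x) = (fun x => F i x + \sum_(j <- r) F j x).
  by apply/funext => x; rewrite big_cons.
rewrite E big_cons -IH2; split; first exact: integrable_addr.
by rewrite RintegralD.
Qed.

End integral_lemmas.

(** * The weak divergence as a function of time *)

Section weak_divergence_in_time.
Context (R : realType) (d : nat) (Om : set 'rV[R]_d) (oOm : open Om) (bOm : bounded_set Om).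
Local Notation E := 'rV[R]_d.
Local Notation leb1 := (@lebesgue_measure R).
Local Notation RM := (measurableTypeR R).
Local Notation L2 := (L2 Om).
Local Notation ip := (ip Om).
Local Notation nrm := (nrm Om).
Local Notation wdiv := (wdiv Om).
Let mOm : measurable Om := open_measurable_rV oOm.
Let fOm : (leb R d Om < +oo)%E := bounded_leb_lty oOm bOm.

(** Duality on a dense set: [g] is approximated by a test function and tested against it. *)
Lemma nrm_le_dual g dl : L2 g -> 0 <= dl ->
  (forall phi, Ccinfty Om phi -> ip g phi <= dl * nrm phi) -> nrm g <= dl.
Proof.
move=> Lg dl0 H; have [g0|g0] := eqVneq (nrm g) 0; first by rewrite g0.
have gp : 0 < nrm g by rewrite lt_neqAle eq_sym g0 nrm_ge0.
apply/ler_addgt0Pr => e e0.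
(* The estimate reads |g|^2 <= dl |g| + (|g| + dl) |g - phi|; this accuracy makes the last term at
   most |g| e. *)
pose e' := nrm g * e / (nrm g + dl).
have e'0 : 0 < e' by rewrite divr_gt0 ?mulr_gt0// ltr_wpDr.
have [phi Cphi hphi] := Ccinfty_dense mOm oOm fOm Lg e'0.
have Lphi := Ccinfty_L2 mOm Cphi.
have Ld := L2B mOm Lg Lphi.
have h1 := H _ Cphi.
have h2 : nrm phi <= nrm g + nrm (g - phi).
  have := nrm_triangle mOm Lg (L2N mOm Ld).
  by rewrite subKr nrmN.
have h3 : ip g g = ip g phi + ip g (g - phi) by rewrite ipBr// addrC subrK.
have h4 := le_trans (ler_norm _) (ip_CS mOm Lg Ld).
have h5 := nrm_ge0 Om (g - phi).
have h6 : e' * (nrm g + dl) = nrm g * e by rewrite /e' mulfVK// gt_eqF// ltr_wpDr.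
rewrite -(ler_pM2l gp) -expr2 nrm_sqr h3.
move: h1 h2 h4 h5 h6 hphi.
move: (ip g phi) (ip g (g - phi)) (nrm phi) (nrm g) (nrm (g - phi)) gp => x y n m k m0 h1 h2 h4 h5 h6 h7.
nra.
Qed.

Lemma dense_conull (T : R) (M : set RM) t dl : measurable M -> leb1 M = 0 -> 0 < T ->
  0 <= t <= T -> 0 < dl -> exists s, [/\ 0 <= s <= T, ~ M s & `|s - t| < dl].
Proof.
move=> mM M0 T0 /andP[t0 tT] dl0.
pose a := Num.max 0 (t - dl); pose b := Num.min T (t + dl).
have ab : a < b by rewrite /a /b gt_max !lt_min T0/=; apply/and3P; split; lra.
have [|] := pselect (`]a, b[%classic `<=` M); last first.
  move=> /existsNP[s /not_implyP[]]; rewrite /= in_itv/= /a /b gt_max lt_min.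
  move=> /andP[/andP[s0 s1] /andP[s2 s3]] nM; exists s; split => //.
    by rewrite !ltW.
  by rewrite ltr_distl s3 andbT ltrBlDr; lra.
move=> sub; have : (leb1 `]a, b[%classic <= leb1 M)%E.
  by apply: le_measure => //; rewrite inE//; exact: measurable_itv.
rewrite M0 lebesgue_measure_itv/= lte_fin ab -EFinB lee_fin; lra.
Qed.

Lemma AC_dist_primitive (T : R) u u' s t : AC Om T u u' -> 0 <= s <= T -> 0 <= t <= T ->
  nrm (u s - u t) <=
  `|\int[leb1]_(r in `[0, s]) nrm (u' r) - \int[leb1]_(r in `[0, t]) nrm (u' r)|.
Proof.
move=> ac; have [Lu tu iu _] := ac.
have key s' t' : 0 <= s' <= T -> 0 <= t' <= T -> s' <= t' ->
    nrm (u t' - u s') <=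
    `|\int[leb1]_(r in `[0, t']) nrm (u' r) - \int[leb1]_(r in `[0, s']) nrm (u' r)|.
  move=> /andP[s0 sT] /andP[t0 tT] st; apply: le_trans (ler_norm _).
  apply: le_trans (AC_dist mOm ac s0 st tT) _.
  rewrite (@Rintegral_itv_split R 0 s' t' (fun r => nrm (u' r)) s0 st); first by rewrite addrC addKr.
  exact: integrable_sub_itv iu.
move=> sT tT; have [st|/ltW ts] := leP s t; last exact: key.
by rewrite distrC (nrm_distC mOm (Lu _ sT) (Lu _ tT)); exact: key.
Qed.

(* [Hdiv (w t)] at a time t is obtained from good times t_n tending to t, along which the divergences form a Cauchy sequence. *)
Lemma AC_wdiv (T : R) (w : R -> 'I_d -> E -> R) (w' : 'I_d -> R -> E -> R) v' (M : set RM) :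
  0 < T -> (forall i, AC Om T (w ^~ i) (w' i)) -> tmeas Om v' ->
  leb1.-integrable `[0, T] (EFin \o (fun t => nrm (v' t))) ->
  measurable M -> leb1 M = 0 ->
  (forall t, 0 <= t <= T -> ~ M t -> Hdiv Om (w t) /\ is_wdiv Om (w' ^~ t) (v' t)) ->
  (forall t, 0 <= t <= T -> Hdiv Om (w t)) /\ AC Om T (fun t => wdiv (w t)) v'.
Proof.
move=> T0 acw tv iv mM M0 good.
have mI (a b : R) := measurable_segment a b.
(* The time increment of the distributional divergence, valid at all times: no divergence of w(a) or
   w(b) is presupposed. *)
have star phi a b : Ccinfty Om phi -> 0 <= a -> a <= b -> b <= T ->
    \sum_i ip (w b i) (pderiv [:: i] phi) - \sum_i ip (w a i) (pderiv [:: i] phi) =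
    - \int[leb1]_(t in `[a, b]) ip (v' t) phi.
  move=> Cphi a0 ab bT.
  have LD i : L2 (pderiv [:: i] phi) by exact: Ccinfty_L2 (Ccinfty_pderiv _ Cphi).
  have iD i : leb1.-integrable `[a, b] (EFin \o (fun t => ip (w' i t) (pderiv [:: i] phi))).
    have [_ tw iw _] := acw i.
    exact: integrable_sub_itv a0 bT (integrable_ipl mOm tw iw (LD i)).
  have [_ Isum] := Rintegral_sum (index_enum 'I_d) (mI a b) iD.
  rewrite -sumrB.
  transitivity (\sum_i \int[leb1]_(t in `[a, b]) ip (w' i t) (pderiv [:: i] phi)).
    by apply: eq_bigr => i _; have [_ _ _ Hw] := acw i; exact: Hw.
  rewrite -Isum.
  have iphi := integrable_sub_itv a0 bT (integrable_ipl mOm tv iv (Ccinfty_L2 mOm Cphi)).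
  rewrite -mulN1r -RintegralZl//.
  apply: (ae_eq_Rintegral_nonmeas (mI a b) mM M0) => t.
  rewrite /= in_itv/= => /andP[at_ tb] nM.
  have tT : 0 <= t <= T by rewrite (le_trans a0 at_) (le_trans tb bT).
  by have [_ ->] := good t tT nM; rewrite // mulN1r.
pose m t := \int[leb1]_(r in `[0, t]) nrm (v' r).
have mE a b : 0 <= a -> a <= b -> b <= T -> m b - m a = \int[leb1]_(t in `[a, b]) nrm (v' t).
  move=> a0 ab bT.
  have im := integrable_sub_itv (lexx 0) bT iv.
  by rewrite /m (Rintegral_itv_split a0 ab im) addrC addKr.
have ipv a b phi : 0 <= a -> a <= b -> b <= T -> L2 phi ->
    `|\int[leb1]_(t in `[a, b]) ip (v' t) phi| <= (m b - m a) * nrm phi.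
  move=> a0 ab bT Lphi.
  have iphi := integrable_sub_itv a0 bT (integrable_ipl mOm tv iv Lphi).
  have ivab := integrable_sub_itv a0 bT iv.
  apply: (le_trans (le_normr_Rintegral (mI a b) iphi)).
  rewrite (mE a b a0 ab bT) mulrC -(RintegralZl (nrm phi) (mI a b) ivab).
  apply: (le_Rintegral (mI a b)).
  - by have := integrable_norm iphi; exact: eq_integrable.
  - exact: integrable_mull.
  - by move=> t _; rewrite mulrC; apply: ip_CS => //; case: tv.
have pair phi a b : 0 <= a -> a <= b -> b <= T -> Hdiv Om (w a) -> Hdiv Om (w b) ->
    Ccinfty Om phi -> ip (wdiv (w b) - wdiv (w a)) phi = \int[leb1]_(t in `[a, b]) ip (v' t) phi.
  move=> a0 ab bT Ha Hb Cphi.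
  have [La Da] := Hdiv_wdiv Ha; have [Lb Db] := Hdiv_wdiv Hb.
  have := star _ _ _ Cphi a0 ab bT; rewrite Da// Db// (ipBl mOm Lb La (Ccinfty_L2 mOm Cphi)).
  move: (ip _ phi) (ip _ phi) (\int[_]_(_ in _) _) => x y z; lra.
have m_ge a b : 0 <= a -> a <= b -> b <= T -> 0 <= m b - m a.
  by move=> a0 ab bT; rewrite mE//; apply: Rintegral_ge0 => t _; exact: nrm_ge0.
have dist a b : 0 <= a -> a <= b -> b <= T -> Hdiv Om (w a) -> Hdiv Om (w b) ->
    nrm (wdiv (w b) - wdiv (w a)) <= m b - m a.
  move=> a0 ab bT Ha Hb.
  have [La Da] := Hdiv_wdiv Ha; have [Lb Db] := Hdiv_wdiv Hb.
  apply: nrm_le_dual; [exact: L2B|exact: m_ge|] => phi Cphi.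
  rewrite pair//; apply: (le_trans (ler_norm _)); apply: ipv => //; exact: Ccinfty_L2 Cphi.
pose mw i t := \int[leb1]_(r in `[0, t]) nrm (w' i r).
(* One continuous function whose increments control those of the divergence and of all velocity
   components at once. *)
pose H t := m t + \sum_i mw i t.
have cH : {within `[0, T], continuous H}.
  move=> t; apply: cvgD; first by exact: (parameterized_integral_continuous (ltW T0) iv).
  elim: (index_enum _) => [|i r IH].
    rewrite big_nil (_ : (fun x => _) = cst 0); first exact: cvg_cst.
    by apply/funext => x; rewrite big_nil.
  rewrite big_cons (_ : (fun x => _) = (fun x => mw i x + \sum_(j <- r) mw j x)); last first.
    by apply/funext => x; rewrite big_cons.
  have [_ tw iw _] := acw i; apply: cvgD; last exact: IH.
  exact: (parameterized_integral_continuous (ltW T0) iw).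
have mono (k : R -> R) a b : (forall r, 0 <= k r) -> leb1.-integrable `[0, T] (EFin \o k) ->
    0 <= a -> a <= b -> b <= T ->
    \int[leb1]_(r in `[0, a]) k r <= \int[leb1]_(r in `[0, b]) k r.
  move=> k0 ik a0 ab bT.
  rewrite (Rintegral_itv_split a0 ab (integrable_sub_itv (lexx 0) bT ik)) lerDl.
  by apply: Rintegral_ge0 => r _.
have mwmono i a b : 0 <= a -> a <= b -> b <= T -> mw i a <= mw i b.
  by have [_ _ iw _] := acw i; apply: mono => // r; exact: nrm_ge0.
have Hm a b : 0 <= a -> a <= b -> b <= T -> m b - m a <= `|H b - H a| /\
    forall i, mw i b - mw i a <= `|H b - H a|.
  move=> a0 ab bT.
  have hm := m_ge a b a0 ab bT.
  have hs : 0 <= \sum_i mw i b - \sum_i mw i a.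
    by rewrite -sumrB; apply: sumr_ge0 => i _; rewrite subr_ge0; exact: mwmono.
  have HE : H b - H a = (m b - m a) + (\sum_i mw i b - \sum_i mw i a).
    by rewrite /H opprD addrACA.
  rewrite HE ger0_norm; last by rewrite addr_ge0.
  split; first by rewrite lerDl.
  move=> i; apply: ler_wpDl => //; rewrite -sumrB (bigD1 i)//= lerDl.
  by apply: sumr_ge0 => j _; rewrite subr_ge0; exact: mwmono.
have Hdist s t : 0 <= s <= T -> 0 <= t <= T -> (forall i, nrm (w s i - w t i) <= `|H s - H t|) /\
    (Hdiv Om (w s) -> Hdiv Om (w t) -> nrm (wdiv (w s) - wdiv (w t)) <= `|H s - H t|).
  move=> sT tT; move: (sT) (tT) => /andP[s0 s1] /andP[t0 t1].
  have [st|/ltW ts] := leP s t.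
    have [h1 h2] := Hm s t s0 st t1; split.
      move=> i; apply: (le_trans (AC_dist_primitive (acw i) sT tT)).
      by rewrite distrC [X in _ <= X]distrC ger0_norm ?subr_ge0; [exact: h2|exact: mwmono].
    move=> Hs Ht; have [Ls _] := Hdiv_wdiv Hs; have [Lt _] := Hdiv_wdiv Ht.
    by rewrite (nrm_distC mOm Ls Lt) distrC; apply: le_trans h1; exact: dist.
  have [h1 h2] := Hm t s t0 ts s1; split.
    move=> i; apply: (le_trans (AC_dist_primitive (acw i) sT tT)).
    by rewrite ger0_norm ?subr_ge0; [exact: h2|exact: mwmono].
  by move=> Hs Ht; apply: le_trans h1; exact: dist.
have allH t : 0 <= t <= T -> Hdiv Om (w t).
  move=> tT.
  (* Half of 2^-n at each time: two consecutive divergences then differ by at most 2^-n, the rate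
     that [L2_complete] asks for. *)
  have /choice[tn tnP] (n : nat) : exists s, [/\ 0 <= s <= T, ~ M s & `|H s - H t| <= 2^-1 ^+ n / 2].
    have e0 : 0 < (2^-1 : R) ^+ n / 2 by rewrite divr_gt0// exprn_gt0// invr_gt0.
    have [dl dl0 Hd] := within_continuous_dist tT cH e0.
    have [s [sT nM sd]] := dense_conull mM M0 T0 tT dl0.
    by exists s; split => //; exact: Hd.
  have Hn n : Hdiv Om (w (tn n)) by have [sT nM _] := tnP n; have [] := good _ sT nM.
  have Hcvg : `|H (tn n) - H t| @[n --> \oo] --> 0.
    apply: (@cvg0_le _ _ (fun n => 2^-1 ^+ n / 2)).
      by move=> n; rewrite normr_ge0; have [_ _ ->] := tnP n.
    rewrite -[X in _ --> X](mul0r (2^-1)); apply: cvgM; last exact: cvg_cst.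
    by apply: cvg_expr; rewrite ger0_norm ?invr_ge0// invf_lt1 ?ltr1n.
  have [||g Lg gc] := L2_complete mOm (u := fun n => wdiv (w (tn n))).
  - by move=> n; have [] := Hdiv_wdiv (Hn n).
  - move=> n; have [sT _ h1] := tnP n; have [sT' _ h2] := tnP n.+1.
    have [_ /(_ (Hn _) (Hn _)) h3] := Hdist _ _ sT' sT.
    apply: (le_trans h3).
    apply: (le_trans (ler_distD (H t) _ _)); rewrite [X in _ + X]distrC.
    have p0 : 0 < (2^-1 : R) ^+ n by rewrite exprn_gt0// invr_gt0.
    apply: (le_trans (lerD h2 h1)); rewrite exprS.
    by move: p0; move: (_ ^+ n) => x x0; lra.
  split; first by move=> i; have [Lw _ _ _] := acw i; exact: Lw.
  exists g; split => // phi Cphi.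
  have Lphi := Ccinfty_L2 mOm Cphi.
  have c1 : \sum_i ip (w (tn n) i) (pderiv [:: i] phi) @[n --> \oo] -->
      \sum_i ip (w t i) (pderiv [:: i] phi).
    apply: cvgn_sum => i; have [Lw _ _ _] := acw i.
    apply: (cvg_ipl mOm) => //.
    - by move=> n; have [sT _ _] := tnP n; exact: Lw.
    - exact: Lw.
    - exact: Ccinfty_L2 (Ccinfty_pderiv _ Cphi).
    - apply: (cvg0_le _ Hcvg) => n; have [sT _ _] := tnP n.
      have [h _] := Hdist _ _ sT tT; rewrite nrm_ge0/=.
      by rewrite (nrm_distC mOm (Lw _ tT) (Lw _ sT)); exact: h.
  have c2 : - ip (wdiv (w (tn n))) phi @[n --> \oo] --> - ip g phi.
    apply: cvgN; apply: (cvg_ipl mOm) => // n; by have [] := Hdiv_wdiv (Hn n).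
  have Es : (fun n => \sum_i ip (w (tn n) i) (pderiv [:: i] phi)) =
      (fun n => - ip (wdiv (w (tn n))) phi).
    by apply/funext => n; have [_ ->] := Hdiv_wdiv (Hn n).
  rewrite Es in c1; exact: (cvg_unique (@Rhausdorff R) c1 c2).
split => //; split => //; first by move=> t /allH /Hdiv_wdiv[].
move=> q a b Lq a0 ab bT.
have aT : 0 <= a <= T by rewrite a0 (le_trans ab bT).
have bT' : 0 <= b <= T by rewrite bT (le_trans a0 ab).
have Ha := allH _ aT; have Hb := allH _ bT'.
have [La _] := Hdiv_wdiv Ha; have [Lb _] := Hdiv_wdiv Hb.
rewrite -(ipBl mOm Lb La Lq); have := L2B mOm Lb La.
have mab := m_ge _ _ a0 ab bT.
(* [pair] gives the identity for test functions; both sides are continuous in [q] for the $L^2$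
   norm, so density extends it. *)
move: (wdiv (w b) - wdiv (w a)) (fun phi => pair phi a b a0 ab bT Ha Hb) => g gE Lg.
apply/eqP; rewrite -subr_eq0 -normr_le0; apply/ler_addgt0Pr => e e0; rewrite add0r.
pose K := nrm g + (m b - m a) + 1.
have K0 : 0 < K by rewrite /K ltr_wpDl// addr_ge0// nrm_ge0.
have e'0 : 0 < e / K by rewrite divr_gt0.
have [phi Cphi hphi] := Ccinfty_dense mOm oOm fOm Lq e'0.
have Lphi := Ccinfty_L2 mOm Cphi; have Ld := L2B mOm Lq Lphi.
have -> : ip g q - \int[leb1]_(t in `[a, b]) ip (v' t) q =
   ip g (q - phi) - \int[leb1]_(t in `[a, b]) ip (v' t) (q - phi).
  have iq := integrable_sub_itv a0 bT (integrable_ipl mOm tv iv Lq).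
  have iphi := integrable_sub_itv a0 bT (integrable_ipl mOm tv iv Lphi).
  have -> : \int[leb1]_(t in `[a, b]) ip (v' t) (q - phi) =
     \int[leb1]_(t in `[a, b]) ip (v' t) q - \int[leb1]_(t in `[a, b]) ip (v' t) phi.
    rewrite -RintegralB//; apply: eq_Rintegral => t _; apply: ipBr => //; by case: tv.
  rewrite -(gE _ Cphi) (ipBr mOm Lq Lphi Lg).
  by move: (ip g q) (ip g phi) (\int[leb1]_(t in `[a, b]) ip (v' t) q) => x y z; ring.
apply: (le_trans (ler_normB _ _)).
have h1 := ip_CS mOm Lg Ld; have h2 := ipv _ _ _ a0 ab bT Ld.
have h3 : nrm (q - phi) * K <= e by rewrite -ler_pdivlMr// ltW.
apply: (le_trans (lerD h1 h2)); rewrite -mulrDl mulrC; apply: le_trans h3.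
by apply: ler_wpM2l; [exact: nrm_ge0|rewrite /K lerDl].
Qed.

End weak_divergence_in_time.

Lemma ler_sum_term (R : numDomainType) (I : finType) (F : I -> R) i :
  (forall j, 0 <= F j) -> F i <= \sum_j F j.
Proof. by move=> F0; rewrite (bigD1 i)//= lerDl sumr_ge0. Qed.

Section almost_everywhere.
Context d (S : measurableType d) (R : realType) (mu : {measure set S -> \bar R}).

Lemma null_set_ae (P : S -> Prop) (M : set S) : measurable M -> mu M = 0 ->
  (forall t, ~ M t -> P t) -> {ae mu, forall t, P t}.
Proof.
move=> mM M0 H; exists M; split => // t /= nP; apply: contrapT => nM; apply: nP; exact: H.
Qed.

Lemma ae_and (P P' : S -> Prop) : {ae mu, forall t, P t} -> {ae mu, forall t, P' t} ->
  {ae mu, forall t, P t /\ P' t}.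
Proof. by move=> h1 h2; apply: filterS2 h1 h2. Qed.

End almost_everywhere.

(** * The energy inequality *)

Section energy_inequality.
Context (R : realType) (d : nat) (Om : set 'rV[R]_d) (oOm : open Om) (bOm : bounded_set Om).
Local Notation E := 'rV[R]_d.
Local Notation leb1 := (@lebesgue_measure R).
Local Notation RM := (measurableTypeR R).
Local Notation L2 := (L2 Om).
Local Notation ip := (ip Om).
Local Notation nrm := (nrm Om).
Local Notation wdiv := (wdiv Om).
Let mOm : measurable Om := open_measurable_rV oOm.

Lemma vnrm_sqr (v : 'I_d -> E -> R) : vnrm Om v ^+ 2 = \sum_i nrm (v i) ^+ 2.
Proof.
rewrite sqr_sqrtr; first by apply: eq_bigr => i _; rewrite nrm_sqr.
by apply: sumr_ge0 => i _; exact: ip_ge0.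
Qed.

Lemma nrm_le_vnrm (v : 'I_d -> E -> R) i : nrm (v i) <= vnrm Om v.
Proof.
apply: ler_wsqrtr; apply: (@ler_sum_term R _ (fun i => ip (v i) (v i)) i) => k; exact: ip_ge0.
Qed.

Lemma gradip_ge0 (v : 'I_d -> E -> R) : 0 <= gradip Om v v.
Proof. by apply: sumr_ge0 => i _; apply: sumr_ge0 => j _; exact: ip_ge0. Qed.

Lemma gradnrm_sqr (v : 'I_d -> E -> R) : gradnrm Om v ^+ 2 = gradip Om v v.
Proof. by rewrite sqr_sqrtr// gradip_ge0. Qed.

Lemma nrm_wpd_le_gradnrm (v : 'I_d -> E -> R) i j : nrm (wpd Om j (v i)) <= gradnrm Om v.
Proof.
pose G i j := ip (wpd Om j (v i)) (wpd Om j (v i)).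
have G0 k l : 0 <= G k l by exact: ip_ge0.
apply: ler_wsqrtr; apply: (@le_trans _ _ (\sum_j G i j)).
  exact: (@ler_sum_term R _ (G i) j).
by apply: (@ler_sum_term R _ (fun i => \sum_j G i j) i) => k; exact: sumr_ge0.
Qed.

Lemma X_0 : X Om 0.
Proof.
move=> i; split.
  by have := Ccinfty_H1 oOm (Ccinfty0 Om).
exists (fun=> 0); split; first by move=> n; exact: Ccinfty0.
rewrite (_ : (fun n => _) = cst 0); first exact: cvg_cst.
apply/funext => n; rewrite subr0.
apply/eqP; rewrite -sqrf_eq0 H1nrm_sqr; apply/eqP.
have H0 := Ccinfty_H1 oOm (Ccinfty0 Om).
have w0 j : nrm (wpd Om j (0 : E -> R)) = 0.
  have [Lw Hw] := H1_wpd j H0.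
  have wz : is_wpd Om j 0 0 by move=> phi Cphi; rewrite !ip0l oppr0.
  by have := is_wpd_unique oOm bOm Lw (L2_0 Om) Hw wz; rewrite subr0.
by rewrite nrm0 expr0n/= add0r big1// => j _; rewrite w0 expr0n.
Qed.

(** F v <= D |grad v| by definition of the dual norm D, and then nu^-1 (D - nu |grad v|)^2 >= 0. *)
Lemma dual_young (nu : R) F v : (0 < d)%N -> 0 < nu -> Hm1 Om F -> X Om v ->
  ((2 * F v)%:E <= (nu^-1)%:E * dualnrm Om F ^+ 2 + (nu * gradnrm Om v ^+ 2)%:E)%E.
Proof.
move=> d0 nu0 [linF aeF dF] Xv.
have g0 : 0 <= gradnrm Om v by rewrite sqrtr_ge0.
(* Fields that vanish almost everywhere are excluded from the supremum in [dualnrm]; for them F v =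
   F 0 = 0, as [F] respects a.e. classes. *)
have [vz|vnz] := pselect (forall i, ae_eq_on Om (v i) (fun=> 0)).
  have F0 : F 0 = 0.
    have := linF 1 0 0 X_0 X_0; rewrite scaler0 addr0 mul1r => h.
    by apply: (addrI (F 0)); rewrite addr0 -h.
  have Fv : F v = F 0 by exact: (aeF v 0 Xv X_0 vz).
  rewrite Fv F0 mulr0; apply: adde_ge0; last by rewrite lee_fin mulr_ge0 ?sqr_ge0// ltW.
  rewrite mule_ge0 ?lee_fin ?invr_ge0 ?(ltW nu0)// expe2.
  by case: (dualnrm Om F) => [r| |]; rewrite ?mulyy ?mulNyNy// lee_fin -expr2 sqr_ge0.
have gp : 0 < gradnrm Om v.
  rewrite lt_neqAle g0 andbT eq_sym; apply/eqP => gz; apply: vnz => i.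
  (* A vanishing gradient norm would make every component zero, by the Poincare inequality in the
     first coordinate direction. *)
  have [C C0 HC] := H10_poincare oOm bOm.
  have := HC (Ordinal d0) (v i) (Xv i).
  have wz : nrm (wpd Om (Ordinal d0) (v i)) = 0.
    by apply/eqP; rewrite eq_le nrm_ge0 andbT -gz nrm_wpd_le_gradnrm.
  rewrite wz mulr0 => nz; apply: (nrm_eq0 mOm).
    by have [[]] := Xv i.
  by apply/eqP; rewrite eq_le nz nrm_ge0.
have le : ((F v / gradnrm Om v)%:E <= dualnrm Om F)%E.
  by apply: ereal_sup_ubound; exists v.
move: dF le; case: (dualnrm Om F) => [D| |]//= _.
rewrite lee_fin ler_pdivrMr// => FD.
rewrite -!EFinM -EFinD lee_fin -expr2.
move: FD g0; move: (F v) (gradnrm Om v) => x g FD g0.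
have h : 0 <= nu^-1 * (D - nu * g) ^+ 2 by rewrite mulr_ge0 ?sqr_ge0// invr_ge0 ltW.
have E1 : nu^-1 * (D - nu * g) ^+ 2 = nu^-1 * D ^+ 2 + nu * g ^+ 2 - 2 * (D * g).
  by field; rewrite gt_eqF.
rewrite E1 in h; lra.
Qed.

(** Each partial derivative has mean zero. This is what makes p an admissible test function for the
    continuity equation. *)
Lemma wdiv_mean v : X Om v -> ip (wdiv v) (cst 1) = 0.
Proof.
move=> Xv; have [_ Lw /(ip_eq_nrmB0 oOm Lw) H] := X_wdiv oOm bOm Xv.
have Lp i : L2 (wpd Om i (v i)) by have [H1v _] := Xv i; have [] := H1_wpd i H1v.
have L1 := L2_cst1 oOm bOm.
rewrite H//; last by apply: L2_sum.
rewrite ip_suml//; apply: big1 => i _; exact: (H10_wpd_mean oOm bOm).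
Qed.

(* Testing the momentum equation with [w] and the continuity equation with [p]. *)
Lemma pointwise_energy (nu alpha beta : R) (f : ('I_d -> E -> R) -> R) w wt l p p' wdt lt :
  (d = 2%N \/ d = 3%N) -> 0 < nu -> 0 < alpha ^+ 2 -> Hm1 Om f -> X Om w -> Q Om l -> Q Om lt ->
  L2 wdt ->
  p = (2 * beta) *: wdiv w + l -> p' = (2 * beta) *: wdt + lt ->
  (forall v, X Om v -> vip Om wt v + bstar Om w w v + nu * gradip Om w v
        - ip l (wdiv v) = f v) ->
  (forall q, Q Om q -> ip (lt + (2 * beta) *: wdt + alpha ^+ 2 *: wdiv w) q = 0) ->
  ((nu * gradnrm Om w ^+ 2 + 4 * beta * nrm (wdiv w) ^+ 2)%:E
   + (2 * (vip Om wt w + alpha ^- 2 * ip p' p))%:E <= (nu^-1)%:E * dualnrm Om f ^+ 2)%E.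
Proof.
move=> d23 nu0 al0 hf Xw [Ll ml] [Llt _] Lwdt pE p'E mom con.
have d0 : (0 < d)%N by case: d23 => ->.
have [_ Ldw _] := X_wdiv oOm bOm Xw.
have L1 := L2_cst1 oOm bOm.
have Lp : L2 p by rewrite pE; exact: L2_lin.
have Qp : Q Om p.
  split=> //; rewrite Rintegral_ip1 pE (ipDl mOm (L2Z mOm _ Ldw) Ll L1) (ipZl mOm _ Ldw L1).
  by rewrite wdiv_mean// mulr0 add0r -Rintegral_ip1.
have := con p Qp; rewrite (addrC lt) -p'E.
have Lp' : L2 p' by rewrite p'E; exact: L2_lin.
rewrite (ipDl mOm Lp' (L2Z mOm _ Ldw) Lp) (ipZl mOm _ Ldw Lp) => h1.
(* The second term is the pressure work of the momentum equation and cancels against it; the first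
   produces 4 beta |div w|^2. *)
have h2 : ip (wdiv w) p = 2 * beta * nrm (wdiv w) ^+ 2 + ip l (wdiv w).
  by rewrite pE (ipDr mOm (L2Z mOm _ Ldw) Ll Ldw) (ipZr mOm _ Ldw Ldw) nrm_sqr [ip _ l]ipC.
have := mom w Xw; rewrite (bstar_eq0 d23 oOm bOm Xw) addr0 => h3.
have h4 := dual_young d0 nu0 hf Xw; rewrite gradnrm_sqr in h4 *.
suff E1 : nu * gradip Om w w + 4 * beta * nrm (wdiv w) ^+ 2 +
    2 * (vip Om wt w + alpha ^- 2 * ip p' p) = 2 * f w - nu * gradip Om w w.
  by rewrite -EFinD E1 EFinB leeBlDr.
rewrite -h3; move: h1; rewrite h2.
move: (ip p' p) (vip Om wt w) (gradip Om w w) (ip l (wdiv w)) (nrm (wdiv w) ^+ 2) => a b c e g h1.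
have -> : a = - (alpha ^+ 2 * (2 * beta * g + e)) by apply/eqP; rewrite -subr_eq0 opprK h1.
have a0 : alpha != 0 by apply: contraTneq al0 => ->; rewrite expr0n ltxx.
by field.
Qed.

(** The defining identity only involves integrals, so both fields have the same weak divergences. It
    compares [w 0] with the initial datum, known to agree only almost everywhere. *)
Lemma wdiv_ae_eq (u v : 'I_d -> E -> R) : Hdiv Om u -> vL2 Om v ->
  (forall i, ae_eq_on Om (u i) (v i)) -> Hdiv Om v /\ nrm (wdiv u - wdiv v) = 0.
Proof.
move=> Hu Lv uv; have [Ldu Du] := Hdiv_wdiv Hu; have [Lu _] := Hu.
have Dv : is_wdiv Om v (wdiv u).
  move=> phi Cphi; rewrite -Du//; apply: eq_bigr => i _.
  have [mp _] : L2 (pderiv [:: i] phi) by exact: Ccinfty_L2 (Ccinfty_pderiv _ Cphi).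
  have [mu_ _] := Lu i; have [mv _] := Lv i.
  apply: ae_eq_ip => //; last by apply: aeW.
  by have := uv i; apply: filterS => x h Ox; rewrite h.
have Hv : Hdiv Om v by split => //; exists (wdiv u).
split => //; have [Ldv Dv'] := Hdiv_wdiv Hv.
exact: (is_wdiv_unique oOm bOm Ldu Ldv Dv Dv').
Qed.

End energy_inequality.

Theorem theorem4p1 (R : realType) (d : nat) (hd : d = 2%N \/ d = 3%N)
    (Om : set 'rV[R]_d) (hOm : regular_bounded_domain Om)
    (T nu alpha beta : R)
    (hT : 0 < T) (hnu : 0 < nu) (halpha : 0 < alpha ^+ 2) (hbeta : 0 < beta)
    (f : R -> ('I_d -> 'rV[R]_d -> R) -> R)
    (hf : bochner_L2 (Hm1 Om) (dualnrm Om) T f)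
    (w0 : 'I_d -> 'rV[R]_d -> R) (l0 : 'rV[R]_d -> R)
    (w : R -> 'I_d -> 'rV[R]_d -> R) (l : R -> 'rV[R]_d -> R)
    (hsol : solution Om T nu alpha beta f w0 l0 w l) :
  ((vnrm Om (w T) ^+ 2
     + alpha ^- 2 * nrm Om (l T + (2 * beta) *: wdiv Om (w T)) ^+ 2)%:E
   + \int[lebesgue_measure]_(t in `[0%R, T])
       (nu * gradnrm Om (w t) ^+ 2
        + 4 * beta * nrm Om (wdiv Om (w t)) ^+ 2)%:E
   <= \int[lebesgue_measure]_(t in `[0%R, T])
        ((nu^-1)%:E * dualnrm Om (f t) ^+ 2)
      + (vnrm Om w0 ^+ 2
         + alpha ^- 2 * nrm Om (l0 + (2 * beta) *: wdiv Om w0) ^+ 2)%:E)%E.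
Proof.
have [oOm _ _ bOm _] := hOm.
have mOm := open_measurable_rV oOm.
have [wt [lt [[aX _ _] bwt dwt aHdiv bdiv [aQ _ _] blt dlt cw cl [Lw0 iw] [Ll0 il0] amom acon]]] := hsol.
have [aHm1 _ _] := hf.
have mI := measurable_segment (0 : R) T.
(* Representatives of the components of [wt] that simple functions approximate at every time, as
   [AC] requires. *)
have /choice[w' w'P] : forall i, exists u', AC Om T (w ^~ i) u' /\
    {ae @lebesgue_measure R, forall t, 0 <= t <= T -> u' t = wt t i}.
  move=> i.
  have LN v : ((nrm Om ((fun v : 'I_d -> 'rV[R]_d -> R => v i) v))%:E <= (vnrm Om v)%:E)%E.
    by rewrite lee_fin nrm_le_vnrm.
  have [u' [tu iu [M [mM M0 MP]]]] := bochner_L2_tmeas mOm (L := fun v => v i)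
    (fun _ _ _ => erefl) (fun v Lv => Lv i) LN bwt.
  exists u'; split; last by apply: (null_set_ae mM M0) => t nM tT; have [] := MP t tT nM.
  by apply: (time_derivative_AC mOm hT (dwt i) (cw i) tu iu mM M0) => t tT nM; have [] := MP t tT nM.
have [v' [tv iv [Mv [mMv Mv0 MvP]]]] := bochner_L2_tmeas mOm (L := id)
    (fun _ _ _ => erefl) (fun v Lv => Lv) (fun=> lexx _) bdiv.
have [l' [tl il [Ml [mMl Ml0 MlP]]]] := bochner_L2_tmeas mOm (L := id)
    (fun _ _ _ => erefl) (fun v Lv => proj1 Lv) (fun=> lexx _) blt.
have acl : AC Om T l l'.
  by apply: (time_derivative_AC mOm hT dlt cl tl il mMl Ml0) => t tT nM; have [] := MlP t tT nM.
have a1 : {ae @lebesgue_measure R, forall t, forall i, 0 <= t <= T -> w' i t = wt t i}.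
  by apply: filter_forall => i; have [] := w'P i.
have a2 : {ae @lebesgue_measure R, forall t, 0 <= t <= T -> v' t = wdiv Om (wt t)}.
  by apply: (null_set_ae mMv Mv0) => t nM tT; have [] := MvP t tT nM.
have a3 : {ae @lebesgue_measure R, forall t, 0 <= t <= T -> l' t = lt t /\ Q Om (lt t)}.
  by apply: (null_set_ae mMl Ml0) => t nM tT; have [] := MlP t tT nM.
(* The equations hold for 0 < t <= T while the integrals run over [0, T]; time 0 is put into the
   null set. *)
have a4 : {ae @lebesgue_measure R, forall t : R, t <> 0}.
  apply: (@null_set_ae _ _ R lebesgue_measure _ [set 0]) => //; exact: lebesgue_measure_set1.
have [M [mM M0 MP]] := ae_and a1 (ae_and a2 (ae_and a3 (ae_and a4 (ae_and aHdiv
  (ae_and aX (ae_and aQ (ae_and aHm1 (ae_and amom acon)))))))).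
have good t : 0 <= t <= T -> ~ M t ->
    [/\ forall i, w' i t = wt t i, v' t = wdiv Om (wt t), l' t = lt t & Q Om (lt t)] /\
    [/\ Hdiv Om (wt t), X Om (w t), Q Om (l t) & Hm1 Om (f t)] /\
    (forall v, X Om v -> vip Om (wt t) v + bstar Om (w t) (w t) v + nu * gradip Om (w t) v
        - ip Om (l t) (wdiv Om v) = f t v) /\
    (forall q, Q Om q ->
      ip Om (lt t + (2 * beta) *: wdiv Om (wt t) + alpha ^+ 2 *: wdiv Om (w t)) q = 0).
  move=> tT nM; apply: contrapT => h; apply: nM; apply: MP => /=.
  move=> [h1 [h2 [h3 [h4 [h5 [h6 [h7 [h8 [h9 h10]]]]]]]]]; apply: h.
  have [e1 e2] := h3 tT; have t0T : 0 < t <= T.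
    by move: tT => /andP[t0 ->]; rewrite andbT lt_neqAle t0 andbT eq_sym; exact/eqP.
  by split; [split|split; [split|split]]; auto.
(* This yields a weak divergence of [w] at every time, in particular at 0 and T, where the final
   inequality evaluates it. *)
have [|allH acdiv] := @AC_wdiv R d Om oOm bOm T w w' v' M hT (fun i => (w'P i).1) tv iv mM M0.
  move=> t tT nM; have [[e1 -> _ _] [[Hwt Xw _ _] _]] := good t tT nM; split.
    by have [] := X_wdiv oOm bOm Xw.
  have [_ Dwt] := Hdiv_wdiv Hwt => phi Cphi; rewrite -Dwt//.
  by apply: eq_bigr => i _; rewrite e1.
pose p t := (2 * beta) *: wdiv Om (w t) + l t.
pose p' t := (2 * beta) *: v' t + l' t.
have acp : AC Om T p p' := AC_lin mOm (2 * beta) acdiv acl.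
have T0 := ltW hT.
have ipp := AC_integrable_ip mOm T0 acp.
have [iww Eww] := Rintegral_sum (index_enum 'I_d) mI (fun i => AC_integrable_ip mOm T0 (w'P i).1).
(* The time derivative of |w|^2 + alpha^-2 |p|^2, written with the measurable representatives so
   that it is integrable. *)
pose G t := 2 * (\sum_i ip Om (w' i t) (w t i) + alpha ^- 2 * ip Om (p' t) (p t)).
have iG : lebesgue_measure.-integrable `[0, T] (EFin \o G).
  apply: (integrable_mull 2 mI); apply: (integrable_addr mI iww); exact: integrable_mull.
have EG : \int[lebesgue_measure]_(t in `[0, T]) G t =
    (vnrm Om (w T) ^+ 2 + alpha ^- 2 * nrm Om (p T) ^+ 2) -
    (vnrm Om (w 0) ^+ 2 + alpha ^- 2 * nrm Om (p 0) ^+ 2).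
  have ep := AC_energy mOm T0 acp.
  have ew : vnrm Om (w T) ^+ 2 - vnrm Om (w 0) ^+ 2 =
     2 * \int[lebesgue_measure]_(t in `[0, T]) (\sum_i ip Om (w' i t) (w t i)).
    rewrite Eww !vnrm_sqr -sumrB mulr_sumr; apply: eq_bigr => i _.
    exact: (AC_energy mOm T0 (w'P i).1).
  rewrite /G RintegralZl//; last first.
    by apply: (integrable_addr mI iww); exact: integrable_mull.
  rewrite RintegralD//; last exact: integrable_mull.
  rewrite RintegralZl// mulrDr -ew mulrCA -ep.
  by move: (vnrm Om _ ^+ 2) (vnrm Om _ ^+ 2) (nrm Om _ ^+ 2) (nrm Om _ ^+ 2) => x y z u; ring.
have main : (\int[lebesgue_measure]_(t in `[0%R, T])
       (nu * gradnrm Om (w t) ^+ 2 + 4 * beta * nrm Om (wdiv Om (w t)) ^+ 2)%:E +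
    ((vnrm Om (w T) ^+ 2 + alpha ^- 2 * nrm Om (p T) ^+ 2) -
     (vnrm Om (w 0) ^+ 2 + alpha ^- 2 * nrm Om (p 0) ^+ 2))%:E <=
    \int[lebesgue_measure]_(t in `[0%R, T]) ((nu^-1)%:E * dualnrm Om (f t) ^+ 2))%E.
  rewrite -EG; apply: (nonmeas_integral_add_le mI _ mM M0 _ _ iG).
  - have := @lebesgue_measure_itv R `[0, T]%R; rewrite /= lte_fin hT -EFinB => E0.
    by apply: le_lt_trans (ltry (T - 0)); rewrite -E0.
  - move=> t _; rewrite lee_fin; apply: addr_ge0; apply: mulr_ge0; rewrite ?sqr_ge0 ?ltW//.
    by rewrite mulr_gt0.
  - move=> t _; apply: mule_ge0; first by rewrite lee_fin invr_ge0 ltW.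
    by rewrite expe2; case: (dualnrm _ _) => [r| |]; rewrite ?mulyy ?mulNyNy// lee_fin -expr2 sqr_ge0.
  - move=> t; rewrite /= in_itv/= => tT nM.
    have [[e1 e2 e3 Qlt] [[Hwt Xw Ql Hf] [mom con]]] := good t tT nM.
    have [Lwdt _] := Hdiv_wdiv Hwt.
    have -> : G t = 2 * (vip Om (wt t) (w t) + alpha ^- 2 * ip Om (p' t) (p t)).
      rewrite /G; congr (2 * (_ + _)); apply: eq_bigr => i _; by rewrite e1.
    apply: (pointwise_energy oOm bOm hd hnu halpha Hf Xw Ql Qlt Lwdt _ _ mom con) => //.
    by rewrite /p' e2 e3.
have I0 : (0 : R) <= 0 <= T by rewrite lexx T0.
(* The initial data enter only through norms, which do not see the null sets on which they may
   differ from [w 0] and [l 0]. *)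
have Ew0 : vnrm Om (w 0) ^+ 2 = vnrm Om w0 ^+ 2.
  rewrite !vnrm_sqr; apply: eq_bigr => i _; congr (_ ^+ 2).
  by apply: (ae_eq_nrm mOm _ (Lw0 i) (iw i)); have [] := cw i 0 I0.
have Ep0 : nrm Om (p 0) = nrm Om (l0 + (2 * beta) *: wdiv Om w0).
  have [Hw0 /nrmB0_ae_eq] := wdiv_ae_eq oOm bOm (allH 0 I0) Lw0 iw.
  have [Ld0 _] := Hdiv_wdiv Hw0; have [Ld _] := Hdiv_wdiv (allH 0 I0).
  move=> /(_ mOm Ld Ld0) aed.
  apply: (ae_eq_nrm mOm).
  - by have [Lp _ _ _] := acp; exact: Lp.
  - by apply: L2D => //; exact: L2Z.
  - by apply: filterS2 aed il0 => x h1 h2 Ox; rewrite /p addrC !fctE h1// h2.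
(* The initial energy is finite, so it can be moved to the other side in the extended reals, where
   the right integral may be infinite. *)
rewrite (addrC (l T)) -/(p T) -Ep0 -Ew0.
have := leeD2r (vnrm Om (w 0) ^+ 2 + alpha ^- 2 * nrm Om (p 0) ^+ 2)%:E main.
by rewrite -addeA -EFinD subrK [in X in (X <= _)%E -> _]addeC.
Qed.
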